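(* Let $\Omega\subset\mathbb R^d$ be open, $\omega\in\mathcal W$. If $g=[(g_\varepsilon)]\in\mathcal G^{\{\omega\},\infty}(\Omega)$ is such that for all $\rho\in\mathcal D^{\{\omega\}}(\Omega)$ the net of numbers $(\langle g_\varepsilon,\rho\rangle)$ is Roumieu negligible, i.e. there is $l>0$ (depending on $\rho$) with $\langle g_\varepsilon,\rho\rangle=o(e^{-l\omega(1/\varepsilon)})$ as $\varepsilon\to0^+$, then $g=0$.
   Context: $\mathbb R^+=[0,\infty)$. $\mathcal W$ is the set of all nondecreasing continuous functions $\omega:\mathbb R^+\to\mathbb R^+$ such that $\omega(0)=0$; $\omega(x+y)\le\omega(x)+\omega(y)$ for all $x,y\ge 0$; $\int_1^\infty \frac{\omega(t)}{t^2}\,dt<\infty$; and $\lim_{t\to\infty}\frac{\omega(t)}{\log(1+t)}=\infty$. For a compactly supported continuous $f$ on $\mathbb R^d$ and $l>0$: $\|f\|_l^{\omega}=\int|\hat f(\xi)|e^{l\omega(|\xi|)}d\xi\in[0,\infty]$. $\mathcal D^{\{\omega\}}(\Omega)$ is the set of continuous $f$ with compact support in $\Omega$ and $\|f\|_l^\omega<\infty$ for some $l>0$. $\mathcal E^{\{\omega\}}(\Omega)$ is the set of smooth $f:\Omega\to\mathbb C$ with $\psi f\in\mathcal D^{\{\omega\}}(\Omega)$ for all $\psi\in\mathcal D^{\{\omega\}}(\Omega)$; for compact $K\subset\Omega$, $\|f\|_{K,l}^{\omega}=\inf\{\|\psi f\|_l^{\omega}:\psi\in\mathcal D^{\{\omega\}}(\Omega),\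 \psi=1\text{ on }K\}$. Nets in $\mathcal E^{\{\omega\}}(\Omega)$ are indexed by $\varepsilon\in(0,1)$, $o(\cdot)$ is as $\varepsilon\to0^+$, $K$ ranges over compact subsets of $\Omega$. Moderate: $\forall K\,\forall k>0\,\exists h>0$: $\|g_\varepsilon\|_{K,h}^\omega=o(e^{k\omega(1/\varepsilon)})$. Negligible: $\forall K\,\exists k>0\,\exists h>0$: $\|g_\varepsilon\|_{K,h}^\omega=o(e^{-k\omega(1/\varepsilon)})$. $\mathcal G^{\{\omega\}}(\Omega)$ is the quotient of moderate by negligible nets. $g\in\mathcal G^{\{\omega\},\infty}(\Omega)$ (regular) means $g$ has a moderate representative with $\forall K\ \exists h>0\ \forall k>0$: $\|g_\varepsilon\|_{K,h}^\omega=o(e^{k\omega(1/\varepsilon)})$. $\langle g_\varepsilon,\rho\rangle=\int g_\varepsilon\rho$. *)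

(* Defs.v *)
From HB Require Import structures.
From mathcomp Require Import all_boot all_order all_algebra.
From mathcomp Require Import complex.
From mathcomp Require Import all_classical all_reals all_analysis.
Set Implicit Arguments.
Unset Strict Implicit.
Unset Printing Implicit Defensive.
Import Order.TTheory GRing.Theory Num.Theory.
Import numFieldNormedType.Exports.
Local Open Scope classical_set_scope.
Local Open Scope ring_scope.

Definition measure_rV_display : measure_display -> measure_display.
Proof. exact. Qed.

(* The sigma-algebra on 'rV_n generated by the coordinates (for R a realType
   this is the Borel sigma-algebra of R^n). *)
Section measurable_rV.
Context {R : realType} (n : nat).

Let coors (i : 'I_n) (v : 'rV[R]_n) : measurableTypeR R := v ord0 i.

Let rV_set0 : g_sigma_preimage coors set0.
Proof. exact: sigma_algebra0. Qed.

Let rV_setC A : g_sigma_preimage coors A -> g_sigma_preimage coors (~` A).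
Proof. exact: sigma_algebraC. Qed.

Let rV_bigcup (F : (set 'rV[R]_n)^nat) :
  (forall i, g_sigma_preimage coors (F i)) ->
  g_sigma_preimage coors (\bigcup_i (F i)).
Proof. exact: sigma_algebra_bigcup. Qed.

HB.instance Definition _ := @isMeasurable.Build
  (measure_rV_display default_measure_display)
  'rV[R]_n (g_sigma_preimage coors) rV_set0 rV_setC rV_bigcup.

Lemma measurable_rV_coord (i : 'I_n) :
  measurable_fun setT (fun v : 'rV[R]_n => v ord0 i : measurableTypeR R).
Proof.
move=> _ Y mY; rewrite setTI; apply: sub_sigma_algebra => /=.
rewrite -bigcup_seq/=; exists i => /=; first by rewrite mem_index_enum.
by exists Y => //; rewrite setTI.
Qed.

Lemma measurable_fun_rVP d (T : measurableType d) (f : T -> 'rV[R]_n) :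
  (forall i, measurable_fun setT (fun t => f t ord0 i : measurableTypeR R)) ->
  measurable_fun setT f.
Proof.
move=> mf _ A mA; rewrite setTI.
suff /(_ A mA) : g_sigma_preimage coors `<=`
  [set B | d.-measurable (f @^-1` B)] by [].
apply: smallest_sub.
  split => /=.
  - by rewrite preimage_set0.
  - by move=> B mB; rewrite setTD preimage_setC; exact: measurableC.
  - by move=> F mF; rewrite preimage_bigcup; exact: bigcup_measurable.
move=> B; rewrite -bigcup_seq => -[i _ [Y mY <-]] /=.
by rewrite setTI; have := mf i measurableT Y mY; rewrite setTI.
Qed.

End measurable_rV.

Definition consrV (R : realType) (n : nat) (p : measurableTypeR R * 'rV[R]_n) :
  'rV[R]_n.+1 := row_mx (const_mx p.1 : 'rV[R]_1) p.2.

Lemma consrV0 (R : realType) n (p : measurableTypeR R * 'rV[R]_n) :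
  consrV p ord0 ord0 = p.1.
Proof.
rewrite /consrV; have -> : (ord0 : 'I_n.+1) = lshift n (ord0 : 'I_1).
  exact/val_inj.
by rewrite [LHS]row_mxEl mxE.
Qed.

Lemma consrVS (R : realType) n (p : measurableTypeR R * 'rV[R]_n) i :
  consrV p ord0 (lift ord0 i) = p.2 ord0 i.
Proof.
rewrite /consrV; have -> : lift ord0 i = rshift 1 i by exact/val_inj.
by rewrite [LHS]row_mxEr.
Qed.

Lemma measurable_consrV (R : realType) n : measurable_fun setT (@consrV R n).
Proof.
apply: measurable_fun_rVP => i; have [->|[j ->]] : i = ord0 \/ exists j, i = lift ord0 j.
  by case: (unliftP ord0 i) => [j ->|->]; [right; exists j|left].
- under eq_fun do rewrite consrV0; exact: measurable_fst.
- under eq_fun do rewrite consrVS.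
  by apply: (measurableT_comp (measurable_rV_coord j)); exact: measurable_snd.
Qed.

Section lebesgue_cons.
Context {R : realType} {n : nat}.
Variable mu : {sigma_finite_measure set 'rV[R]_n -> \bar R}.

Definition lebesgue_cons : set 'rV[R]_n.+1 -> \bar R :=
  pushforward (@lebesgue_measure R \x mu)%E (@consrV R n).

Let lebesgue_cons0 : lebesgue_cons set0 = 0%E.
Proof. by rewrite /lebesgue_cons /pushforward preimage_set0 measure0. Qed.

Let lebesgue_cons_ge0 A : (0 <= lebesgue_cons A)%E.
Proof. exact: integral_ge0. Qed.

Let lebesgue_cons_sigma_additive : semi_sigma_additive lebesgue_cons.
Proof.
move=> F mF tF mUF; rewrite /lebesgue_cons /pushforward preimage_bigcup.
apply: measure_semi_sigma_additive.
- by move=> k; rewrite -[X in measurable X]setTI; exact: measurable_consrV.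
- apply/trivIsetP => /= i j _ _ ij; rewrite -preimage_setI.
  by move/trivIsetP : tF => /(_ _ _ _ _ ij) ->//; rewrite preimage_set0.
- rewrite -preimage_bigcup -[X in measurable X]setTI; exact: measurable_consrV.
Qed.

HB.instance Definition _ := isMeasure.Build _ _ _ lebesgue_cons
  lebesgue_cons0 lebesgue_cons_ge0 lebesgue_cons_sigma_additive.

Let unconsrV (v : 'rV[R]_n.+1) : measurableTypeR R * 'rV[R]_n :=
  (v ord0 ord0, \row_j v ord0 (lift ord0 j)).

Let consrVK : cancel (@consrV R n) unconsrV.
Proof.
move=> p; rewrite /unconsrV consrV0 [RHS]surjective_pairing; congr pair.
by apply/rowP => j; rewrite mxE consrVS.
Qed.

Let measurable_unconsrV : measurable_fun setT unconsrV.
Proof.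
apply/measurable_fun_pairP; split => /=; first exact: measurable_rV_coord.
apply: measurable_fun_rVP => j.
by under eq_fun do rewrite mxE; exact: measurable_rV_coord.
Qed.

Let lebesgue_cons_sigma_finite : sigma_finite setT lebesgue_cons.
Proof.
have /sigma_finiteP[F [TF ndF Foo]] := sigma_finiteT (@lebesgue_measure R).
have /sigma_finiteP[G [TG ndG Goo]] := sigma_finiteT mu.
exists (fun k => unconsrV @^-1` (F k `*` G k)).
  rewrite -preimage_bigcup -[LHS](preimage_setT unconsrV); congr (_ @^-1` _).
  rewrite -setXTT TF TG predeqE => -[x y]; split.
    move=> [/= [a _ Fax] [b _ Gby]]; exists (maxn a b) => //; split.
    - by move: x Fax; exact/subsetPset/ndF/leq_maxl.
    - by move: y Gby; exact/subsetPset/ndG/leq_maxr.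
  by move=> [a _ []/= ? ?]; split; exists a.
move=> k; have [mF Fk] := Foo k; have [mG Gk] := Goo k; split.
  rewrite -[X in measurable X]setTI; apply: measurable_unconsrV => //.
  exact: measurableX.
rewrite /lebesgue_cons /pushforward -comp_preimage.
rewrite (_ : _ \o _ = id); last by apply/funext => p /=; exact: consrVK.
by rewrite preimage_id product_measure1E// lte_mul_pinfty// ge0_fin_numE.
Qed.

HB.instance Definition _ := Measure_isSigmaFinite.Build _ _ _ lebesgue_cons
  lebesgue_cons_sigma_finite.

End lebesgue_cons.

(* Lebesgue measure on R^n, as the n-fold product of the Lebesgue measure on R
   (the Dirac mass when n = 0). *)
Fixpoint lebesgue_rV (R : realType) (n : nat) :
    {sigma_finite_measure set 'rV[R]_n -> \bar R} :=
  match n with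
  | 0 => \d_(0 : 'rV[R]_0)
  | m.+1 => lebesgue_cons (lebesgue_rV R m)
  end.

Lemma lebesgue_rV_box (R : realType) (n : nat)
    (A : 'I_n -> set (measurableTypeR R)) : (forall i, measurable (A i)) ->
  lebesgue_rV R n [set v | forall i, A i (v ord0 i)] =
  (\prod_(i < n) lebesgue_measure (A i))%E.
Proof.
elim: n A => [|n IHn] A mA.
  by rewrite big_ord0 /= diracE mem_set// => -[].
rewrite big_ord_recl /= -IHn// /lebesgue_cons /pushforward.
have -> : @consrV R n @^-1` [set v | forall i, A i (v ord0 i)] =
    A ord0 `*` [set v : 'rV[R]_n | forall i, A (lift ord0 i) (v ord0 i)].
  apply/seteqP; split=> p /=.
    by move=> Ap; split=> [|i]; [rewrite -consrV0|rewrite -consrVS].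
  move=> [Ap0 ApS] i; case: (unliftP ord0 i) => [j ->|->].
    by rewrite consrVS.
  by rewrite consrV0.
rewrite product_measure1E//.
have -> : [set v : 'rV[R]_n | forall i, A (lift ord0 i) (v ord0 i)] =
    \bigcap_(i in [set: 'I_n]) (fun v : 'rV[R]_n => v ord0 i) @^-1`
       A (lift ord0 i).
  by apply/seteqP; split=> v /= Av i; [move=> _|]; exact: Av.
apply: fin_bigcap_measurable => // i _.
by rewrite -[X in measurable X]setTI; exact: measurable_rV_coord.
Qed.

Section function_spaces.
Context {R : realType} {d : nat}.
Implicit Types (f psi rho : 'rV[R]_d -> R[i]) (omega : R -> R).
Implicit Types (Omega K : set 'rV[R]_d) (l : R).

(* The weight class W; only the values of omega on [0, +oo[ matter. *)
Record weight omega : Prop := {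
  weight_ge0 : forall t : R, 0 <= t -> 0 <= omega t ;
  weight_nondecreasing : forall s t : R, 0 <= s -> s <= t -> omega s <= omega t ;
  weight_continuous : {within `[0%R, +oo[, continuous omega} ;
  weight_0 : omega 0 = 0 ;
  weight_subadditive : forall s t : R, 0 <= s -> 0 <= t ->
    omega (s + t) <= omega s + omega t ;
  weight_integral : (\int[@lebesgue_measure R]_(t in `[1%R, +oo[)
    (omega t / t ^+ 2)%:E < +oo)%E ;
  weight_log : omega t / ln (1 + t) @[t --> +oo] --> +oo }.

(* The norm `|v| that the library puts on 'rV_d is the sup norm. *)
Definition euclidean_norm (v : 'rV[R]_d) : R :=
  Num.sqrt (\sum_(i < d) v ord0 i ^+ 2).

Definition dot (v w : 'rV[R]_d) : R := \sum_(i < d) v ord0 i * w ord0 i.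

Definition integralC f : R[i] :=
  ((\int[lebesgue_rV R d]_x complex.Re (f x))%R +i*
   (\int[lebesgue_rV R d]_x complex.Im (f x))%R)%C.

(* Normalisation: fourier f xi = \int f(x) exp(- i x.xi) dx. *)
Definition fourier f (xi : 'rV[R]_d) : R[i] :=
  integralC (fun x => f x * (cos (dot x xi) -i* sin (dot x xi))%C).

Definition wnorm omega l f : \bar R :=
  (\int[lebesgue_rV R d]_xi
    (Normc.normc (fourier f xi) * expR (l * omega (euclidean_norm xi)))%:E)%E.

Definition supp f : set 'rV[R]_d := closure [set x | f x != 0].

Definition test_function omega Omega f : Prop :=
  [/\ continuous (f : 'rV[R]_d -> R[i]^o), compact (supp f), supp f `<=` Omega &
      exists2 l : R, 0 < l & (wnorm omega l f < +oo)%E].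

(* u is k times continuously differentiable on the open set Omega: all iterated
   partial derivatives of order at most k exist and are continuous there. *)
Fixpoint Ck (k : nat) Omega (u : 'rV[R]_d -> R) : Prop :=
  (forall x, Omega x -> {for x, continuous u}) /\
  match k with
  | 0 => True
  | m.+1 => forall i : 'I_d,
      (forall x, Omega x -> derivable u x (delta_mx ord0 i)) /\
      Ck m Omega ('D_(delta_mx ord0 i) u)
  end.

Definition smooth Omega f : Prop :=
  forall k, Ck k Omega (fun x => complex.Re (f x)) /\
            Ck k Omega (fun x => complex.Im (f x)).

(* A function on the open set Omega is represented by a total function whose
   values outside Omega are irrelevant. In particular psi \* f is the extension
   by 0 of the product when the support of psi lies in Omega. *)
Definition ultradifferentiable omega Omega f : Prop :=
  smooth Omega f /\
  forall psi, test_function omega Omega psi ->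
    test_function omega Omega (psi \* f).

(* The infimum over an empty set is +oo. *)
Definition wnormK omega Omega K l f : \bar R :=
  ereal_inf [set wnorm omega l (psi \* f) | psi in
    [set psi | test_function omega Omega psi /\ forall x, K x -> psi x = 1]].

Definition pairing f rho : R[i] := integralC (f \* rho).

End function_spaces.

(* N e = o(phi e) as e --> 0+, for N with values in [0, +oo]. *)
Definition small_o (R : realType) (N : R -> \bar R) (phi : R -> R) : Prop :=
  forall c : R, 0 < c -> \forall e \near 0^'+, (N e <= (c * phi e)%:E)%E.

Section generalized_functions.
Context {R : realType} {d : nat}.
Variables (omega : R -> R) (Omega : set 'rV[R]_d).

Definition net := R -> 'rV[R]_d -> R[i].

Implicit Type g : net.

Definition ultradifferentiable_net g : Prop :=
  forall e : R, 0 < e < 1 -> ultradifferentiable omega Omega (g e).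

Definition moderate_net g : Prop :=
  ultradifferentiable_net g /\
  forall K : set 'rV[R]_d, compact K -> K `<=` Omega -> forall k : R, 0 < k ->
    exists2 h : R, 0 < h & small_o (fun e => wnormK omega Omega K h (g e))
                               (fun e => expR (k * omega e^-1)).

Definition negligible_net g : Prop :=
  ultradifferentiable_net g /\
  forall K : set 'rV[R]_d, compact K -> K `<=` Omega -> exists2 k : R, 0 < k &
    exists2 h : R, 0 < h & small_o (fun e => wnormK omega Omega K h (g e))
                               (fun e => expR (- k * omega e^-1)).

(* The class of g in the quotient of the moderate by the negligible nets. *)
Definition gen_class g : set net :=
  [set g' | moderate_net g' /\ negligible_net (fun e => g e \- g' e)].

Definition gen_functions : set (set net) := [set gen_class g | g in moderate_net].

Definition gen_zero : set net := gen_class (fun _ _ => 0).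

Definition regular_net g : Prop :=
  forall K : set 'rV[R]_d, compact K -> K `<=` Omega -> exists2 h : R, 0 < h &
    forall k : R, 0 < k -> small_o (fun e => wnormK omega Omega K h (g e))
                               (fun e => expR (k * omega e^-1)).

Definition regular_gen_functions : set (set net) :=
  [set G | gen_functions G /\ exists2 g, G g & regular_net g].

(* For nets of numbers, indexed by e in ]0, 1[. *)
Definition negligible_numbers (z : R -> R[i]) : Prop :=
  exists2 l : R, 0 < l & small_o (fun e => (Normc.normc (z e))%:E)
                             (fun e => expR (- l * omega e^-1)).

End generalized_functions.

(* Main.v *)
Require Import Defs.
From mathcomp Require Import all_boot all_order all_algebra.
From mathcomp Require Import complex.
From mathcomp Require Import all_classical all_reals all_analysis.
From mathcomp Require Import measurable_realfun ring lra.
Import Order.TTheory GRing.Theory Num.Theory.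
Import numFieldNormedType.Exports.
Local Open Scope classical_set_scope.
Local Open Scope ring_scope.
Set Implicit Arguments.
Unset Strict Implicit.
Unset Printing Implicit Defensive.

(** Write [Lambda = omega(1/e)] and let [g_e] be a representative for which one weight [exp(h omega)]
    works at every rate [k]. It suffices to prove that this representative is negligible: it differs
    from the given one by a negligible net, so its pairings with test functions are negligible too
    ([pairing_le_wnormK]).

    Fix a compact set [K] and a test function [chi] equal to 1 on it ([cutoff_exists]), and let [F_e]
    be the Fourier transform of [chi g_e]. Two bounds are available.

    - Regularity says that the integral of [|F_e| exp(h omega)] is at most [exp(j Lambda)] for every
      [j > 0] and small [e].
    - The values [F_e(xi)] are the pairings of [g_e] with [chi exp(- i x.xi)], so each of them is
      negligible. The rate may depend on [xi], but a gliding hump argument makes it uniform: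
      [|F_e(xi)| <= C exp(- k Lambda) exp(a omega(|xi|))] ([uniform_fourier_bound]). If this failed for
      all [k], one could choose frequencies and small coefficients such that [chi] times the
      corresponding trigonometric series is still a test function ([modulated_test_function]) but pairs
      with [g_e] in a way that is not negligible ([gliding_hump]).

    Interpolating them ([interpolation_le]), the second bound wins where [omega(|xi|)] is at most a
    small multiple of [Lambda], and elsewhere part of the weight [exp(h omega)] turns into decay in
    [Lambda]. Since [omega] dominates the logarithm, [exp(- omega(|xi|))] is integrable
    ([integral_wexpN_lty]), and integration bounds [|F_e| exp(h omega / 2)] by a negative exponential of
    [Lambda] ([regular_negligible]).

    Norms over [K] are infima over cutoffs that may vary with [e]. To replace them by one fixed cutoff
    ([wnorm_le_wnormK]) one needs the norm of a product bounded by the product of the norms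
    ([wnorm_mul]), that is, the transform of a product as a convolution ([fourier_mul]). This rests on
    Fourier inversion for compactly supported continuous functions with integrable transform
    ([fourier_inversion]), proved by Fejer summation: the hat function has a nonnegative integrable
    cosine transform, and its tensor powers give an approximate identity on R^n. *)

(** * Lebesgue measure: affine maps, continuous functions, products *)

Lemma measurable_line_affine (R : realType) (a b : R) :
  measurable_fun setT (fun x : measurableTypeR R => a * x + b : measurableTypeR R).
Proof. by apply: measurable_funD => //; apply: measurable_funM. Qed.

(** Both sides are measures in [A], and they agree on half-open intervals. *)
Lemma lebesgue_measure_affine (R : realType) (a b : R) (A : set R) :
  0 < a -> measurable A ->
  (a%:E * lebesgue_measure ((fun x => a * x + b)%R @^-1` A) =
   @lebesgue_measure R A)%E.
Proof.
move=> a0 mA.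
pose phi : measurableTypeR R -> measurableTypeR R := fun x => a * x + b.
have mphi : measurable_fun setT phi by exact: measurable_line_affine.
pose m := mscale (NngNum (ltW a0)) (pushforward (@lebesgue_measure R) phi).
transitivity (m mphi A); first by [].
apply/esym/lebesgue_measure_unique => // _ [[c d]] _ <-.
have phiE : phi @^-1` `]c, d] = `](c - b) / a, (d - b) / a]%classic.
  apply/seteqP; split=> x /=; rewrite !in_itv/= /phi;
  by rewrite ltr_pdivrMr// ler_pdivlMr// ltrBlDr lerBrDr mulrC.
rewrite [RHS]/= /m /mscale /= /pushforward; move: phiE; rewrite /phi => ->.
rewrite !lebesgue_measure_itv/= !lte_fin ltr_pM2r ?invr_gt0// ltrD2r.
case: ifPn => _; last by rewrite mule0.
by rewrite -!EFinB -EFinM; congr EFin; field; rewrite gt_eqF.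
Qed.

Lemma ge0_integral_affine1 (R : realType) (a b : R) (f : R -> \bar R) :
  a != 0 -> measurable_fun setT f -> (forall x, (0 <= f x)%E) ->
  (\int[@lebesgue_measure R]_x f (a * x + b)%R =
   `|a|^-1%:E * \int[@lebesgue_measure R]_x f x)%E.
Proof.
wlog a0 : a b f / 0 < a.
  move=> W; move: (a) => c; rewrite neq_lt => /orP[c0|c0] mf f0; last first.
    by apply: W => //; rewrite gt_eqF.
  have mN : measurable_fun setT (fun x : measurableTypeR R => - x : measurableTypeR R).
    exact: oppr_measurable.
  (* a reflection changes the sign of the slope *)
  have E (g : R -> \bar R) : measurable_fun setT g -> (forall x, (0 <= g x)%E) ->
      (\int[@lebesgue_measure R]_x g x = \int[@lebesgue_measure R]_x g (- x)%R)%E.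
    move=> mg g0.
    transitivity (\int[pushforward (@lebesgue_measure R)
       (-%R : _ -> measurableTypeR R)]_x g x)%E.
      by apply: eq_measure_integral => //= A mA _; exact/esym/lebesgue_measureN.
    by rewrite ge0_integral_pushforward.
  rewrite [LHS]E; last 2 first.
  - apply: (measurableT_comp mf).
    by apply: measurable_funD => //; apply: measurable_funM.
  - by move=> x; exact: f0.
  under eq_integral do rewrite mulrN -mulNr.
  rewrite (W (- c) b f) ?oppr_gt0//; first by rewrite normrN.
  by rewrite gt_eqF// oppr_gt0.
move=> _ mf f0.
have mphi := measurable_line_affine a b.
have P := ge0_integral_pushforward mphi (@lebesgue_measure R) measurableT mf
  (fun x _ => f0 x).
rewrite preimage_setT in P; rewrite -[LHS]P.
have ai0 : 0 <= `|a|^-1 by rewrite invr_ge0.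
rewrite -(ge0_integral_mscale _ _ (NngNum ai0))//.
apply: eq_measure_integral => //= A mA _.
rewrite /mscale/= -(lebesgue_measure_affine b a0 mA) gtr0_norm// muleA -EFinM.
by rewrite mulVf ?gt_eqF// mul1e.
Qed.

(** Lebesgue measure on R^(n+1) is the image of a product measure, so this is Tonelli's
    theorem; it drives the inductions on the dimension. *)
Lemma ge0_integral_rVS (R : realType) (n : nat) (f : 'rV[R]_n.+1 -> \bar R) :
  measurable_fun setT f -> (forall x, 0 <= f x)%E ->
  (\int[lebesgue_rV R n.+1]_x f x =
   \int[@lebesgue_measure R]_t \int[lebesgue_rV R n]_v f (consrV (t, v)))%E.
Proof.
move=> mf f0.
have P : (\int[pushforward (@lebesgue_measure R \x lebesgue_rV R n)
    (@consrV R n)]_x f x = \int[@lebesgue_measure R \x lebesgue_rV R n]_x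
    (f \o @consrV R n) x)%E.
  by rewrite ge0_integral_pushforward//; exact: measurable_consrV.
rewrite [LHS]P fubini_tonelli1//.
  by apply: measurableT_comp => //; exact: measurable_consrV.
by move=> x; exact: f0.
Qed.

Lemma consrVD (R : realType) n (t s : R) (v w : 'rV[R]_n) :
  consrV (t, v) + consrV (s, w) = consrV (t + s, v + w).
Proof.
apply/rowP => i; case: (unliftP ord0 i) => [j ->|->];
by rewrite mxE ?consrVS ?consrV0 ?mxE.
Qed.

Lemma consrVZ (R : realType) n (a t : R) (v : 'rV[R]_n) :
  a *: consrV (t, v) = consrV (a * t, a *: v).
Proof.
apply/rowP => i; case: (unliftP ord0 i) => [j ->|->];
by rewrite mxE ?consrVS ?consrV0 ?mxE.
Qed.

Lemma consrV_surj (R : realType) n (b : 'rV[R]_n.+1) :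
  exists t v, b = consrV (t, v).
Proof.
exists (b ord0 ord0), (\row_j b ord0 (lift ord0 j)); apply/rowP => i.
by case: (unliftP ord0 i) => [j ->|->]; rewrite ?consrVS ?consrV0 ?mxE.
Qed.

Lemma measurable_rV_affine (R : realType) n (a : R) (b : 'rV[R]_n) :
  measurable_fun setT (fun x : 'rV[R]_n => a *: x + b).
Proof.
apply: measurable_fun_rVP => i; under eq_fun do rewrite !mxE.
apply: measurable_funD => //; apply: measurable_funM => //.
exact: measurable_rV_coord.
Qed.

Lemma measurable_rV_subr (R : realType) n (b : 'rV[R]_n) :
  measurable_fun setT (fun x : 'rV[R]_n => b - x).
Proof.
have := measurable_rV_affine (-1) b.
by under eq_fun do rewrite scaleN1r addrC.
Qed.

Lemma measurable_rV_sub (R : realType) n :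
  measurable_fun setT (fun p : 'rV[R]_n * 'rV[R]_n => p.1 - p.2).
Proof.
apply: measurable_fun_rVP => i; under eq_fun do rewrite !mxE.
apply: measurable_funB.
  exact: (measurableT_comp (@measurable_rV_coord R n i) measurable_fst).
exact: (measurableT_comp (@measurable_rV_coord R n i) measurable_snd).
Qed.

Lemma ge0_integral_rV_affine (R : realType) (n : nat) (a : R) (b : 'rV[R]_n)
    (f : 'rV[R]_n -> \bar R) : a != 0 ->
  measurable_fun setT f -> (forall x, 0 <= f x)%E ->
  (\int[lebesgue_rV R n]_x f (a *: x + b)%R =
   (`|a|^-1 ^+ n)%:E * \int[lebesgue_rV R n]_x f x)%E.
Proof.
move=> a0; elim: n b f => [|n IHn] b f mf f0.
  rewrite expr0 mul1e; apply: eq_integral => x _.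
  by congr f; apply/rowP; case.
have mfc : measurable_fun setT (f \o @consrV R n).
  by apply: measurableT_comp => //; exact: measurable_consrV.
have [s [w ->]] := consrV_surj b.
rewrite ge0_integral_rVS//; last first.
  exact: (measurableT_comp mf (measurable_rV_affine a _)).
under eq_integral => t _.
  under eq_integral do rewrite consrVZ consrVD.
  rewrite (IHn w (fun v => f (consrV (a * t + s, v))))//; last first.
    exact: (measurableT_comp mfc (pair1_measurable _)).
  over.
pose F (t : measurableTypeR R) := (\int[lebesgue_rV R n]_x f (consrV (t, x)))%E.
have F0 t : (0 <= F t)%E by apply: integral_ge0 => x _; exact: f0.
have mF : measurable_fun setT F.
  apply: (measurable_fun_fubini_tonelli_F (f \o @consrV R n)) => // x.
  exact: f0.
transitivity (\int[@lebesgue_measure R]_t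
   ((`|a|^-1 ^+ n)%:E * F (a * t + s)%R))%E; first by [].
rewrite ge0_integralZl//; last first.
  exact: (measurableT_comp mF (measurable_line_affine a s)).
rewrite (ge0_integral_affine1 s (f := F))//.
by rewrite -ge0_integral_rVS// muleA -EFinM -exprSr.
Qed.

Lemma Rintegral_rV_affine (R : realType) (n : nat) (a : R) (b : 'rV[R]_n)
    (f : 'rV[R]_n -> R) : a != 0 -> measurable_fun setT f ->
  \int[lebesgue_rV R n]_x f (a *: x + b) =
  `|a|^-1 ^+ n * \int[lebesgue_rV R n]_x f x.
Proof.
move=> a0 mf; have mf' : measurable_fun setT (EFin \o f) by exact/measurable_EFinP.
have c0 : 0 < `|a|^-1 ^+ n by rewrite exprn_gt0// invr_gt0 normr_gt0.
have Ep : (\int[lebesgue_rV R n]_x (EFin \o (fun x => f (a *: x + b)%R))^\+ x =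
    (`|a|^-1 ^+ n)%:E * \int[lebesgue_rV R n]_x (EFin \o f)^\+ x)%E.
  rewrite -(ge0_integral_rV_affine b a0 (f := (EFin \o f)^\+%E))//;
    first by apply: eq_integral => x _; rewrite !funeposE.
  exact: measurable_funepos.
have En : (\int[lebesgue_rV R n]_x (EFin \o (fun x => f (a *: x + b)%R))^\- x =
    (`|a|^-1 ^+ n)%:E * \int[lebesgue_rV R n]_x (EFin \o f)^\- x)%E.
  rewrite -(ge0_integral_rV_affine b a0 (f := (EFin \o f)^\-%E))//;
    first by apply: eq_integral => x _; rewrite !funenegE.
  exact: measurable_funeneg.
rewrite /Rintegral [in LHS]integralE [in RHS]integralE [in LHS]Ep [in LHS]En.
have : (0 <= \int[lebesgue_rV R n]_x (EFin \o f)^\+ x)%E.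
  by apply: integral_ge0 => x _; rewrite funeposE le_max lexx orbT.
have : (0 <= \int[lebesgue_rV R n]_x (EFin \o f)^\- x)%E.
  by apply: integral_ge0 => x _; rewrite funenegE le_max lexx orbT.
move: (\int[_]_(_ in _) _)%E (\int[_]_(_ in _) _)%E => [q| |] [p| |]// q0 p0 /=; last 3 first.
- by rewrite gt0_muley ?lte_fin//= mulr0.
- by rewrite gt0_muley ?lte_fin//= mulr0.
- by rewrite gt0_muley ?lte_fin//= mulr0.
by rewrite mulrBr.
Qed.

(** The measurable sets are generated by the coordinates, not by the open sets; an open set is a
    countable union of cubes with rational centres and radii 1/(k+1), and cubes are measurable. *)
Lemma open_measurable_rV (R : realType) n (U : set 'rV[R]_n) :
  open U -> measurable U.
Proof.
move=> oU.
pose B (p : 'rV[rat]_n * nat) : set 'rV[R]_n :=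
  [set x | forall i, `|x ord0 i - ratr (p.1 ord0 i)| < p.2.+1%:R^-1].
have mB p : measurable (B p).
  have -> : B p = \bigcap_(i in [set: 'I_n]) (fun v : 'rV[R]_n => v ord0 i) @^-1`
      (ball (ratr (p.1 ord0 i) : R) p.2.+1%:R^-1).
    apply/seteqP; split=> x /= Bx i; last by have := Bx i I; rewrite /= /ball/= distrC.
    by move=> _; rewrite /= /ball/= distrC; exact: Bx.
  apply: fin_bigcap_measurable => // i _.
  rewrite -[X in measurable X]setTI; apply: measurable_rV_coord => //.
  exact: measurable_ball.
have -> : U = \bigcup_p (if pselect (B p `<=` U) is left _ then B p else set0).
  apply/seteqP; split=> [x Ux|x [p _]]; last by case: pselect => // pU /pU.
  have /nbhs_ballP[e /= e0 eU] : nbhs x U by exact: open_nbhs_nbhs.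
  have [k ke] : exists k : nat, (k.+1%:R^-1 : R) < e / 2.
    have := @near_infty_natSinv_lt R (PosNum (divr_gt0 e0 (ltr0n R 2))).
    by case=> N _ /(_ N (leqnn N)) ?; exists N.
  have q_ i : exists q : rat, `|x ord0 i - ratr q| < k.+1%:R^-1.
    have : x ord0 i - k.+1%:R^-1 < x ord0 i + k.+1%:R^-1.
      by rewrite ltrBlDr -addrA ltrDl addr_gt0// invr_gt0.
    case/rat_in_itvoo => q; rewrite in_itv/= => /andP[q1 q2].
    by exists q; rewrite distrC ltr_distl q1 q2.
  pose q := \row_i projT1 (cid (q_ i)).
  have Bqx : B (q, k) x.
    by move=> i; rewrite /= mxE; exact: projT2 (cid (q_ i)).
  exists (q, k) => //; case: pselect => // -[] y By; apply: eU.
  split=> // i j; rewrite (ord1 i) /ball/=.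
  rewrite (le_lt_trans (ler_distD (ratr (q ord0 j)) _ _))// (splitr e).
  by rewrite ltrD// ?(lt_trans (Bqx j))// distrC (lt_trans (By j)).
apply: countable_bigcupT_measurable; first exact: countableP.
by move=> p; case: pselect.
Qed.

Lemma continuous_measurable_rV (R : realType) n (f : 'rV[R]_n -> R) :
  continuous f -> measurable_fun setT f.
Proof.
move=> /continuousP cf; apply: (measurability _ (RGenOpens.measurableE R)).
move=> _ [_ [a [b ->] <-]]; rewrite setTI; apply: open_measurable_rV.
exact/cf/interval_open.
Qed.

Lemma compact_rV_bound (R : realType) n (K : set 'rV[R]_n) :
  compact K -> exists r : R, forall x, K x -> forall i, `|x ord0 i| <= r.
Proof.
move=> /compact_bounded[M [_ /(_ (M + 1))]]; rewrite ltrDl ltr01 => /(_ isT) KM.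
exists (M + 1) => x /KM + i; apply: le_trans.
rewrite [leRHS]/Num.norm/= mx_normrE; apply/bigmax_geP; right => /=.
by exists (ord0, i) => //; rewrite mem_index_enum.
Qed.

Definition box (R : realType) n (r : R) : set 'rV[R]_n :=
  [set v | forall i, `[- r, r]%classic (v ord0 i)].

Lemma measurable_box (R : realType) n (r : R) : measurable (@box R n r).
Proof.
have -> : @box R n r = \bigcap_(i in [set: 'I_n])
    (fun v : 'rV[R]_n => v ord0 i) @^-1` `[- r, r]%classic.
  by apply/seteqP; split=> x /= Bx i; [move=> _|]; exact: Bx.
apply: fin_bigcap_measurable => // i _.
by rewrite -[X in measurable X]setTI; apply: measurable_rV_coord.
Qed.

Lemma lebesgue_box_lty (R : realType) n (r : R) :
  (lebesgue_rV R n (box r) < +oo)%E.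
Proof.
rewrite (lebesgue_rV_box (A := fun=> `[- r, r]%classic))//.
have fin_box : (@lebesgue_measure R `[(- r)%R, r]%classic < +oo)%E.
  by rewrite lebesgue_measure_itv/=; case: ifP => // _; rewrite -EFinB ltry.
suff: (0 <= \prod_(i < n) lebesgue_measure (`[(- r)%R, r]%classic : set R) < +oo)%E.
  by case/andP.
elim/big_ind : _ => [|x y /andP[x0 xy] /andP[y0 yy]|i _]; first by rewrite lee01 ltry.
- by rewrite mule_ge0//= lte_mul_pinfty// ge0_fin_numE.
- by rewrite measure_ge0.
Qed.

Lemma compact_support_bounded (R : realType) n (f : 'rV[R]_n -> R) (r : R) :
  continuous f -> (forall x, f x != 0 -> box r x) ->
  exists2 M, 0 <= M & forall x, `|f x| <= M.
Proof.
move=> cf fr.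
have cbox : compact (@box R n r) 
  by apply: (@rV_compact _ _ (fun=> `[- r, r]%classic)) => _; exact: segment_compact.
have /compact_bounded[M [_ /(_ (`|M| + 1))]] : compact (f @` box r).
  by apply: continuous_compact => //; exact: continuous_subspaceT.
rewrite (le_lt_trans (ler_norm M)) ?ltrDl// => /(_ isT) fM.
exists (`|M| + 1); first by rewrite addr_ge0.
move=> x; have [->|/fr bx] := eqVneq (f x) 0; first by rewrite normr0 addr_ge0.
by apply: fM; exists x.
Qed.

Lemma compact_support_integrable (R : realType) n (f : 'rV[R]_n -> R) (r : R) :
  continuous f -> (forall x, f x != 0 -> box r x) ->
  (lebesgue_rV R n).-integrable setT (EFin \o f).
Proof.
move=> cf fr; have [M M0 fM] := compact_support_bounded cf fr.
have mf := continuous_measurable_rV cf.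
have mb := @measurable_box R n r.
apply: (@le_integrable _ _ _ _ _ _ _ (fun x => M%:E * (\1_(box r) x)%:E)%E) => //.
- exact/measurable_EFinP.
- move=> x _ /=; rewrite lee_fin indicE [leRHS]ger0_norm ?mulr_ge0//.
  have [->|/fr bx] := eqVneq (f x) 0; first by rewrite normr0 mulr_ge0.
  by rewrite mem_set// mulr1.
- apply: integrableZl => //; apply/integrableP; split.
    by apply/measurable_EFinP; exact: measurable_indic.
  under eq_integral do rewrite /= ger0_norm//.
  by rewrite integral_indic// setIT lebesgue_box_lty.
Qed.

Lemma ge0_integral_rV_prod (R : realType) n (h : 'I_n -> R -> R) :
  (forall i, measurable_fun setT (h i)) -> (forall i x, 0 <= h i x) ->
  (\int[lebesgue_rV R n]_x (\prod_(i < n) h i (x ord0 i))%:E =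
   \prod_(i < n) \int[@lebesgue_measure R]_t (h i t)%:E)%E.
Proof.
elim: n h => [|n IHn] h mh h0.
  under eq_integral do rewrite big_ord0.
  by rewrite big_ord0 integral_dirac//= diracT mul1e.
rewrite ge0_integral_rVS; last 2 first.
- apply/measurable_EFinP.
  apply: (measurable_prod (h := fun i (x : 'rV[R]_n.+1) => h i (x ord0 i))) => i _.
  exact: (measurableT_comp (mh i) (@measurable_rV_coord R _ i)).
- by move=> x; rewrite lee_fin prodr_ge0.
have E (t : R) (v : 'rV[R]_n) : ((\prod_(i < n.+1) h i (consrV (t, v) ord0 i))%:E =
    (h ord0 t)%:E * (\prod_(i < n) h (lift ord0 i) (v ord0 i))%:E)%E.
  rewrite big_ord_recl consrV0 EFinM; congr (_ * _%:E)%E.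
  by apply: eq_bigr => i _; rewrite consrVS.
transitivity (\int[@lebesgue_measure R]_t ((h ord0 t)%:E *
    \prod_(i < n) \int[@lebesgue_measure R]_t (h (lift ord0 i) t)%:E))%E.
  apply: eq_integral => t _; under eq_integral do rewrite E.
  rewrite ge0_integralZl ?lee_fin//.
  - by rewrite (IHn (fun i => h (lift ord0 i))).
  - apply/measurable_EFinP.
    apply: (measurable_prod (h := fun i (x : 'rV[R]_n) => h (lift ord0 i) (x ord0 i))) => i _.
    exact: (measurableT_comp (mh _) (@measurable_rV_coord R _ i)).
  - by move=> x _; rewrite lee_fin prodr_ge0.
rewrite /= big_ord_recl ge0_integralZr//.
- by apply/measurable_EFinP; exact: mh.
- by move=> x _; rewrite lee_fin.
- by apply: prode_ge0 => i _; apply: integral_ge0 => x _; rewrite lee_fin.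
Qed.

(** * The Fejer kernel on the line *)

Section fejer.
Variable R : realType.
Local Notation mu := (@lebesgue_measure R).

Definition tri (t : R) : R := Num.max 0 (1 - `|t|).

Lemma tri_ge0 t : 0 <= tri t. Proof. by rewrite le_max lexx. Qed.

Lemma tri_le1 t : tri t <= 1.
Proof. by rewrite ge_max ler01 gerBl normr_ge0. Qed.

Lemma tri0 : tri 0 = 1.
Proof. by rewrite /tri normr0 subr0; apply/max_idPr. Qed.

Lemma continuous_tri : continuous tri.
Proof.
have -> : tri = (fun t => (0 + (1 - `|t|) + `|0 - (1 - `|t|)|) / 2).
  by apply/funext => t; rewrite /tri maxr_absE.
have ctri : continuous (fun t : R => 1 - `|t|).
  by move=> t; apply: cvgB; [exact: cvg_cst|exact: norm_continuous].
move=> t; apply: cvgM; last exact: cvg_cst.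
apply: cvgD; first by apply: cvgD; [exact: cvg_cst|exact: ctri].
apply: cvg_norm.
by apply: cvgB; [exact: cvg_cst|exact: ctri].
Qed.

Lemma measurable_tri : measurable_fun setT tri.
Proof. by apply: continuous_measurable_fun; exact: continuous_tri. Qed.

Lemma tri_out t : t \notin `[-1, 1] -> tri t = 0.
Proof.
move=> t1; apply/max_idPl; rewrite subr_le0 leNgt; apply: contra t1 => t1.
by rewrite in_itv/= -ler_norml ltW.
Qed.

Lemma triM_restrict (h : R -> R) : (tri \* h) = (tri \* h) \_ `[-1, 1].
Proof.
apply/funext => t; rewrite patchE; case: ifPn => //.
by rewrite mem_setE => /tri_out /= ->; rewrite mul0r.
Qed.

Lemma integrable_triM (h : R -> R) : continuous h ->
  mu.-integrable setT (EFin \o (tri \* h)).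
Proof.
move=> ch; rewrite triM_restrict -restrict_EFin; apply/integrable_restrict => //.
rewrite setTI; apply: continuous_compact_integrable; first exact: segment_compact.
apply: continuous_subspaceT => t; apply: cvgM; last exact: ch.
exact: continuous_tri.
Qed.

(** The integrand is smooth on each side of the kink of [tri] at 0, where the fundamental theorem
    of calculus applies. *)
Lemma integral_triM (h : R -> R) : continuous h ->
  \int[mu]_t (tri t * h t) = \int[mu]_(t in `[-1, 0]) ((1 + t) * h t) +
                             \int[mu]_(t in `[0, 1]) ((1 - t) * h t).
Proof.
move=> ch; have ih := integrable_triM ch.
transitivity (\int[mu]_(t in `[-1, 1]) (tri t * h t)).
  by rewrite [RHS]Rintegral_mkcond; apply: eq_Rintegral => t _; rewrite -triM_restrict.
have -> : `[-1, 1]%classic = `[-1, 0]%classic `|` `]0, 1]%classic :> set R.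
  by rewrite -itv_bndbnd_setU ?bnd_simp// oppr_le0.
rewrite Rintegral_setU//; last 2 first.
- by apply: integrableS ih => //; exact: measurableU.
- by apply/disj_setPS => t [] /=; rewrite !in_itv/=; lra.
congr (_ + _).
  apply: eq_Rintegral => t; rewrite inE/= in_itv/= => t0.
  by rewrite /tri ler0_norm ?opprK; [congr (_ * _); apply/max_idPr|]; lra.
rewrite Rintegral_itv_obnd_cbnd; last first.
  by apply: integrableS ih.
apply: eq_Rintegral => t; rewrite inE/= in_itv/= => t0.
by rewrite /tri ger0_norm; [congr (_ * _); apply/max_idPr|]; lra.
Qed.

Lemma Rintegral_FTC (f F : R -> R) (a b : R) : a < b -> continuous f ->
  (forall x : R, is_derive x 1 F (f x)) ->
  \int[mu]_(x in `[a, b]) f x = F b - F a.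
Proof.
move=> ab cf dF.
have cF : continuous F.
  by move=> x; apply/differentiable_continuous/derivable1_diffP; have := dF x; case.
rewrite /Rintegral (@continuous_FTC2 _ f F a b)//.
- exact: continuous_subspaceT.
- split => [x _||].
  + by have := dF x; case.
  + by apply: cvg_at_right_filter; exact: cF.
  + by apply: cvg_at_left_filter; exact: cF.
- by move=> x _; rewrite derive1E; have := dF x => -[].
Qed.

(** The cosine transform of the hat function, that is [2 (1 - cos y) / y^2]: nonnegative and
    integrable, as is needed of a summability kernel. *)
Definition fejer (y : R) : R := \int[mu]_t (tri t * cos (t * y)).

Lemma continuous_cosM (y : R) : continuous (fun t : R => cos (t * y)).
Proof.
move=> t; apply: continuous_comp; last exact: continuous_cos.
by apply: cvgM; [exact: cvg_id|exact: cvg_cst].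
Qed.

Lemma continuous_sinM (y : R) : continuous (fun t : R => sin (t * y)).
Proof.
move=> t; apply: continuous_comp; last exact: continuous_sin.
by apply: cvgM; [exact: cvg_id|exact: cvg_cst].
Qed.

Lemma fejerE y : y != 0 -> fejer y = 2 * (1 - cos y) / y ^+ 2.
Proof.
move=> y0; rewrite /fejer integral_triM; last exact: continuous_cosM.
have c1 (s : R) : continuous (fun t : R => (1 + s * t) * cos (t * y)).
  move=> t; apply: cvgM; last exact: continuous_cosM.
  by apply: cvgD; [exact: cvg_cst|apply: cvgM;[exact: cvg_cst|exact: cvg_id]].
have c0 : continuous (fun t : R => (1 + t) * cos (t * y)).
  by have := c1 1; under eq_fun do rewrite mul1r.
have c2 : continuous (fun t : R => (1 - t) * cos (t * y)).
  by have := c1 (-1); under eq_fun do rewrite mulN1r.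
have d0 (x : R) : is_derive x 1
    (fun t : R => (1 + t) * sin (t * y) / y + cos (t * y) / y ^+ 2) ((1 + x) * cos (x * y)).
  by apply: is_derive_eq; rewrite /GRing.scale/=; field.
have d1 (x : R) : is_derive x 1
    (fun t : R => (1 - t) * sin (t * y) / y - cos (t * y) / y ^+ 2) ((1 - x) * cos (x * y)).
  by apply: is_derive_eq; rewrite /GRing.scale/=; field.
rewrite (Rintegral_FTC _ c0 d0) ?(Rintegral_FTC _ c2 d1) ?ltrN10 ?ltr01//.
rewrite !mulN1r cosN sinN !mul0r cos0 sin0 !mul1r.
by field.
Qed.

Lemma integral_tri_sin y : \int[mu]_t (tri t * sin (t * y)) = 0.
Proof.
have [->|y0] := eqVneq y 0.
  under eq_Rintegral do rewrite mulr0 sin0 mulr0.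
  by rewrite Rintegral_cst// mul0r.
rewrite integral_triM; last exact: continuous_sinM.
have c1 (s : R) : continuous (fun t : R => (1 + s * t) * sin (t * y)).
  move=> t; apply: cvgM; last exact: continuous_sinM.
  by apply: cvgD; [exact: cvg_cst|apply: cvgM;[exact: cvg_cst|exact: cvg_id]].
have c0 : continuous (fun t : R => (1 + t) * sin (t * y)).
  by have := c1 1; under eq_fun do rewrite mul1r.
have c2 : continuous (fun t : R => (1 - t) * sin (t * y)).
  by have := c1 (-1); under eq_fun do rewrite mulN1r.
have d0 (x : R) : is_derive x 1
    (fun t : R => - (1 + t) * cos (t * y) / y + sin (t * y) / y ^+ 2) ((1 + x) * sin (x * y)).
  by apply: is_derive_eq; rewrite /GRing.scale/=; field.
have d1 (x : R) : is_derive x 1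
    (fun t : R => - (1 - t) * cos (t * y) / y - sin (t * y) / y ^+ 2) ((1 - x) * sin (x * y)).
  by apply: is_derive_eq; rewrite /GRing.scale/=; field.
rewrite (Rintegral_FTC _ c0 d0) ?(Rintegral_FTC _ c2 d1) ?ltrN10 ?ltr01//.
rewrite !mulN1r cosN sinN !mul0r cos0 sin0 !mul1r.
by field.
Qed.

End fejer.

(** Tonelli's theorem gives the measurability of the integrals of the positive and negative parts,
    and [fine] is measurable. *)
Lemma measurable_Rintegral d1 d2 (T1 : measurableType d1) (T2 : measurableType d2)
    (R : realType) (m : {sigma_finite_measure set T2 -> \bar R})
    (F : T1 * T2 -> R) : measurable_fun setT F ->
  measurable_fun setT (fun x => \int[m]_y F (x, y)).
Proof.
move=> mF; have mF' : measurable_fun setT (EFin \o F) by exact/measurable_EFinP.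
apply: (measurableT_comp (@fine_measurable R _ measurableT)).
have -> : (fun x => \int[m]_y (F (x, y))%:E)%E =
    (fun x => \int[m]_y ((EFin \o F)^\+%E (x, y)) -
              \int[m]_y ((EFin \o F)^\-%E (x, y)))%E.
  apply/funext => x; rewrite integralE; congr (_ - _)%E.
    by apply: eq_integral => y _; rewrite !funeposE.
  by apply: eq_integral => y _; rewrite !funenegE.
apply: emeasurable_funB.
  apply: (measurable_fun_fubini_tonelli_F (EFin \o F)^\+%E) => [|x].
    exact: measurable_funepos.
  by rewrite funeposE le_max lexx orbT.
apply: (measurable_fun_fubini_tonelli_F (EFin \o F)^\-%E) => [|x].
  exact: measurable_funeneg.
by rewrite funenegE le_max lexx orbT.
Qed.

Section fejer_integral.
Variable R : realType.
Local Notation mu := (@lebesgue_measure R).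

Lemma integral_oneDsqrV_lty : (\int[mu]_x ((1 + x ^+ 2)^-1)%:E < +oo)%E.
Proof.
pose f (x : R) : \bar R := ((oneDsqr x)^-1)%:E.
have mf : measurable_fun setT f.
  by apply/measurable_EFinP; apply: continuous_measurable_fun; exact: continuous_oneDsqrV.
have f0 x : (0 <= f x)%E by rewrite lee_fin invr_ge0.
rewrite -[X in (\int[_]_(x in X) _)%E](setUv `]-oo, (0:R)%R]%classic).
rewrite setCitvl; change (\int[mu]_(x in `]-oo, (0:R)%R] `|` `](0:R)%R, +oo[) f x < +oo)%E.
rewrite ge0_integral_setU//; last 2 first.
- exact: measurable_funTS.
- by apply/disj_setPS => t [] /=; rewrite !in_itv/=; lra.
rewrite integral_itv_obnd_cbnd; last exact: measurable_funTS.
rewrite [X in (_ + X)%E](_ : _ = (pi / 2)%:E); last exact: integral0y_oneDsqr.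
have -> : (\int[mu]_(x in `]-oo, 0%R]) f x = (pi / 2)%:E)%E.
  rewrite -integral0y_oneDsqr [in RHS]ge0_integration_by_substitution0//.
  by apply: eq_integral => x _; rewrite /f /oneDsqr sqrrN.
by rewrite -EFinD ltry.
Qed.

Lemma integrable_oneDsqrV : mu.-integrable setT (EFin \o (fun x : R => (1 + x ^+ 2)^-1)).
Proof.
apply/integrableP; split.
  by apply/measurable_EFinP; apply: continuous_measurable_fun; exact: continuous_oneDsqrV.
apply: le_lt_trans integral_oneDsqrV_lty.
by under eq_integral do rewrite /= ger0_norm ?invr_ge0 ?addr_ge0 ?sqr_ge0//.
Qed.

Lemma measurable_fejer : measurable_fun setT (@fejer R).
Proof.
apply: (measurable_Rintegral mu (F := fun p : measurableTypeR R * measurableTypeR R =>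
  tri p.2 * cos (p.2 * p.1))).
apply: measurable_funM.
  exact: (measurableT_comp (@measurable_tri R) measurable_snd).
apply: (measurableT_comp (f := @cos R)).
  by apply: continuous_measurable_fun; exact: continuous_cos.
by apply: measurable_funM; [exact: measurable_snd|exact: measurable_fst].
Qed.

Lemma fejer_ge0 y : 0 <= fejer y :> R.
Proof.
have [->|y0] := eqVneq y 0.
  by apply: Rintegral_ge0 => t _; rewrite mulr0 cos0 mulr1; exact: tri_ge0.
by rewrite fejerE// divr_ge0 ?sqr_ge0// mulr_ge0// subr_ge0 cos_le1.
Qed.

(** The factor 1 is kept so that the integrand is an instance of [integral_triM]. *)
Lemma integral_tri : \int[mu]_t (tri t * 1) = 1.
Proof.
rewrite integral_triM; last by move=> ?; exact: cvg_cst.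
have c (s : R) : continuous (fun t : R => (1 + s * t) * 1).
  move=> t; apply: cvgM; last exact: cvg_cst.
  by apply: cvgD; [exact: cvg_cst|apply: cvgM;[exact: cvg_cst|exact: cvg_id]].
have c0 : continuous (fun t : R => (1 + t) * 1).
  by have := c 1; under eq_fun do rewrite mul1r.
have c2 : continuous (fun t : R => (1 - t) * 1).
  by have := c (-1); under eq_fun do rewrite mulN1r.
have d0 (x : R) : is_derive x 1 (fun t : R => t + t ^+ 2 / 2) ((1 + x) * 1).
  by apply: is_derive_eq; rewrite /GRing.scale/=; field.
have d1 (x : R) : is_derive x 1 (fun t : R => t - t ^+ 2 / 2) ((1 - x) * 1).
  by apply: is_derive_eq; rewrite /GRing.scale/=; field.
rewrite (Rintegral_FTC _ c0 d0) ?(Rintegral_FTC _ c2 d1) ?ltrN10 ?ltr01//.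
by field.
Qed.

Lemma fejer_le1 y : fejer y <= 1 :> R.
Proof.
rewrite -integral_tri; apply: le_Rintegral => //.
- exact: (integrable_triM (@continuous_cosM R y)).
- by apply: (integrable_triM (h := fun=> 1)) => ?; exact: cvg_cst.
- by move=> t _; rewrite ler_wpM2l ?tri_ge0// cos_le1.
Qed.

(** Near 0 the bound is [fejer_le1]; where [1 < y^2], the numerator [1 - cos y] is at most 2. The
    constant 8 covers both cases. *)
Lemma fejer_le y : fejer y <= 8 / (1 + y ^+ 2) :> R.
Proof.
have p1 : 0 < 1 + y ^+ 2 by rewrite ltr_pwDl// sqr_ge0.
rewrite ler_pdivlMr//; have [y1|y1] := leP (y ^+ 2) 1.
  have := fejer_le1 y; have := fejer_ge0 y; nra.
have y0 : y != 0 by apply: contraTneq y1 => ->; rewrite expr0n/= ltr10.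
rewrite fejerE// mulrAC ler_pdivrMr ?(lt_trans _ y1)//.
have := cos_geN1 y; nra.
Qed.

Lemma integrable_fejer : mu.-integrable setT (EFin \o @fejer R).
Proof.
pose w : R -> \bar R := EFin \o (fun x => (1 + x ^+ 2)^-1).
have iw : mu.-integrable setT (fun x => (8%:E * w x)%E).
  by apply: integrableZl => //; exact: integrable_oneDsqrV.
apply: le_integrable iw => //.
- by apply/measurable_EFinP; exact: measurable_fejer.
- move=> y _ /=; rewrite lee_fin !ger0_norm ?fejer_ge0 ?fejer_le//.
  by rewrite mulr_ge0// invr_ge0 addr_ge0// sqr_ge0.
Qed.

(** On [[1, 2]] the cosine stays below [cos 1 < 1], so the kernel is bounded below there. *)
Lemma integral_fejer_gt0 : 0 < \int[mu]_y fejer y.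
Proof.
have c1 : cos 1 < 1 :> R.
  rewrite -[ltRHS]cos0 ltr_cos// in_itv/= ?lexx ?pi_ge0 ?ler01//=.
  by rewrite (le_trans _ (pi_ge2 R))// ler1n.
pose m : R := (1 - cos 1) / 2.
have m0 : 0 < m by rewrite divr_gt0// subr_gt0.
apply: (@lt_le_trans _ _ (\int[mu]_(y in `[1, 2]) m)).
  rewrite Rintegral_cst// mulr_gt0//= lebesgue_measure_itv/= lte_fin ltr1n/=.
  by lra.
rewrite Rintegral_mkcond; apply: le_Rintegral => //.
- rewrite -restrict_EFin; apply/integrable_restrict => //; rewrite setTI.
  apply: continuous_compact_integrable; first exact: segment_compact.
  by apply: continuous_subspaceT => ?; exact: cvg_cst.
- exact: integrable_fejer.
- move=> y _; rewrite patchE; case: ifPn => [|_]; last exact: fejer_ge0.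
  rewrite inE/= in_itv/= => /andP[y1 y2].
  have yp : y <= pi by rewrite (le_trans y2)// pi_ge2.
  have cy : cos y <= cos 1.
    rewrite le_eqVlt; have [->|yn] := eqVneq y 1; first by rewrite eqxx.
    rewrite ltr_cos ?in_itv/= ?yp ?ler01 ?(le_trans _ yp) ?(le_trans _ y1)//.
    by rewrite lt_def yn y1 orbT.
  rewrite fejerE; last by rewrite gt_eqF// (lt_le_trans _ y1).
  rewrite ler_pdivlMr ?exprn_gt0 ?(lt_le_trans _ y1)// /m.
  have y4 : 0 <= 4 - y ^+ 2 by nra.
  have := mulr_ge0 (ltW m0) y4; rewrite /m; lra.
Qed.

End fejer_integral.

(** * Complex-valued integrals *)

Section complex_basics.
Variable R : realType.
Implicit Types z w : R[i].

Lemma cReD z w : complex.Re (z + w) = complex.Re z + complex.Re w.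
Proof. by case: z; case: w. Qed.

Lemma cImD z w : complex.Im (z + w) = complex.Im z + complex.Im w.
Proof. by case: z; case: w. Qed.

Lemma cReM z w : complex.Re (z * w) =
  complex.Re z * complex.Re w - complex.Im z * complex.Im w.
Proof. by case: z; case: w. Qed.

Lemma cImM z w : complex.Im (z * w) =
  complex.Re z * complex.Im w + complex.Im z * complex.Re w.
Proof. by case: z; case: w. Qed.

Lemma complex_eqP z w : complex.Re z = complex.Re w -> complex.Im z = complex.Im w -> z = w.
Proof. by case: z => a b; case: w => c d /= -> ->. Qed.

Lemma normcE z : Normc.normc z = Num.sqrt (complex.Re z ^+ 2 + complex.Im z ^+ 2).
Proof. by case: z. Qed.

Lemma normc_ge0 z : 0 <= Normc.normc z.
Proof. by rewrite normcE sqrtr_ge0. Qed.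

Lemma normc_normr z : (Normc.normc z)%:C%C = `|z|.
Proof. by []. Qed.

Lemma ler_normcD z w : Normc.normc (z + w) <= Normc.normc z + Normc.normc w.
Proof. by have := ler_normD z w; rewrite -!normc_normr -rmorphD lecR. Qed.

Lemma normcN z : Normc.normc (- z) = Normc.normc z.
Proof. by case: z => a b /=; rewrite !sqrrN. Qed.

Lemma normc_sum I (r : seq I) (F : I -> R[i]) :
  Normc.normc (\sum_(i <- r) F i) <= \sum_(i <- r) Normc.normc (F i).
Proof.
elim/big_ind2 : _ => //; first by rewrite Normc.normc0.
by move=> a b c d ab cd; rewrite (le_trans (ler_normcD _ _))// lerD.
Qed.

Lemma Re_le_normc z : `|complex.Re z| <= Normc.normc z.
Proof. by rewrite normcE -sqrtr_sqr ler_sqrt ?addr_ge0 ?sqr_ge0// lerDl sqr_ge0. Qed.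

Lemma Im_le_normc z : `|complex.Im z| <= Normc.normc z.
Proof. by rewrite normcE -sqrtr_sqr ler_sqrt ?addr_ge0 ?sqr_ge0// lerDr sqr_ge0. Qed.

Lemma normc_le_ReIm z : Normc.normc z <= `|complex.Re z| + `|complex.Im z|.
Proof.
rewrite normcE -(ler_pXn2r (_ : 0 < 2)%N)// ?nnegrE ?sqrtr_ge0 ?addr_ge0//.
rewrite sqr_sqrtr ?addr_ge0 ?sqr_ge0// sqrrD !real_normK ?num_real//.
by rewrite -addrA lerD2l lerDr mulrn_wge0// mulr_ge0.
Qed.

Lemma normcR (a : R) : 0 <= a -> Normc.normc (a%:C%C : R[i]) = a.
Proof. by move=> a0; rewrite normcE /= expr0n/= addr0 sqrtr_sqr ger0_norm. Qed.

(** A unit factor turns [z] into its modulus; this reduces the modulus of an integral to a real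
    part. *)
Lemma normc_rotate z : exists2 c : R[i],
  Normc.normc c = 1 & complex.Re (c * z) = Normc.normc z.
Proof.
have [z0|N0] := eqVneq (Normc.normc z) 0.
  by exists 1; [exact: Normc.normc1|rewrite mul1r z0 (Normc.eq0_normc z0)].
case: z N0 => a b; set N := Normc.normc _ => N0.
have N2 : a ^+ 2 + b ^+ 2 = N ^+ 2 by rewrite /N/= sqr_sqrtr// addr_ge0 ?sqr_ge0.
exists (Complex (a / N) (- b / N)) => /=.
  rewrite [X in Num.sqrt X](_ : _ = (a ^+ 2 + b ^+ 2) / N ^+ 2); last by field.
  by rewrite N2 divff ?sqrf_eq0// sqrtr1.
rewrite [LHS](_ : _ = (a ^+ 2 + b ^+ 2) / N); last by field.
by rewrite N2 expr2 mulfK.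
Qed.

Definition cis (t : R) : R[i] := Complex (cos t) (sin t).

Lemma normc_cis t : Normc.normc (cis t) = 1.
Proof. by rewrite /= cos2Dsin2 sqrtr1. Qed.

Lemma cisD s t : cis (s + t) = cis s * cis t.
Proof. by apply: complex_eqP; rewrite ?cReM ?cImM /= ?cosD ?sinD//; ring. Qed.

Lemma cRe_sum I (s : seq I) (F : I -> R[i]) :
  complex.Re (\sum_(i <- s) F i) = \sum_(i <- s) complex.Re (F i).
Proof. by elim/big_ind2 : _ => // a b c d <- <-; rewrite cReD. Qed.

Lemma cIm_sum I (s : seq I) (F : I -> R[i]) :
  complex.Im (\sum_(i <- s) F i) = \sum_(i <- s) complex.Im (F i).
Proof. by elim/big_ind2 : _ => // a b c d <- <-; rewrite cImD. Qed.

End complex_basics.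

Section measurable_complex.
Context d (T : measurableType d) {R : realType}.
Implicit Types f g : T -> R[i].

Definition measC f := measurable_fun setT (fun x => complex.Re (f x)) /\
                      measurable_fun setT (fun x => complex.Im (f x)).

Lemma measCD f g : measC f -> measC g -> measC (fun x => f x + g x).
Proof.
move=> [f1 f2] [g1 g2]; split.
  by under eq_fun do rewrite cReD; exact: measurable_funD.
by under eq_fun do rewrite cImD; exact: measurable_funD.
Qed.

Lemma measCM f g : measC f -> measC g -> measC (fun x => f x * g x).
Proof.
move=> [f1 f2] [g1 g2]; split.
  under eq_fun do rewrite cReM.
  by apply: measurable_funB; apply: measurable_funM.
under eq_fun do rewrite cImM.
by apply: measurable_funD; apply: measurable_funM.
Qed.

Lemma measC_cst (c : R[i]) : measC (fun=> c).
Proof. by split; exact: measurable_cst. Qed.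

Lemma measC_real (u : T -> R) : measurable_fun setT u -> measC (fun x => (u x)%:C%C).
Proof. by move=> mu; split => //=; exact: measurable_cst. Qed.

Lemma measC_cis (u : T -> R) : measurable_fun setT u -> measC (fun x => cis (u x)).
Proof.
move=> mu; split => /=.
  apply: (measurableT_comp (f := @cos R)) => //.
  by apply: continuous_measurable_fun; exact: continuous_cos.
apply: (measurableT_comp (f := @sin R)) => //.
by apply: continuous_measurable_fun; exact: continuous_sin.
Qed.

Lemma measurable_sqrtr : measurable_fun setT (@Num.sqrt R).
Proof. by apply: continuous_measurable_fun; exact: sqrt_continuous. Qed.

Lemma measurable_normc f : measC f -> measurable_fun setT (fun x => Normc.normc (f x)).
Proof.
move=> [f1 f2]; under eq_fun do rewrite normcE.
apply: (measurableT_comp measurable_sqrtr).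
by apply: measurable_funD; exact: measurable_funX.
Qed.

End measurable_complex.

Lemma measC_comp d d' (T : measurableType d) (T' : measurableType d') (R : realType)
    (f : T' -> R[i]) (phi : T -> T') :
  measC f -> measurable_fun setT phi -> measC (f \o phi).
Proof.
move=> [f1 f2] mphi; split; first exact: (measurableT_comp f1 mphi).
exact: (measurableT_comp f2 mphi).
Qed.

Section integralC.
Context {R : realType} {n : nat}.
Local Notation mu := (lebesgue_rV R n).
Implicit Types f g : 'rV[R]_n -> R[i].

Definition intC f := measC f /\ (\int[mu]_x (Normc.normc (f x))%:E < +oo)%E.

Lemma intC_Re f : intC f -> mu.-integrable setT (fun x => (complex.Re (f x))%:E).
Proof.
move=> [mf foo]; apply/integrableP; split; first by apply/measurable_EFinP; exact: mf.1.
apply: le_lt_trans foo; apply: ge0_le_integral => //=.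
- by apply/measurable_EFinP; apply: measurableT_comp => //; exact: mf.1.
- by apply/measurable_EFinP; exact: measurable_normc.
- by move=> x _; rewrite lee_fin Re_le_normc.
Qed.

Lemma intC_Im f : intC f -> mu.-integrable setT (fun x => (complex.Im (f x))%:E).
Proof.
move=> [mf foo]; apply/integrableP; split; first by apply/measurable_EFinP; exact: mf.2.
apply: le_lt_trans foo; apply: ge0_le_integral => //=.
- by apply/measurable_EFinP; apply: measurableT_comp => //; exact: mf.2.
- by apply/measurable_EFinP; exact: measurable_normc.
- by move=> x _; rewrite lee_fin Im_le_normc.
Qed.

Lemma intC_le f (h : 'rV[R]_n -> R) : measC f -> measurable_fun setT h ->
  (forall x, Normc.normc (f x) <= h x) ->
  (\int[mu]_x (h x)%:E < +oo)%E -> intC f.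
Proof.
move=> mf mh fh hoo; split => //; apply: le_lt_trans hoo.
apply: ge0_le_integral => //=.
- by move=> x _; rewrite lee_fin normc_ge0.
- by apply/measurable_EFinP; exact: measurable_normc.
- exact/measurable_EFinP.
- by move=> x _; rewrite lee_fin fh.
Qed.

Lemma integralCD f g : intC f -> intC g ->
  integralC (fun x => f x + g x) = integralC f + integralC g.
Proof.
move=> If Ig; apply: complex_eqP; rewrite ?cReD ?cImD /=.
  by under eq_Rintegral do rewrite cReD; rewrite RintegralD//; exact: intC_Re.
by under eq_Rintegral do rewrite cImD; rewrite RintegralD//; exact: intC_Im.
Qed.

Lemma integralCZl (c : R[i]) f : intC f ->
  integralC (fun x => c * f x) = c * integralC f.
Proof.
move=> If; have iR := intC_Re If; have iI := intC_Im If.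
have sR a : mu.-integrable setT (fun x => (a * complex.Re (f x))%:E).
  by under eq_fun do rewrite EFinM; exact: integrableZl.
have sI a : mu.-integrable setT (fun x => (a * complex.Im (f x))%:E).
  by under eq_fun do rewrite EFinM; exact: integrableZl.
apply: complex_eqP; rewrite ?cReM ?cImM /=.
  under eq_Rintegral do rewrite cReM.
  rewrite RintegralB//; [|exact: sR|exact: sI].
by rewrite (RintegralZl _ measurableT iR) (RintegralZl _ measurableT iI).
under eq_Rintegral do rewrite cImM.
rewrite RintegralD//; [|exact: sI|exact: sR].
by rewrite (RintegralZl _ measurableT iR) (RintegralZl _ measurableT iI).
Qed.

Lemma intCZl c f : intC f -> intC (fun x => c * f x).
Proof.
move=> [mf foo]; split; first by apply: measCM => //; exact: measC_cst.
under eq_integral do rewrite Normc.normcM EFinM.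
rewrite ge0_integralZl ?lee_fin ?normc_ge0//.
- by rewrite lte_mul_pinfty// lee_fin normc_ge0.
- by apply/measurable_EFinP; exact: measurable_normc.
- by move=> x _; rewrite lee_fin normc_ge0.
Qed.

Lemma normc_integralC f : intC f ->
  ((Normc.normc (integralC f))%:E <= \int[mu]_x (Normc.normc (f x))%:E)%E.
Proof.
move=> If; have [c c1 cI] := normc_rotate (integralC f).
have Icf := intCZl c If.
rewrite -cI -integralCZl//= fineK; last exact: integrable_fin_num (intC_Re Icf).
apply: (@le_trans _ _ (\int[mu]_x `|(complex.Re (c * f x))%:E|)%E).
  apply: le_trans (le_abse_integral _ _ _) => //; first exact: lee_abs.
  by apply/measurable_EFinP; exact: Icf.1.1.
apply: ge0_le_integral => //=.
- apply/measurable_EFinP; apply: measurableT_comp => //; exact: Icf.1.1.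
- by apply/measurable_EFinP; exact: measurable_normc If.1.
- by move=> x _; rewrite lee_fin (le_trans (Re_le_normc _))// Normc.normcM c1 mul1r.
Qed.

Lemma integralC_affine (a : R) (b : 'rV[R]_n) f : a != 0 -> measC f ->
  integralC (fun x => f (a *: x + b)) = ((`|a|^-1 ^+ n)%:C)%C * integralC f.
Proof.
move=> a0 [f1 f2]; apply: complex_eqP; rewrite ?cReM ?cImM /= ?mul0r ?subr0 ?addr0.
  exact: (Rintegral_rV_affine b a0 f1).
exact: (Rintegral_rV_affine b a0 f2).
Qed.

(** Convergence is stated on real and imaginary parts, so that the topology is that of the reals. *)
Lemma dominated_integralC (f_ : nat -> 'rV[R]_n -> R[i]) f (h : 'rV[R]_n -> R) :
  (forall k, measC (f_ k)) -> measC f ->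
  (forall x, complex.Re (f_ k x) @[k --> \oo] --> complex.Re (f x)) ->
  (forall x, complex.Im (f_ k x) @[k --> \oo] --> complex.Im (f x)) ->
  mu.-integrable setT (EFin \o h) ->
  (forall k x, Normc.normc (f_ k x) <= h x) ->
  (complex.Re (integralC (f_ k)) @[k --> \oo] --> complex.Re (integralC f)) /\
  (complex.Im (integralC (f_ k)) @[k --> \oo] --> complex.Im (integralC f)).
Proof.
move=> mf_ mf cR cI ih fh.
have D (u_ : nat -> 'rV[R]_n -> R) (u : 'rV[R]_n -> R) :
    (forall k, measurable_fun setT (u_ k)) -> measurable_fun setT u ->
    (forall x, u_ k x @[k --> \oo] --> u x) ->
    (forall k x, `|u_ k x| <= h x) ->
    \int[mu]_x u_ k x @[k --> \oo] --> \int[mu]_x u x.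
  move=> mu_ mu0 cu uh.
  have P := @dominated_convergence _ _ R mu setT measurableT
    (fun k x => (u_ k x)%:E) (fun x => (u x)%:E) (EFin \o h).
  case: P => //.
  - by move=> k; exact/measurable_EFinP.
  - exact/measurable_EFinP.
  - by apply: aeW => x _; apply/cvg_EFin; [exact: nearW|exact: cu].
  - by apply: aeW => x k _; rewrite /= lee_fin uh.
  move=> iu _ cint; apply: fine_cvg; rewrite fineK//.
  exact: integrable_fin_num iu.
split; apply: D => //.
- by move=> k; exact: (mf_ k).1.
- exact: mf.1.
- by move=> k x; exact: le_trans (Re_le_normc _) (fh k x).
- by move=> k; exact: (mf_ k).2.
- exact: mf.2.
- by move=> k x; exact: le_trans (Im_le_normc _) (fh k x).
Qed.

End integralC.

(** * Scalar product, Fubini, separation of variables *)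

Section continuous_real.
Context {R : realType} {T : topologicalType}.
Implicit Types f g : T -> R.

Lemma continuous_addR f g : continuous f -> continuous g ->
  continuous (fun x => f x + g x).
Proof. by move=> cf cg x; apply: cvgD; [exact: cf|exact: cg]. Qed.

Lemma continuous_mulR f g : continuous f -> continuous g ->
  continuous (fun x => f x * g x).
Proof. by move=> cf cg x; apply: cvgM; [exact: cf|exact: cg]. Qed.

Lemma continuous_cstR (c : R) : continuous (fun _ : T => c).
Proof. by move=> x; exact: cvg_cst. Qed.

Lemma continuous_compR f (h : R -> R) : continuous f -> continuous h ->
  continuous (fun x => h (f x)).
Proof. by move=> cf ch x; apply: continuous_comp; [exact: cf|exact: ch]. Qed.

End continuous_real.

Lemma continuous_bigsum (R : realType) (T : topologicalType) I (s : seq I)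
    (f : I -> T -> R) : (forall i, continuous (f i)) ->
  continuous (fun x => \sum_(i <- s) f i x).
Proof.
move=> cf; elim: s => [|i s IH] x.
  by under eq_fun do rewrite big_nil; exact: cvg_cst.
by under eq_fun do rewrite big_cons; apply: cvgD; [exact: cf|exact: IH].
Qed.

Lemma continuous_bigprod (R : realType) (T : topologicalType) I (s : seq I)
    (f : I -> T -> R) : (forall i, continuous (f i)) ->
  continuous (fun x => \prod_(i <- s) f i x).
Proof.
move=> cf; elim: s => [|i s IH] x.
  by under eq_fun do rewrite big_nil; exact: cvg_cst.
by under eq_fun do rewrite big_cons; apply: cvgM; [exact: cf|exact: IH].
Qed.

Section dot_norm.
Context {R : realType} {n : nat}.
Implicit Types x y z : 'rV[R]_n.

Lemma dotC x y : dot x y = dot y x.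
Proof. by apply: eq_bigr => i _; rewrite mulrC. Qed.

Lemma dotDl x y z : dot (x + y) z = dot x z + dot y z.
Proof. by rewrite /dot -big_split; apply: eq_bigr => i _; rewrite mxE mulrDl. Qed.

Lemma dotZl (a : R) x y : dot (a *: x) y = a * dot x y.
Proof. by rewrite /dot mulr_sumr; apply: eq_bigr => i _; rewrite mxE mulrA. Qed.

Lemma dotDr x y z : dot x (y + z) = dot x y + dot x z.
Proof. by rewrite dotC dotDl !(dotC x). Qed.

Lemma dotZr (a : R) x y : dot x (a *: y) = a * dot x y.
Proof. by rewrite dotC dotZl dotC. Qed.

Lemma dotNl x y : dot (- x) y = - dot x y.
Proof. by rewrite -scaleN1r dotZl mulN1r. Qed.

Lemma dotNr x y : dot x (- y) = - dot x y.
Proof. by rewrite dotC dotNl dotC. Qed.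

Lemma continuous_dot y : continuous (dot ^~ y : 'rV[R]_n -> R).
Proof.
apply: (continuous_bigsum (f := fun i (x : 'rV[R]_n) => x ord0 i * y ord0 i)).
move=> i; apply: (continuous_mulR (f := fun x : 'rV[R]_n => x ord0 i)).
  exact: coord_continuous.
exact: continuous_cstR.
Qed.

Lemma measurable_dot d (T : measurableType d) (f g : T -> 'rV[R]_n) :
  measurable_fun setT f -> measurable_fun setT g ->
  measurable_fun setT (fun t => dot (f t) (g t)).
Proof.
move=> mf mg; apply: (@measurable_sum _ _ _ _ _ _ (fun i t => f t ord0 i * g t ord0 i)) => i.
by apply: measurable_funM; apply: (measurableT_comp (@measurable_rV_coord R n i)).
Qed.

Lemma euclidean_norm_dot x : euclidean_norm x = Num.sqrt (dot x x).
Proof. by congr Num.sqrt; apply: eq_bigr => i _; rewrite expr2. Qed.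

Lemma dot_ge0 x : 0 <= dot x x.
Proof. by apply: sumr_ge0 => i _; rewrite -expr2 sqr_ge0. Qed.

Lemma euclidean_norm_ge0 x : 0 <= euclidean_norm x.
Proof. exact: sqrtr_ge0. Qed.

Lemma sqr_euclidean_norm x : euclidean_norm x ^+ 2 = dot x x.
Proof. by rewrite euclidean_norm_dot sqr_sqrtr// dot_ge0. Qed.

(** Cauchy-Schwarz, from the nonnegativity of the square norm of
    [|y|^2 x - (x, y) y]. *)
Lemma dot_le_norm x y : dot x y <= euclidean_norm x * euclidean_norm y.
Proof.
have [y0|y0] := eqVneq (euclidean_norm y) 0.
  have yi i : y ord0 i = 0.
    have : dot y y = 0 by rewrite -sqr_euclidean_norm y0 expr0n.
    move/eqP; rewrite psumr_eq0 => [/allP /(_ i (mem_index_enum _))|j _].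
      by rewrite /= -expr2 sqrf_eq0 => /eqP.
    by rewrite -expr2 sqr_ge0.
  by rewrite y0 mulr0 /dot big1// => i _; rewrite yi mulr0.
set a := euclidean_norm x; set b := euclidean_norm y.
have b0 : 0 < b by rewrite lt_def y0 euclidean_norm_ge0.
rewrite (le_trans (ler_norm _))// -(ler_pXn2r (_ : 0 < 2)%N)// ?nnegrE ?mulr_ge0
  ?euclidean_norm_ge0//.
rewrite real_normK ?num_real// exprMn.
have := dot_ge0 (b ^+ 2 *: x - dot x y *: y).
rewrite !(dotDl, dotDr, dotNl, dotNr, dotZl, dotZr) (dotC y x).
rewrite -(sqr_euclidean_norm x) -(sqr_euclidean_norm y) -/a -/b.
set D := dot x y => H.
have : 0 <= b ^+ 2 * (a ^+ 2 * b ^+ 2 - D ^+ 2) by move: H; lra.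
by rewrite pmulr_rge0 ?exprn_gt0// subr_ge0.
Qed.

Lemma ler_euclidean_normD x y :
  euclidean_norm (x + y) <= euclidean_norm x + euclidean_norm y.
Proof.
rewrite -(ler_pXn2r (_ : 0 < 2)%N)// ?nnegrE ?addr_ge0 ?euclidean_norm_ge0//.
rewrite sqrrD !sqr_euclidean_norm dotDl !dotDr (dotC y x).
have := dot_le_norm x y; lra.
Qed.

Lemma euclidean_normN x : euclidean_norm (- x) = euclidean_norm x.
Proof. by rewrite !euclidean_norm_dot dotNl dotNr opprK. Qed.

Lemma measurable_euclidean_norm : measurable_fun setT (@euclidean_norm R n).
Proof.
have -> : @euclidean_norm R n = @Num.sqrt R \o (fun x => dot x x).
  by apply/funext => x; exact: euclidean_norm_dot.
by apply: measurableT_comp; [exact: measurable_sqrtr|exact: measurable_dot].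
Qed.

End dot_norm.

Section fubini_product_bound.
Context {R : realType} {n m : nat}.
Local Notation mu := (lebesgue_rV R n).
Local Notation nu := (lebesgue_rV R m).
Variables (u : 'rV[R]_n -> R) (v : 'rV[R]_m -> R).
Hypotheses (mu_ : measurable_fun setT u) (mv : measurable_fun setT v).
Hypotheses (u0 : forall x, 0 <= u x) (v0 : forall y, 0 <= v y).
Hypotheses (iu : (\int[mu]_x (u x)%:E < +oo)%E) (iv : (\int[nu]_y (v y)%:E < +oo)%E).

(** The bound [u x * v y] makes every inner integral finite, not only almost every one, so real and
    extended integrals can be exchanged pointwise. *)
Lemma Rintegral_Fubini (G : 'rV[R]_n * 'rV[R]_m -> R) :
  measurable_fun setT G -> (forall x y, `|G (x, y)| <= u x * v y) ->
  \int[mu]_x \int[nu]_y G (x, y) = \int[nu]_y \int[mu]_x G (x, y).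
Proof.
move=> mG Guv; have mG' : measurable_fun setT (EFin \o G) by exact/measurable_EFinP.
have iuE : mu.-integrable setT (EFin \o u).
  apply/integrableP; split; first exact/measurable_EFinP.
  by under eq_integral do rewrite /= ger0_norm//.
have ivE : nu.-integrable setT (EFin \o v).
  apply/integrableP; split; first exact/measurable_EFinP.
  by under eq_integral do rewrite /= ger0_norm//.
have i1 x : nu.-integrable setT (fun y => (G (x, y))%:E).
  apply: (@le_integrable _ _ _ _ _ _ _ (fun y => (u x)%:E * (EFin \o v) y)%E) => //.
  - exact: (measurableT_comp mG' (pair1_measurable x)).
  - by move=> y _ /=; rewrite lee_fin [leRHS]ger0_norm ?mulr_ge0.
  - exact: integrableZl.
have i2 y : mu.-integrable setT (fun x => (G (x, y))%:E).
  apply: (@le_integrable _ _ _ _ _ _ _ (fun x => (v y)%:E * (EFin \o u) x)%E) => //.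
  - exact: (measurableT_comp mG' (pair2_measurable y)).
  - by move=> x _ /=; rewrite lee_fin [leRHS]ger0_norm ?mulr_ge0// mulrC.
  - exact: integrableZl.
rewrite /Rintegral.
under eq_integral do rewrite fineK ?(integrable_fin_num _ (i1 _))//.
under [in RHS]eq_integral do rewrite fineK ?(integrable_fin_num _ (i2 _))//.
congr fine; apply: (Fubini (f := EFin \o G)).
apply/(integrable12ltyP _ _ mG').
apply: (@le_lt_trans _ _ (\int[mu]_x ((u x)%:E * \int[nu]_y (v y)%:E))%E).
  apply: ge0_le_integral => //=.
  - by move=> x _; apply: integral_ge0.
  - apply: (measurable_fun_fubini_tonelli_F (fun p => `|(G p)%:E|)%E) => //.
    exact: measurableT_comp.
  - apply: emeasurable_funM => //; exact/measurable_EFinP.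
  - move=> x _; rewrite -ge0_integralZl//.
    + apply: ge0_le_integral => //=.
      * apply/measurable_EFinP; apply: measurableT_comp => //.
        exact: (measurableT_comp mG (pair1_measurable x)).
      * by apply/measurable_EFinP; exact: measurable_funM.
      * by move=> y _; rewrite -EFinM lee_fin Guv.
    + exact/measurable_EFinP.
    + by move=> y _; rewrite lee_fin.
    + by rewrite lee_fin.
rewrite ge0_integralZr//.
- by rewrite lte_mul_pinfty// ?ge0_fin_numE//; apply: integral_ge0 => x _; rewrite lee_fin.
- exact/measurable_EFinP.
- by move=> x _; rewrite lee_fin.
- by apply: integral_ge0 => x _; rewrite lee_fin.
Qed.

Lemma integralC_Fubini (F : 'rV[R]_n * 'rV[R]_m -> R[i]) :
  measC F -> (forall x y, Normc.normc (F (x, y)) <= u x * v y) ->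
  integralC (fun x => integralC (fun y => F (x, y))) =
  integralC (fun y => integralC (fun x => F (x, y))).
Proof.
move=> mF Fuv; apply: complex_eqP => /=.
  apply: (Rintegral_Fubini (G := fun p => complex.Re (F p))); first exact: mF.1.
  by move=> x y; exact: le_trans (Re_le_normc _) (Fuv x y).
apply: (Rintegral_Fubini (G := fun p => complex.Im (F p))); first exact: mF.2.
by move=> x y; exact: le_trans (Im_le_normc _) (Fuv x y).
Qed.

End fubini_product_bound.

Lemma measC_integralC (R : realType) d (T : measurableType d) n
    (F : T * 'rV[R]_n -> R[i]) : measC F ->
  measC (fun x => integralC (fun y => F (x, y))).
Proof.
move=> mF; split => /=.
  exact: (measurable_Rintegral (lebesgue_rV R n) (F := fun p => complex.Re (F p)) mF.1).
exact: (measurable_Rintegral (lebesgue_rV R n) (F := fun p => complex.Im (F p)) mF.2).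
Qed.

Section separated.
Context {R : realType} {n : nat}.

Definition tailV (x : 'rV[R]_n.+1) : 'rV[R]_n := \row_j x ord0 (lift ord0 j).

Lemma tail_consrV t (v : 'rV[R]_n) : tailV (consrV (t, v)) = v.
Proof. by apply/rowP => j; rewrite mxE consrVS. Qed.

Lemma measurable_tailV : measurable_fun setT tailV.
Proof.
by apply: measurable_fun_rVP => j; under eq_fun do rewrite mxE; exact: measurable_rV_coord.
Qed.

Variables (u : R -> R) (w : 'rV[R]_n -> R).
Hypotheses (iu : (@lebesgue_measure R).-integrable setT (EFin \o u)).
Hypotheses (iw : (lebesgue_rV R n).-integrable setT (EFin \o w)).

Let f (x : 'rV[R]_n.+1) := u (x ord0 ord0) * w (tailV x).

Let mu_ : measurable_fun setT u.
Proof. by apply/measurable_EFinP; exact: measurable_int iu. Qed.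

Let mw : measurable_fun setT w.
Proof. by apply/measurable_EFinP; exact: measurable_int iw. Qed.

Let mf : measurable_fun setT f.
Proof.
apply: measurable_funM; first exact: (measurableT_comp mu_ (@measurable_rV_coord R _ ord0)).
exact: (measurableT_comp mw measurable_tailV).
Qed.

Let fE : (EFin \o f) \o @consrV R n = (fun p => (u p.1 * w p.2)%:E).
Proof. by apply/funext => -[t v]; rewrite /f /= consrV0 tail_consrV. Qed.

Let iG : (@lebesgue_measure R \x lebesgue_rV R n)%E.-integrable setT
  ((EFin \o f) \o @consrV R n).
Proof.
apply/integrable12ltyP.
  apply: measurableT_comp; first exact/measurable_EFinP.
  exact: measurable_consrV.
rewrite fE; have [/measurable_EFinP mu1 u1] := integrableP _ _ _ iu.
have [/measurable_EFinP mw1 w1] := integrableP _ _ _ iw.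
apply: (@le_lt_trans _ _ (\int[@lebesgue_measure R]_t
    (`|(u t)%:E| * \int[lebesgue_rV R n]_v `|(w v)%:E|))%E).
  have aE t v : (`|(u t * w v)%:E| = `|(u t)%:E| * `|(w v)%:E|)%E by rewrite EFinM abseM.
  rewrite le_eqVlt; apply/orP; left; apply/eqP; apply: eq_integral => t _.
  transitivity (\int[lebesgue_rV R n]_v (`|(u t)%:E| * `|(w v)%:E|))%E.
    by apply: eq_integral => v _; exact: aE.
  rewrite ge0_integralZl//.
  by apply: measurableT_comp => //; exact/measurable_EFinP.
rewrite ge0_integralZr//.
- by rewrite lte_mul_pinfty// ?ge0_fin_numE//; apply: integral_ge0.
- by apply: measurableT_comp => //; exact/measurable_EFinP.
- exact: integral_ge0.
Qed.

Lemma integrable_separated : (lebesgue_rV R n.+1).-integrable setT (EFin \o f).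
Proof.
apply: (integrable_pushforward (@measurable_consrV R n)) => //.
exact/measurable_EFinP.
Qed.

Lemma Rintegral_separated : \int[lebesgue_rV R n.+1]_x f x =
  \int[@lebesgue_measure R]_t u t * \int[lebesgue_rV R n]_v w v.
Proof.
have P : (\int[lebesgue_rV R n.+1]_x (f x)%:E =
    \int[@lebesgue_measure R \x lebesgue_rV R n]_p ((EFin \o f) \o @consrV R n) p)%E.
  apply: (integral_pushforward (@measurable_consrV R n)) => //.
  exact/measurable_EFinP.
rewrite /Rintegral P -integral12_prod_meas1// /fubini_F fE.
have fw := integrable_fin_num measurableT iw.
have fu := integrable_fin_num measurableT iu.
transitivity (fine (\int[@lebesgue_measure R]_t
    ((u t)%:E * \int[lebesgue_rV R n]_v (w v)%:E))%E).
  congr fine; apply: eq_integral => t _; rewrite -(integralZl measurableT iw).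
  by apply: eq_integral => v _; rewrite /= EFinM.
rewrite -[X in (\int[_]_t (_ * X))%E]fineK// (integralZr measurableT iu).
by rewrite fineM.
Qed.

End separated.

(** * The Fejer kernel on R^n *)

Section kernel.
Context {R : realType}.

(** The Fourier multiplier of Fejer summation; its transform is [fejer_prod]. *)
Definition tri_prod n (x : 'rV[R]_n) : R := \prod_(i < n) tri (x ord0 i).

Definition fejer_prod n (x : 'rV[R]_n) : R := \prod_(i < n) fejer (x ord0 i).

Lemma continuous_tri_prod n : continuous (@tri_prod n).
Proof.
apply: (continuous_bigprod (f := fun i (x : 'rV[R]_n) => tri (x ord0 i))) => i.
apply: continuous_compR; last exact: continuous_tri.
exact: coord_continuous.
Qed.

Lemma tri_prod_supp n (x : 'rV[R]_n) : tri_prod x != 0 -> box 1 x.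
Proof.
move=> /prodf_neq0 Px i /=; apply/negPn/negP => /tri_out t0.
by have := Px i isT; rewrite t0 eqxx.
Qed.

Lemma tri_prod_ge0 n (x : 'rV[R]_n) : 0 <= tri_prod x.
Proof. by apply: prodr_ge0 => i _; exact: tri_ge0. Qed.

Lemma tri_prod_le1 n (x : 'rV[R]_n) : tri_prod x <= 1.
Proof. by apply: prodr_ile1 => i _; rewrite tri_ge0 tri_le1. Qed.

Lemma tri_prod0 n : tri_prod (0 : 'rV[R]_n) = 1.
Proof. by rewrite /tri_prod big1// => i _; rewrite mxE tri0. Qed.

Lemma fejer_prod_ge0 n (x : 'rV[R]_n) : 0 <= fejer_prod x.
Proof. by apply: prodr_ge0 => i _; exact: fejer_ge0. Qed.

Lemma measurable_fejer_prod n : measurable_fun setT (@fejer_prod n).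
Proof.
apply: (@measurable_prod _ _ _ _ _ _ (fun i (x : 'rV[R]_n) => fejer (x ord0 i))) => i _.
exact: (measurableT_comp (@measurable_fejer R) (@measurable_rV_coord R n i)).
Qed.

Lemma integral_fejer_prod n : (\int[lebesgue_rV R n]_x (fejer_prod x)%:E =
  ((\int[@lebesgue_measure R]_t fejer t) ^+ n)%:E)%E.
Proof.
rewrite (ge0_integral_rV_prod (h := fun=> @fejer R)).
- rewrite -[in RHS](card_ord n) -prodr_const -prodEFin; apply: eq_bigr => i _.
  by rewrite fineK// (integrable_fin_num _ (integrable_fejer R)).
- by move=> i; exact: measurable_fejer.
- by move=> i x; exact: fejer_ge0.
Qed.

(** This is (2 pi)^n, the inversion constant of a Fourier transform taken without a normalising
    factor. *)
Definition fejer_mass n : R := (\int[@lebesgue_measure R]_t fejer t) ^+ n.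

Lemma fejer_mass_gt0 n : 0 < fejer_mass n.
Proof. by rewrite exprn_gt0// integral_fejer_gt0. Qed.

Lemma continuous_cos_dot n (z : 'rV[R]_n) : continuous (fun x => cos (dot x z)).
Proof. by apply: continuous_compR; [exact: continuous_dot|exact: continuous_cos]. Qed.

Lemma continuous_sin_dot n (z : 'rV[R]_n) : continuous (fun x => sin (dot x z)).
Proof. by apply: continuous_compR; [exact: continuous_dot|exact: continuous_sin]. Qed.

Lemma integrable_tri_prodM n (h : 'rV[R]_n -> R) : continuous h ->
  (lebesgue_rV R n).-integrable setT (EFin \o (fun x => tri_prod x * h x)).
Proof.
move=> ch; apply: (@compact_support_integrable _ _ _ 1).
  by apply: continuous_mulR => //; exact: continuous_tri_prod.
by move=> x; rewrite mulf_eq0 negb_or => /andP[/tri_prod_supp].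
Qed.

Lemma Rintegral_rV0 (h : 'rV[R]_0 -> R) : \int[lebesgue_rV R 0]_x h x = h 0.
Proof.
transitivity (\int[lebesgue_rV R 0]_x (fun=> h 0) x).
  by apply: eq_Rintegral => x _; congr h; apply/rowP; case.
rewrite Rintegral_cst// [X in _ * fine X](_ : _ = 1%E) ?mulr1//.
exact: diracT.
Qed.

(** The addition formulas split off the first coordinate; the sine part vanishes because [tri] is
    even. *)
Lemma kernel_transform n (z : 'rV[R]_n) :
  \int[lebesgue_rV R n]_x (tri_prod x * cos (dot x z)) = fejer_prod z /\
  \int[lebesgue_rV R n]_x (tri_prod x * sin (dot x z)) = 0.
Proof.
elim: n z => [|n IH] z.
  rewrite !Rintegral_rV0 /tri_prod /fejer_prod /dot !big_ord0.
  by rewrite cos0 sin0 mulr1 mulr0.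
have [z0 [z' ->]] := consrV_surj z; have [C S] := IH z'.
have tri_prodS x : tri_prod x = tri (x ord0 ord0) * tri_prod (tailV x).
  by rewrite /tri_prod big_ord_recl; congr (_ * _); apply: eq_bigr => i _; rewrite mxE.
have dotS x : dot x (consrV (z0, z')) = x ord0 ord0 * z0 + dot (tailV x) z'.
  rewrite /dot big_ord_recl consrV0; congr (_ + _).
  by apply: eq_bigr => i _; rewrite consrVS mxE.
have kS : fejer_prod (consrV (z0, z')) = fejer z0 * fejer_prod z'.
  rewrite /fejer_prod big_ord_recl consrV0; congr (_ * _).
  by apply: eq_bigr => i _; rewrite consrVS.
have ic := integrable_triM (@continuous_cosM R z0).
have is_ := integrable_triM (@continuous_sinM R z0).
have iC := integrable_tri_prodM (@continuous_cos_dot n z').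
have iS := integrable_tri_prodM (@continuous_sin_dot n z').
split.
  transitivity (\int[lebesgue_rV R n.+1]_x
     ((@tri R \* (fun t => cos (t * z0))) (x ord0 ord0) *
        (tri_prod (tailV x) * cos (dot (tailV x) z')) -
      (@tri R \* (fun t => sin (t * z0))) (x ord0 ord0) *
        (tri_prod (tailV x) * sin (dot (tailV x) z')))).
    by apply: eq_Rintegral => x _; rewrite tri_prodS dotS cosD /=; ring.
  rewrite RintegralB//; [|exact: (integrable_separated ic iC)|exact: (integrable_separated is_ iS)].
  rewrite (Rintegral_separated ic iC) (Rintegral_separated is_ iS) C S mulr0 subr0 kS.
  by [].
transitivity (\int[lebesgue_rV R n.+1]_x
   ((@tri R \* (fun t => sin (t * z0))) (x ord0 ord0) *
        (tri_prod (tailV x) * cos (dot (tailV x) z')) +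
    (@tri R \* (fun t => cos (t * z0))) (x ord0 ord0) *
        (tri_prod (tailV x) * sin (dot (tailV x) z')))).
  by apply: eq_Rintegral => x _; rewrite tri_prodS dotS sinD /=; ring.
rewrite RintegralD//; [|exact: (integrable_separated is_ iC)|exact: (integrable_separated ic iS)].
rewrite (Rintegral_separated is_ iC) (Rintegral_separated ic iS) C S mulr0 addr0.
rewrite [X in X * _](_ : _ = 0) ?mul0r//.
exact: integral_tri_sin.
Qed.

Lemma integralC_kernel n (z : 'rV[R]_n) :
  integralC (fun x => (tri_prod x)%:C%C * cis (dot x z)) = (fejer_prod z)%:C%C.
Proof.
have [C S] := kernel_transform z; apply: complex_eqP.
  by rewrite -[RHS]C; apply: eq_Rintegral => x _; rewrite cReM /= mul0r subr0.
by rewrite -[RHS]S; apply: eq_Rintegral => x _; rewrite cImM /= mul0r addr0.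
Qed.

End kernel.

(** * Fourier transforms of compactly supported functions *)

Section fourier_basics.
Context {R : realType} {n : nat}.
Local Notation mu := (lebesgue_rV R n).
Implicit Types (f g : 'rV[R]_n -> R[i]) (x y xi eta : 'rV[R]_n).

Lemma fourierE f xi : fourier f xi = integralC (fun x => f x * cis (- dot x xi)).
Proof.
by rewrite /fourier; congr integralC; apply/funext => x; rewrite /cis cosN sinN.
Qed.

(** Continuous functions with compact support, with the support condition in the form in which it is
    used. Real and imaginary parts keep the topology of the complex numbers out of the estimates. *)
Definition Cc f := [/\ continuous (fun x => complex.Re (f x)),
  continuous (fun x => complex.Im (f x)) &
  exists r, forall x, f x != 0 -> box r x].

Lemma Cc_measC f : Cc f -> measC f.
Proof. by case=> cR cI _; split; exact: continuous_measurable_rV. Qed.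

Lemma Cc_bounded f : Cc f -> exists2 M, 0 <= M & forall x, Normc.normc (f x) <= M.
Proof.
move=> [cR cI [r fr]].
have [x|M M0 fM] := compact_support_bounded (r := r) cR.
  by move=> fx; apply: fr; apply: contraNneq fx => ->.
have [x|N N0 fN] := compact_support_bounded (r := r) cI.
  by move=> fx; apply: fr; apply: contraNneq fx => ->.
exists (M + N); first exact: addr_ge0.
by move=> x; rewrite (le_trans (normc_le_ReIm _))// lerD.
Qed.

Lemma Cc_intC f : Cc f -> intC f.
Proof.
move=> Cf; have mf := Cc_measC Cf; have [M M0 fM] := Cc_bounded Cf.
have [_ _ [r fr]] := Cf.
have mb := @measurable_box R n r.
apply: (@intC_le _ _ _ (fun x => M * \1_(box r) x)) => //.
- by apply: measurable_funM => //; exact: measurable_indic.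
- move=> x; rewrite indicE.
  have [->|/fr bx] := eqVneq (f x) 0; first by rewrite Normc.normc0 mulr_ge0.
  by rewrite mem_set// mulr1.
- under eq_integral do rewrite EFinM.
  rewrite ge0_integralZl ?lee_fin//; last first.
    by apply/measurable_EFinP; exact: measurable_indic.
  rewrite integral_indic// setIT lte_mul_pinfty// ?lee_fin//.
  exact: lebesgue_box_lty.
Qed.

Lemma intCM_cis f (u : 'rV[R]_n -> R) : measurable_fun setT u ->
  intC f -> intC (fun x => f x * cis (u x)).
Proof.
move=> mu0 [mf foo]; split; first by apply: measCM => //; exact: measC_cis.
by under eq_integral do rewrite Normc.normcM normc_cis mulr1.
Qed.

Lemma measurable_dotl y : measurable_fun setT (fun x => dot x y).
Proof. by apply: continuous_measurable_rV; exact: continuous_dot. Qed.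

Lemma measurable_dotr y : measurable_fun setT (dot y).
Proof.
rewrite (_ : dot y = fun x => dot x y); first exact: measurable_dotl.
by apply/funext => x; exact: dotC.
Qed.

Lemma measurable_dotNl y : measurable_fun setT (fun x => - dot x y).
Proof. by apply: measurableT_comp => //; exact: measurable_dotl. Qed.

Lemma fourier_le f xi : intC f ->
  ((Normc.normc (fourier f xi))%:E <= \int[mu]_x (Normc.normc (f x))%:E)%E.
Proof.
move=> If; rewrite fourierE.
apply: le_trans (normc_integralC (intCM_cis (measurable_dotNl xi) If)) _.
by under eq_integral do rewrite Normc.normcM normc_cis mulr1.
Qed.

Lemma measC_fourier f : measC f -> measC (fourier f).
Proof.
move=> mf.
have -> : fourier f = (fun xi => integralC (fun x => f x * cis (- dot x xi))).
  by apply/funext => xi; exact: fourierE.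
apply: (measC_integralC (F := fun p : 'rV[R]_n * 'rV[R]_n => f p.2 * cis (- dot p.2 p.1))).
apply: measCM; first exact: (measC_comp mf measurable_snd).
apply: measC_cis; apply: measurableT_comp => //.
by apply: measurable_dot; [exact: measurable_snd|exact: measurable_fst].
Qed.

(** Multiplication by a character is a translation on the Fourier side. *)
Lemma fourier_modulation f xi eta :
  fourier (fun x => f x * cis (- dot x eta)) xi = fourier f (xi + eta).
Proof.
rewrite !fourierE; congr integralC; apply/funext => x.
by rewrite -mulrA -cisD dotDr opprD addrC.
Qed.

Lemma cvg_harmonicZ (x z : 'rV[R]_n) :
  (- k.+1%:R^-1) *: z + x @[k --> \oo] --> x.
Proof.
rewrite -[X in _ --> X]add0r; apply: cvgD; last exact: cvg_cst.
rewrite -[X in _ --> X](scale0r z); apply: cvgZ; last exact: cvg_cst.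
by rewrite -oppr0; apply: cvgN; exact: cvg_harmonic.
Qed.

Lemma intC_affine (a : R) (b : 'rV[R]_n) f : a != 0 -> intC f ->
  intC (fun x => f (a *: x + b)).
Proof.
move=> a0 [mf foo]; split; first exact: (measC_comp mf (measurable_rV_affine a b)).
rewrite (ge0_integral_rV_affine b (f := fun y => (Normc.normc (f y))%:E) a0).
- by rewrite lte_mul_pinfty// ?lee_fin ?exprn_ge0 ?invr_ge0.
- by apply/measurable_EFinP; exact: measurable_normc.
- by move=> y; rewrite lee_fin normc_ge0.
Qed.

Lemma intC_real (u : 'rV[R]_n -> R) : measurable_fun setT u -> (forall x, 0 <= u x) ->
  (\int[mu]_x (u x)%:E < +oo)%E -> intC (fun x => (u x)%:C%C).
Proof.
move=> mu_ u0 uoo; split; first exact: measC_real.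
by under eq_integral do rewrite normcR//.
Qed.

End fourier_basics.

(** * Fourier inversion *)

Section inversion.
Context {R : realType} {n : nat}.
Local Notation mu := (lebesgue_rV R n).
Variable f : 'rV[R]_n -> R[i].
Hypothesis Cf : Cc f.
Hypothesis ff : (\int[mu]_xi (Normc.normc (fourier f xi))%:E < +oo)%E.

Let intCf := Cc_intC Cf.

Let fejer_prod_oo : (\int[mu]_x (fejer_prod x)%:E < +oo)%E.
Proof. by rewrite integral_fejer_prod ltry. Qed.

Let tri_prod_oo : (\int[mu]_x (tri_prod x)%:E < +oo)%E.
Proof.
have := integrable_tri_prodM (n := n) (@continuous_cstR R 'rV[R]_n 1).
move=> /integrableP[_]; apply: le_lt_trans.
by under [leRHS]eq_integral do rewrite /= mulr1 ger0_norm ?tri_prod_ge0//.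
Qed.

Let measurable_tri_prod : measurable_fun setT (@tri_prod R n).
Proof. by apply: continuous_measurable_rV; exact: continuous_tri_prod. Qed.

Let intC_tri_prod : intC (fun x : 'rV[R]_n => (tri_prod x)%:C%C).
Proof. by apply: intC_real => //; exact: tri_prod_ge0. Qed.

Let J (x : 'rV[R]_n) (e : R) :=
  integralC (fun z : 'rV[R]_n => f (- e *: z + x) * (fejer_prod z)%:C%C).

Let H (x : 'rV[R]_n) (e : R) xi : R[i] :=
  fourier f xi * cis (dot x xi) * (tri_prod (e *: xi))%:C%C.

(** Writing the kernel as the transform of [tri_prod] and exchanging the integrals gives this after
    the substitutions [y = x - e z] and [eta = e xi], whose Jacobians cancel. *)
Lemma smoothed_inversion x e : 0 < e -> J x e = integralC (H x e).
Proof.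
move=> e0.
pose F (p : 'rV[R]_n * 'rV[R]_n) : R[i] :=
  f (- e *: p.1 + x) * cis (dot p.2 p.1) * (tri_prod p.2)%:C%C.
have mfa : measC (fun z : 'rV[R]_n => f (- e *: z + x)).
  exact: (measC_comp (Cc_measC Cf) (measurable_rV_affine (- e) x)).
have mF : measC F.
  apply: measCM; last first.
    by apply: measC_real; exact: (measurableT_comp measurable_tri_prod measurable_snd).
  apply: measCM; first exact: (measC_comp mfa measurable_fst).
  by apply: measC_cis; apply: measurable_dot; [exact: measurable_snd|exact: measurable_fst].
have ne0 : - e != 0 by rewrite oppr_eq0 gt_eqF.
have intfa : intC (fun z : 'rV[R]_n => f (- e *: z + x)) by exact: intC_affine.
transitivity (integralC (fun z => integralC (fun eta => F (z, eta)))).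
  congr integralC; apply/funext => z.
  rewrite -integralC_kernel -integralCZl.
    by congr integralC; apply/funext => eta; rewrite /F /=; ring.
  by apply: intCM_cis; [exact: measurable_dotl|exact: intC_tri_prod].
rewrite (@integralC_Fubini _ _ _ (fun z => Normc.normc (f (- e *: z + x)))
    (@tri_prod R n)) //; last 5 first.
- exact: measurable_normc.
- by move=> z; exact: normc_ge0.
- exact: tri_prod_ge0.
- exact: intfa.2.
- by move=> z eta; rewrite /F !Normc.normcM normc_cis mulr1 normcR ?tri_prod_ge0.
have inner eta : integralC (fun z => F (z, eta)) =
    (e^-1 ^+ n)%:C%C * H x e (e^-1 *: eta + 0).
  pose h y : R[i] := f y * cis (- dot y (e^-1 *: eta)) *
    (cis (dot x (e^-1 *: eta)) * (tri_prod eta)%:C%C).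
  transitivity (integralC (fun z => h (- e *: z + x))).
    congr integralC; apply/funext => z; rewrite /F /h /= -!mulrA; congr (_ * _).
    rewrite mulrA -cisD; congr (cis _ * _).
    rewrite dotDl dotZl !dotZr dotC; field; exact: lt0r_neq0.
  rewrite (integralC_affine x ne0 (f := h)); last first.
    apply: measCM; last exact: measC_cst.
    by apply: measCM; [exact: Cc_measC|apply: measC_cis; exact: measurable_dotNl].
  rewrite normrN gtr0_norm//; congr (_ * _); rewrite addr0.
  rewrite /H scalerA divff ?gt_eqF// scale1r -mulrA fourierE [RHS]mulrC -integralCZl.
    by congr integralC; apply/funext => y; rewrite mulrC.
  by apply: intCM_cis => //; exact: measurable_dotNl.
under eq_fun do rewrite inner.
have mH : measC (H x e).
  apply: measCM; first (apply: measCM; first exact: measC_fourier intCf.1).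
    by apply: measC_cis; exact: measurable_dotr.
  apply: measC_real.
  apply: (measurableT_comp (continuous_measurable_rV (@continuous_tri_prod R n))).
  have := measurable_rV_affine e (0 : 'rV[R]_n).
  by under eq_fun do rewrite addr0.
have IH : intC (H x e).
  apply: (@intC_le _ _ _ (fun xi => Normc.normc (fourier f xi))) => //.
    by apply: measurable_normc; exact: measC_fourier intCf.1.
  move=> xi; rewrite /H !Normc.normcM normc_cis mulr1 normcR ?tri_prod_ge0//.
  by rewrite ler_piMr ?normc_ge0 ?tri_prod_le1.
have ei0 : e^-1 != 0 by rewrite invr_eq0 gt_eqF.
rewrite integralCZl; last first.
  exact: (intC_affine 0 ei0 IH).
rewrite (integralC_affine 0 ei0 mH) gtr0_norm ?invr_gt0// invrK mulrA.
by rewrite -rmorphM -exprMn mulVf ?gt_eqF// expr1n mul1r.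
Qed.

(** As the scale of the kernel tends to 0, the two sides of [smoothed_inversion] converge by
    dominated convergence: the smoothing of [f] is dominated by a multiple of the kernel, the other
    side by the integrable function [|fourier f|]. *)
Lemma fourier_inversion x :
  (@fejer_mass R n)%:C%C * f x = integralC (fun xi : 'rV[R]_n => fourier f xi * cis (dot x xi)).
Proof.
pose e k : R := k.+1%:R^-1.
have [M M0 fM] := Cc_bounded Cf; have [cR cI _] := Cf.
have mkap : measC (fun z : 'rV[R]_n => (fejer_prod z)%:C%C).
  by apply: measC_real; exact: measurable_fejer_prod.
have ikap : mu.-integrable setT (EFin \o (fun z : 'rV[R]_n => M * fejer_prod z)).
  rewrite (_ : _ \o _ = (fun z : 'rV[R]_n => M%:E * (fejer_prod z)%:E)%E); last by apply/funext.
  apply: integrableZl => //; apply/integrableP; split.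
    by apply/measurable_EFinP; exact: measurable_fejer_prod.
  by under eq_integral do rewrite /= ger0_norm ?fejer_prod_ge0//.
have e0 k : 0 < e k by rewrite invr_gt0.
have cvgf (p : R[i] -> R) : continuous (fun y => p (f y)) ->
    forall z, p (f (- e k *: z + x)) @[k --> \oo] --> p (f x).
  by move=> cp z; exact: (cvg_comp _ _ (@cvg_harmonicZ R n x z) (cp x)).
have JJ : (complex.Re (J x (e k)) @[k --> \oo] -->
      complex.Re (integralC (fun z : 'rV[R]_n => f x * (fejer_prod z)%:C%C))) /\
    (complex.Im (J x (e k)) @[k --> \oo] -->
      complex.Im (integralC (fun z : 'rV[R]_n => f x * (fejer_prod z)%:C%C))).
  apply: (@dominated_integralC R n
    (fun k (z : 'rV[R]_n) => f (- e k *: z + x) * (fejer_prod z)%:C%C)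
    (fun z : 'rV[R]_n => f x * (fejer_prod z)%:C%C) (fun z : 'rV[R]_n => M * fejer_prod z)) => //.
  - move=> k; apply: measCM => //.
    exact: (measC_comp (Cc_measC Cf) (measurable_rV_affine (- e k) x)).
  - by apply: measCM => //; exact: measC_cst.
  - move=> z; under eq_fun do rewrite cReM /= mulr0 subr0.
    by rewrite cReM /= mulr0 subr0; apply: cvgM; [exact: (cvgf (@complex.Re R))|exact: cvg_cst].
  - move=> z; under eq_fun do rewrite cImM /= mulr0 add0r.
    by rewrite cImM /= mulr0 add0r; apply: cvgM; [exact: (cvgf (@complex.Im R))|exact: cvg_cst].
  - move=> k z; rewrite Normc.normcM normcR ?fejer_prod_ge0// ler_wpM2r ?fejer_prod_ge0//.
have intCff : intC (fourier f) by split => //; exact: measC_fourier intCf.1.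
have iff : mu.-integrable setT (EFin \o (fun xi : 'rV[R]_n => Normc.normc (fourier f xi))).
  apply/integrableP; split.
    by apply/measurable_EFinP; apply: measurable_normc; exact: intCff.1.
  by under eq_integral do rewrite /= ger0_norm ?normc_ge0//.
have cvg_tri_prod (xi : 'rV[R]_n) : tri_prod (e k *: xi) @[k --> \oo] --> (1 : R).
  rewrite -(@tri_prod0 R n); have c0 : e k *: xi @[k --> \oo] --> (0 : 'rV[R]_n).
    rewrite -[X in _ --> X](scale0r xi); apply: cvgZ; last exact: cvg_cst.
    exact: cvg_harmonic.
  exact: (cvg_comp _ _ c0 (@continuous_tri_prod R n 0)).
have mcis : measC (fun xi : 'rV[R]_n => fourier f xi * cis (dot x xi)).
  apply: measCM; first exact: intCff.1.
  by apply: measC_cis; exact: measurable_dotr.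
have HH : (complex.Re (integralC (H x (e k))) @[k --> \oo] -->
      complex.Re (integralC (fun xi : 'rV[R]_n => fourier f xi * cis (dot x xi)))) /\
    (complex.Im (integralC (H x (e k))) @[k --> \oo] -->
      complex.Im (integralC (fun xi : 'rV[R]_n => fourier f xi * cis (dot x xi)))).
  apply: (@dominated_integralC R n (fun k => H x (e k))
    (fun xi : 'rV[R]_n => fourier f xi * cis (dot x xi))
    (fun xi : 'rV[R]_n => Normc.normc (fourier f xi))) => //.
  - move=> k; apply: measCM => //; apply: measC_real.
    apply: (measurableT_comp measurable_tri_prod).
    by have := measurable_rV_affine (e k) (0 : 'rV[R]_n); under eq_fun do rewrite addr0.
  - move=> xi; set a := complex.Re (fourier f xi * cis (dot x xi)).
    have -> : (fun k => complex.Re (H x (e k) xi)) = (fun k => a * tri_prod (e k *: xi)).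
      by apply/funext => k; rewrite /H cReM [complex.Im _%:C%C]/= mulr0 subr0.
    by rewrite -(mulr1 a); apply: cvgM; [rewrite mulr1; exact: cvg_cst|exact: cvg_tri_prod].
  - move=> xi; set a := complex.Im (fourier f xi * cis (dot x xi)).
    have -> : (fun k => complex.Im (H x (e k) xi)) = (fun k => a * tri_prod (e k *: xi)).
      by apply/funext => k; rewrite /H cImM [complex.Im _%:C%C]/= mulr0 add0r.
    by rewrite -(mulr1 a); apply: cvgM; [rewrite mulr1; exact: cvg_cst|exact: cvg_tri_prod].
  - move=> k xi; rewrite /H !Normc.normcM normc_cis mulr1 normcR ?tri_prod_ge0//.
    by rewrite ler_piMr ?normc_ge0 ?tri_prod_le1.
have JH k : J x (e k) = integralC (H x (e k)) by exact: smoothed_inversion.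
have <- : integralC (fun z : 'rV[R]_n => f x * (fejer_prod z)%:C%C) = (@fejer_mass R n)%:C%C * f x.
  rewrite integralCZl; last first.
    by apply: intC_real => //; [exact: measurable_fejer_prod|exact: fejer_prod_ge0].
  rewrite mulrC; congr (_ * _); apply: complex_eqP => /=.
    by rewrite /Rintegral integral_fejer_prod.
  by rewrite Rintegral_cst// mul0r.
have JHf (p : R[i] -> R) :
    (fun k => p (integralC (H x (e k)))) = (fun k => p (J x (e k))).
  by apply/funext => k; rewrite JH.
case: HH; rewrite (JHf (@complex.Re R)) (JHf (@complex.Im R)) => H1 H2.
by apply: complex_eqP; [exact: (cvg_unique _ JJ.1 H1)|exact: (cvg_unique _ JJ.2 H2)].
Qed.

End inversion.

(** * Products and convolutions *)

Section complex_continuity.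
Context {R : realType} {T : topologicalType}.
Implicit Type f : T -> R[i].

Lemma complex_continuousP f : continuous (f : T -> R[i]^o) <->
  continuous (fun x => complex.Re (f x)) /\ continuous (fun x => complex.Im (f x)).
Proof.
split=> [cf|[cR cI] x].
  split=> x.
    apply/cvgrPdist_lt => e e0.
    have e0C : 0 < e%:C%C :> R[i] by rewrite ltcR.
    have /cvgrPdist_lt /(_ _ e0C) := cf x; apply: filterS => y.
    rewrite -normc_normr ltcR; apply: le_lt_trans.
    by apply: le_trans (Re_le_normc _); case: (f x) => ? ?; case: (f y).
  apply/cvgrPdist_lt => e e0.
  have e0C : 0 < e%:C%C :> R[i] by rewrite ltcR.
  have /cvgrPdist_lt /(_ _ e0C) := cf x; apply: filterS => y.
  rewrite -normc_normr ltcR; apply: le_lt_trans.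
  by apply: le_trans (Im_le_normc _); case: (f x) => ? ?; case: (f y).
apply/cvgrPdist_lt => e e0.
have [e1 e1E] : exists2 e1 : R, 0 < e1 & e = e1%:C%C.
  case: e e0 => a b; rewrite ltcE /= => /andP[/eqP -> a0].
  by exists a.
move=> ->.
have e20 : 0 < e1 / 2 by rewrite divr_gt0.
have /cvgrPdist_lt /(_ _ e20) RH := cR x.
have /cvgrPdist_lt /(_ _ e20) IH := cI x.
near=> y.
rewrite -normc_normr ltcR (le_lt_trans (normc_le_ReIm _))// (splitr e1) ltrD//.
  have : `|complex.Re (f x) - complex.Re (f y)| < e1 / 2 by near: y.
  by case: (f x) => ? ?; case: (f y).
have : `|complex.Im (f x) - complex.Im (f y)| < e1 / 2 by near: y.
by case: (f x) => ? ?; case: (f y).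
Unshelve. all: by end_near.
Qed.

End complex_continuity.

Section convolution.
Context {R : realType} {n : nat}.
Local Notation mu := (lebesgue_rV R n).

Lemma supp_Cc (f : 'rV[R]_n -> R[i]) : continuous (f : 'rV[R]_n -> R[i]^o) ->
  compact (supp f) -> Cc f.
Proof.
move=> /complex_continuousP[cR cI] csf; split => //.
have [r sr] := compact_rV_bound csf; exists r => x fx i.
have sx : supp f x by apply: subset_closure.
by rewrite /= in_itv/= -ler_norml sr.
Qed.

Lemma test_function_Cc omega Omega (f : 'rV[R]_n -> R[i]) :
  test_function omega Omega f -> Cc f.
Proof. by case=> cf csf _ _; exact: supp_Cc. Qed.

Lemma Cc_opp (f : 'rV[R]_n -> R[i]) : Cc f -> Cc (fun x => - f x).
Proof.
move=> [fR fI [r fr]]; split.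
- rewrite (_ : (fun x => _) = fun x => - complex.Re (f x)).
    by apply: (continuous_compR (h := -%R)) => // y; exact: opp_continuous.
  by apply/funext => x; case: (f x).
- rewrite (_ : (fun x => _) = fun x => - complex.Im (f x)).
    by apply: (continuous_compR (h := -%R)) => // y; exact: opp_continuous.
  by apply/funext => x; case: (f x).
- by exists r => x; rewrite oppr_eq0 => /fr.
Qed.

Lemma Cc_add (f g : 'rV[R]_n -> R[i]) : Cc f -> Cc g -> Cc (fun x => f x + g x).
Proof.
move=> [fR fI [r fr]] [gR gI [s gs]]; split.
- by under eq_fun do rewrite cReD; exact: continuous_addR.
- by under eq_fun do rewrite cImD; exact: continuous_addR.
exists (Num.max r s) => x fgx i.
have : box r x \/ box s x.
  have [fx|fx] := eqVneq (f x) 0; last by left; exact: fr.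
  by right; apply: gs; move: fgx; rewrite fx add0r.
rewrite /= in_itv/= -ler_norml le_max => -[] /(_ i); rewrite /= in_itv/= -ler_norml => -> //.
by rewrite orbT.
Qed.

Lemma Cc_mull (f g : 'rV[R]_n -> R[i]) : Cc f ->
  continuous (fun x => complex.Re (g x)) -> continuous (fun x => complex.Im (g x)) ->
  Cc (fun x => f x * g x).
Proof.
move=> [fR fI [r fr]] gR gI; split.
- rewrite (_ : (fun x => _) = fun x => complex.Re (f x) * complex.Re (g x) +
    - complex.Im (f x) * complex.Im (g x)); last first.
    by apply/funext => x; rewrite cReM mulNr.
  apply: continuous_addR; apply: continuous_mulR => //.
  by apply: continuous_compR => // y; exact: opp_continuous.
- rewrite (_ : (fun x => _) = fun x => complex.Re (f x) * complex.Im (g x) +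
    complex.Im (f x) * complex.Re (g x)); last first.
    by apply/funext => x; rewrite cImM.
  by apply: continuous_addR; apply: continuous_mulR.
- by exists r => x; rewrite mulf_eq0 negb_or => /andP[/fr].
Qed.

Lemma Cc_mul (f g : 'rV[R]_n -> R[i]) : Cc f -> Cc g -> Cc (fun x => f x * g x).
Proof. by move=> Cf [gR gI _]; exact: Cc_mull. Qed.

(** Replace [chi] by its inversion integral and exchange the integrals: the transform of a product is
    a convolution. *)
Lemma fourier_mul (chi f : 'rV[R]_n -> R[i]) (xi : 'rV[R]_n) : Cc chi -> Cc f ->
  (\int[mu]_xi (Normc.normc (fourier chi xi))%:E < +oo)%E ->
  (@fejer_mass R n)%:C%C * fourier (fun x => chi x * f x) xi =
  integralC (fun eta => fourier chi eta * fourier f (xi - eta)).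
Proof.
move=> Cchi Cf fchi; have If := Cc_intC Cf.
have mfchi : measC (fourier chi) by apply: measC_fourier; exact: Cc_measC.
pose F (p : 'rV[R]_n * 'rV[R]_n) : R[i] :=
  (f p.1 * cis (- dot p.1 xi)) * (fourier chi p.2 * cis (dot p.1 p.2)).
have Ichi x : intC (fun eta => fourier chi eta * cis (dot x eta)).
  by apply: intCM_cis; [exact: measurable_dotr|split].
rewrite fourierE -integralCZl; last first.
  apply: intCM_cis; first exact: measurable_dotNl.
  exact: Cc_intC (Cc_mul Cchi Cf).
transitivity (integralC (fun x => integralC (fun eta => F (x, eta)))).
  congr integralC; apply/funext => x.
  have -> : integralC (fun eta => F (x, eta)) = _ :=
    integralCZl (f x * cis (- dot x xi)) (Ichi x).
  by rewrite -fourier_inversion//; ring.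
rewrite (@integralC_Fubini _ _ _ (fun x => Normc.normc (f x))
    (fun eta => Normc.normc (fourier chi eta))) //; last 7 first.
- by apply: measurable_normc; exact: If.1.
- exact: measurable_normc.
- by move=> x; exact: normc_ge0.
- by move=> x; exact: normc_ge0.
- exact: If.2.
- apply: measCM.
    apply: (measC_comp (phi := fst) (f := fun x => f x * cis (- dot x xi))) => //.
    by apply: (intCM_cis _ If).1; exact: measurable_dotNl.
  apply: measCM; first exact: (measC_comp mfchi measurable_snd).
  by apply: measC_cis; apply: measurable_dot; [exact: measurable_fst|exact: measurable_snd].
- by move=> x eta; rewrite /F !Normc.normcM !normc_cis !mulr1.
congr integralC; apply/funext => eta.
rewrite [fourier f _]fourierE -integralCZl; last by apply: intCM_cis => //; exact: measurable_dotNl.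
congr integralC; apply/funext => x; rewrite /F /=.
by rewrite dotDr dotNr opprD opprK cisD; ring.
Qed.

Lemma ge0_integral_convolution (a b : 'rV[R]_n -> R) :
  measurable_fun setT a -> measurable_fun setT b ->
  (forall x, 0 <= a x) -> (forall x, 0 <= b x) ->
  (\int[mu]_x \int[mu]_y (a y * b (x - y))%:E =
   \int[mu]_x (a x)%:E * \int[mu]_x (b x)%:E)%E.
Proof.
move=> ma mb a0 b0.
have mb2 : measurable_fun setT (fun p : 'rV[R]_n * 'rV[R]_n => b (p.1 - p.2)).
  exact: (measurableT_comp mb (@measurable_rV_sub R n)).
rewrite (fubini_tonelli (fun p : 'rV[R]_n * 'rV[R]_n => (a p.2 * b (p.1 - p.2))%:E))/=;
  last 2 first.
- apply/measurable_EFinP; apply: measurable_funM => //.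
  exact: (measurableT_comp ma measurable_snd).
- by move=> x; rewrite lee_fin mulr_ge0.
rewrite -ge0_integralZr//; last 3 first.
- exact/measurable_EFinP.
- by move=> x _; rewrite lee_fin.
- by apply: integral_ge0 => x _; rewrite lee_fin.
apply: eq_integral => y _; under eq_integral do rewrite EFinM.
rewrite ge0_integralZl//; last 3 first.
- apply/measurable_EFinP; have := measurable_rV_affine 1 (- y).
  by under eq_fun do rewrite scale1r; exact: measurableT_comp.
- by move=> x _; rewrite lee_fin.
- by rewrite lee_fin.
congr (_ * _)%E.
rewrite -[RHS]mul1e; have := ge0_integral_rV_affine (- y)
  (f := fun x => (b x)%:E) (oner_neq0 R).
rewrite normr1 invr1 expr1n => <- //; last exact/measurable_EFinP.
by under [RHS]eq_integral do rewrite scale1r.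
Qed.

End convolution.

(** * Weighted norms of Fourier transforms *)

Section weights.
Context {R : realType} {n : nat}.
Local Notation mu := (lebesgue_rV R n).
Variable omega : R -> R.
Hypothesis womega : weight omega.
Implicit Types (f g chi : 'rV[R]_n -> R[i]) (xi eta : 'rV[R]_n) (l : R).

Lemma measurable_omega_norm :
  measurable_fun setT (fun xi : 'rV[R]_n => omega (euclidean_norm xi)).
Proof.
pose h (t : R) := omega (Num.max 0 t).
have mh : measurable_fun setT h.
  apply: nondecreasing_measurable => // s t st; rewrite /h.
  apply: (weight_nondecreasing womega); first by rewrite le_max lexx.
  by rewrite ge_max !le_max lexx/= st orbT.
rewrite (_ : (fun xi => _) = h \o @euclidean_norm R n).
  exact: (measurableT_comp mh measurable_euclidean_norm).
apply/funext => xi; rewrite /h /=; congr omega.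
by apply/esym/max_idPr; exact: euclidean_norm_ge0.
Qed.

Definition wexp l xi : R := expR (l * omega (euclidean_norm xi)).

Lemma measurable_wexp l : measurable_fun setT (wexp l).
Proof.
apply: (measurableT_comp (@measurable_expR R)).
by apply: measurable_funM => //; exact: measurable_omega_norm.
Qed.

Lemma wexp_ge0 l xi : 0 <= wexp l xi. Proof. exact: expR_ge0. Qed.

Lemma omega_norm_ge0 xi : 0 <= omega (euclidean_norm xi).
Proof. by apply: weight_ge0 => //; exact: euclidean_norm_ge0. Qed.

Lemma omega_norm_add xi eta : omega (euclidean_norm (xi + eta)) <=
  omega (euclidean_norm xi) + omega (euclidean_norm eta).
Proof.
apply: le_trans (weight_subadditive womega _ _); try exact: euclidean_norm_ge0.
apply: (weight_nondecreasing womega); first exact: euclidean_norm_ge0.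
exact: ler_euclidean_normD.
Qed.

Lemma wexp_le l l' xi : l <= l' -> wexp l xi <= wexp l' xi.
Proof. by move=> ll; rewrite ler_expR ler_wpM2r// omega_norm_ge0. Qed.

(** Subadditivity of [omega] makes the weight submultiplicative. *)
Lemma wexp_add l xi eta : 0 <= l -> wexp l (xi + eta) <= wexp l xi * wexp l eta.
Proof. by move=> l0; rewrite -expRD ler_expR -mulrDr ler_wpM2l// omega_norm_add. Qed.

Lemma wexp0 xi : wexp 0 xi = 1.
Proof. by rewrite /wexp mul0r expR0. Qed.

Lemma wexp_ge1 l xi : 0 <= l -> 1 <= wexp l xi.
Proof. by move=> l0; rewrite -(wexp0 xi) wexp_le. Qed.

Lemma measurable_wnorm_arg l f : measC f ->
  measurable_fun setT (fun xi => Normc.normc (fourier f xi) * wexp l xi).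
Proof.
move=> mf; apply: measurable_funM; last exact: measurable_wexp.
by apply: measurable_normc; exact: measC_fourier.
Qed.

Lemma wnorm_arg_ge0 l f xi : 0 <= Normc.normc (fourier f xi) * wexp l xi.
Proof. by rewrite mulr_ge0 ?normc_ge0 ?wexp_ge0. Qed.

Lemma wnorm_ge0 l f : (0 <= wnorm omega l f)%E.
Proof. by apply: integral_ge0 => xi _; rewrite lee_fin wnorm_arg_ge0. Qed.

Lemma le_wnorm l l' f : measC f -> l <= l' -> (wnorm omega l f <= wnorm omega l' f)%E.
Proof.
move=> mf ll; apply: ge0_le_integral => //.
- by move=> xi _; rewrite lee_fin wnorm_arg_ge0.
- by apply/measurable_EFinP; exact: measurable_wnorm_arg.
- by apply/measurable_EFinP; exact: measurable_wnorm_arg.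
- by move=> xi _; rewrite lee_fin ler_wpM2l ?normc_ge0 ?wexp_le.
Qed.

Lemma fourier_lty l f : measC f -> 0 <= l -> (wnorm omega l f < +oo)%E ->
  (\int[mu]_xi (Normc.normc (fourier f xi))%:E < +oo)%E.
Proof.
move=> mf l0; apply: le_lt_trans; apply: le_trans (le_wnorm mf l0).
rewrite le_eqVlt; apply/orP; left; apply/eqP; apply: eq_integral => xi _.
by rewrite -/(wexp 0 xi) wexp0 mulr1.
Qed.

Lemma fourierD f g xi : intC f -> intC g ->
  fourier (fun x => f x + g x) xi = fourier f xi + fourier g xi.
Proof.
move=> If Ig; rewrite !fourierE -integralCD.
- by congr integralC; apply/funext => x; rewrite mulrDl.
- by apply: intCM_cis => //; exact: measurable_dotNl.
- by apply: intCM_cis => //; exact: measurable_dotNl.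
Qed.

Lemma fourierZ (c : R[i]) f xi : intC f ->
  fourier (fun x => c * f x) xi = c * fourier f xi.
Proof.
move=> If; rewrite !fourierE -integralCZl.
  by congr integralC; apply/funext => x; rewrite mulrA.
by apply: intCM_cis => //; exact: measurable_dotNl.
Qed.

Lemma wnormD l f g : intC f -> intC g ->
  (wnorm omega l (fun x => f x + g x)%R <= wnorm omega l f + wnorm omega l g)%E.
Proof.
move=> If Ig; rewrite -ge0_integralD//.
- apply: ge0_le_integral => //.
  + by move=> xi _; rewrite lee_fin wnorm_arg_ge0.
  + apply/measurable_EFinP; apply: measurable_wnorm_arg.
    exact: measCD If.1 Ig.1.
  + apply: emeasurable_funD; apply/measurable_EFinP; apply: measurable_wnorm_arg.
      exact: If.1.
    exact: Ig.1.
  + move=> xi _; rewrite -EFinD lee_fin -mulrDl ler_wpM2r ?wexp_ge0//.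
    by rewrite fourierD// ler_normcD.
- by move=> xi _; rewrite lee_fin wnorm_arg_ge0.
- by apply/measurable_EFinP; apply: measurable_wnorm_arg; exact: If.1.
- by move=> xi _; rewrite lee_fin wnorm_arg_ge0.
- by apply/measurable_EFinP; apply: measurable_wnorm_arg; exact: Ig.1.
Qed.

Lemma wnormN l f : intC f -> wnorm omega l (fun x => - f x) = wnorm omega l f.
Proof.
move=> If; apply: eq_integral => xi _; congr (_ * _)%:E.
rewrite (_ : (fun x => - f x) = (fun x => -1 * f x)); last first.
  by apply/funext => x; rewrite mulN1r.
by rewrite fourierZ// mulN1r normcN.
Qed.

Lemma fourier_bounded f : intC f ->
  exists M, forall xi, Normc.normc (fourier f xi) <= M.
Proof.
move=> If; exists (fine (\int[mu]_x (Normc.normc (f x))%:E)) => xi.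
rewrite -lee_fin fineK; first exact: fourier_le.
by rewrite ge0_fin_numE ?If.2//; apply: integral_ge0 => x _; rewrite lee_fin normc_ge0.
Qed.

(** By [fourier_mul] the transform of the product is a convolution, and the weight at [xi] is at most
    the product of the weights at [eta] and [xi - eta]. *)
Lemma wnorm_mul l chi f : 0 <= l -> Cc chi -> Cc f -> (wnorm omega l chi < +oo)%E ->
  (wnorm omega l (fun x => chi x * f x)%R <=
   ((@fejer_mass R n)^-1)%:E * (wnorm omega l chi * wnorm omega l f))%E.
Proof.
move=> l0 Cchi Cf chioo.
have k0 := @fejer_mass_gt0 R n.
have mchi := Cc_measC Cchi; have mf := Cc_measC Cf.
have If := Cc_intC Cf; have Icf := Cc_intC (Cc_mul Cchi Cf).
have fchi := fourier_lty mchi l0 chioo.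
rewrite -ge0_integral_convolution; last 4 first.
- exact: measurable_wnorm_arg.
- exact: measurable_wnorm_arg.
- exact: wnorm_arg_ge0.
- exact: wnorm_arg_ge0.
pose G xi := (\int[mu]_eta (Normc.normc (fourier chi eta) * wexp l eta *
   (Normc.normc (fourier f (xi - eta)) * wexp l (xi - eta)))%:E)%E.
have mG2 : measurable_fun setT (fun p : 'rV[R]_n * 'rV[R]_n =>
    Normc.normc (fourier chi p.2) * wexp l p.2 *
    (Normc.normc (fourier f (p.1 - p.2)) * wexp l (p.1 - p.2))).
  apply: measurable_funM.
    exact: (measurableT_comp (measurable_wnorm_arg l mchi) measurable_snd).
  exact: (measurableT_comp (measurable_wnorm_arg l mf) (@measurable_rV_sub R n)).
have G0 xi : (0 <= G xi)%E.
  by apply: integral_ge0 => eta _; rewrite lee_fin mulr_ge0 ?wnorm_arg_ge0.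
have mG : measurable_fun setT G.
  apply: (measurable_fun_fubini_tonelli_F (fun p : 'rV[R]_n * 'rV[R]_n =>
    (Normc.normc (fourier chi p.2) * wexp l p.2 *
    (Normc.normc (fourier f (p.1 - p.2)) * wexp l (p.1 - p.2)))%:E)).
    exact/measurable_EFinP.
  by move=> p; rewrite lee_fin mulr_ge0 ?wnorm_arg_ge0.
rewrite -ge0_integralZl//; last 2 first.
- by move=> xi _; exact: G0.
- by rewrite lee_fin invr_ge0 ltW.
apply: ge0_le_integral => //.
- by move=> xi _; rewrite lee_fin wnorm_arg_ge0.
- by apply/measurable_EFinP; apply: measurable_wnorm_arg; exact: Icf.1.
- by apply: emeasurable_funM.
move=> xi _; rewrite -/(G xi).
rewrite EFinM -/(wexp l xi).
have mconv : measC (fun eta => fourier chi eta * fourier f (xi - eta)).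
  apply: measCM; first exact: measC_fourier.
  exact: (measC_comp (measC_fourier mf) (measurable_rV_subr xi)).
have fE : ((@fejer_mass R n)%:E * (Normc.normc (fourier (fun x => chi x * f x)%R xi))%:E
    <= \int[mu]_eta (Normc.normc (fourier chi eta * fourier f (xi - eta)))%:E)%E.
  rewrite -EFinM -[X in (X * _)%:E]normcR ?(ltW k0)// -Normc.normcM fourier_mul//.
  have [M fM] := fourier_bounded If.
  apply: normc_integralC.
  apply: (@intC_le _ _ _ (fun eta => Normc.normc (fourier chi eta) * M)).
  - exact: mconv.
  - by apply: measurable_funM => //; apply: measurable_normc; exact: measC_fourier.
  - by move=> eta; rewrite Normc.normcM ler_wpM2l ?normc_ge0.
  - under eq_integral do rewrite EFinM.
    have M0 : 0 <= M by apply: le_trans (fM 0); exact: normc_ge0.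
    rewrite ge0_integralZr//.
    + have I0 : (0 <= \int[mu]_eta (Normc.normc (fourier chi eta))%:E)%E.
        by apply: integral_ge0 => x _; rewrite lee_fin normc_ge0.
      by rewrite lte_mul_pinfty ?ge0_fin_numE ?ltry.
    + by apply/measurable_EFinP; apply: measurable_normc; exact: measC_fourier.
    + by move=> x _; rewrite lee_fin normc_ge0.
have fE2 : ((Normc.normc (fourier (fun x => chi x * f x)%R xi))%:E <=
    ((@fejer_mass R n)^-1)%:E *
      \int[mu]_eta (Normc.normc (fourier chi eta * fourier f (xi - eta)))%:E)%E.
  by rewrite -lee_pdivrMl ?invr_gt0// invrK.
apply: (@le_trans _ _ ((((@fejer_mass R n)^-1)%:E *
      \int[mu]_eta (Normc.normc (fourier chi eta * fourier f (xi - eta)))%:E)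
      * (wexp l xi)%:E)%E).
  by rewrite lee_wpmul2r// lee_fin wexp_ge0.
rewrite -muleA lee_wpmul2l ?lee_fin ?invr_ge0 ?(ltW k0)//.
have mp : measurable_fun setT (fun eta => Normc.normc (fourier chi eta * fourier f (xi - eta))).
  exact: measurable_normc.
rewrite -ge0_integralZr//; last 3 first.
- exact/measurable_EFinP.
- by move=> eta _; rewrite lee_fin normc_ge0.
- by rewrite lee_fin wexp_ge0.
apply: ge0_le_integral => //.
- by move=> eta _; rewrite -EFinM lee_fin mulr_ge0 ?normc_ge0 ?wexp_ge0.
- by apply: emeasurable_funM => //; exact/measurable_EFinP.
- apply/measurable_EFinP.
  exact: (measurableT_comp mG2 (pair1_measurable xi)).
move=> eta _; rewrite -EFinM lee_fin Normc.normcM mulrACA ler_wpM2l ?mulr_ge0 ?normc_ge0//.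
by rewrite -[X in wexp l X <= _](subrK eta) mulrC wexp_add.
Qed.

Lemma integral_prod_oneDsqrV_lty :
  (\int[mu]_xi (\prod_(i < n) (1 + xi ord0 i ^+ 2)^-1)%:E < +oo)%E.
Proof.
rewrite (ge0_integral_rV_prod (h := fun _ (t : R) => (1 + t ^+ 2)^-1)).
- suff: (0 <= \prod_(i < n) \int[@lebesgue_measure R]_t ((1 + t ^+ 2)^-1)%:E < +oo)%E.
    by case/andP.
  have I0 : (0 <= \int[@lebesgue_measure R]_t ((1 + t ^+ 2)^-1)%:E)%E.
    by apply: integral_ge0 => t _; rewrite lee_fin invr_ge0 addr_ge0// sqr_ge0.
  elim/big_ind : _ => [|x y /andP[x0 xy] /andP[y0 yy]|i _]; first by rewrite lee01 ltry.
  + by rewrite mule_ge0//= lte_mul_pinfty// ge0_fin_numE.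
  + by rewrite I0 integral_oneDsqrV_lty.
- by move=> i; apply: continuous_measurable_fun; exact: continuous_oneDsqrV.
- by move=> i t; rewrite invr_ge0 addr_ge0// sqr_ge0.
Qed.

(** This is how the growth condition on the weight enters: [omega] beats every multiple of the
    logarithm. *)
Lemma omega_ge_log (N : R) : exists2 T, 0 <= T & forall t, T <= t ->
  N * ln (1 + t) <= omega t.
Proof.
have /cvgryPge/(_ N) [M [_ MP]] := weight_log womega.
exists (`|M| + 1); first by rewrite addr_ge0.
move=> t tM.
have t0 : 0 < t by rewrite (lt_le_trans _ tM)// ltr_wpDl.
have lt0 : 0 < ln (1 + t) by rewrite ln_gt0// ltrDl.
have := MP t; rewrite /= ler_pdivlMr//; apply.
by rewrite (le_lt_trans (ler_norm M))// (lt_le_trans _ tM)// ltrDl.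
Qed.

Lemma omega_cvg_pinfty (A : R) : exists2 T, 0 <= T & forall t, T <= t -> A <= omega t.
Proof.
have [T T0 TP] := omega_ge_log 1.
exists (Num.max T (expR A)); first by rewrite le_max T0.
move=> t; rewrite ge_max => /andP[Tt At].
apply: le_trans (TP _ Tt); rewrite mul1r.
have t0 : 0 < t by rewrite (lt_le_trans (expR_gt0 A)).
by rewrite -[leLHS]expRK ler_ln ?posrE ?expR_gt0 ?addr_gt0// (le_trans At)// lerDr.
Qed.

Lemma coord_le_euclidean_norm xi i : `|xi ord0 i| <= euclidean_norm xi.
Proof.
rewrite -sqrtr_sqr ler_wsqrtr// (bigD1 i)//= lerDl.
by apply: sumr_ge0 => j _; exact: sqr_ge0.
Qed.

(** [exp(- omega)] decays faster than any power. The power 2n is chosen because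
    [(1 + r)^(2n)] dominates the product of the [1 + xi_i^2] when [|xi| <= r]; the constant accounts
    for the ball where [omega] does not yet dominate the logarithm. *)
Lemma wexpN_le : exists2 C, 0 <= C & forall xi,
  wexp (-1) xi <= C * \prod_(i < n) (1 + xi ord0 i ^+ 2)^-1.
Proof.
have [T T0 TP] := omega_ge_log (2 * n)%:R.
(* each factor 1 + xi_i^2 is at most (1 + r)^2 *)
have P (xi : 'rV[R]_n) (r : R) : euclidean_norm xi <= r ->
    (1 + r) ^- (2 * n) <= \prod_(i < n) (1 + xi ord0 i ^+ 2)^-1.
  move=> xr; have r0 : 0 <= r by apply: le_trans xr; exact: euclidean_norm_ge0.
  rewrite exprM -exprVn -[in leLHS](card_ord n) -prodr_const.
  apply: ler_prod => i _; rewrite invr_ge0 sqr_ge0/= lef_pV2 ?posrE; last 2 first.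
  - by rewrite exprn_gt0// ltr_pwDl.
  - by rewrite ltr_pwDl// sqr_ge0.
  have xi2 : xi ord0 i ^+ 2 <= r ^+ 2.
    rewrite -[leLHS]real_normK ?num_real// ler_pXn2r ?nnegrE//.
    exact: le_trans (coord_le_euclidean_norm xi i) xr.
  by rewrite sqrrD expr1n mul1r -addrA lerD2l (le_trans xi2)// lerDr mulrn_wge0.
have p1 (t : R) : 0 <= t -> 0 < (1 + t) ^+ (2 * n).
  by move=> t0; rewrite exprn_gt0// ltr_pwDl.
exists ((1 + T) ^+ (2 * n)); first exact: ltW (p1 _ T0).
move=> xi; have [xT|xT] := leP (euclidean_norm xi) T.
  apply: (@le_trans _ _ 1).
    by rewrite -[leRHS](wexp0 xi) wexp_le// lerN10.
  have H := P _ _ xT; rewrite -(ler_pM2l (p1 _ T0)) in H; apply: le_trans H.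
  by rewrite divff// gt_eqF// p1.
have e0 := euclidean_norm_ge0 xi.
apply: (@le_trans _ _ ((1 + euclidean_norm xi) ^- (2 * n))).
  rewrite /wexp mulN1r expRN lef_pV2 ?posrE ?expR_gt0 ?p1//.
  have H := TP _ (ltW xT); rewrite -ler_expR in H; apply: le_trans H.
  by rewrite mulrC expRM_natr lnK// posrE ltr_pwDl.
apply: le_trans (P _ _ (lexx _)) _; rewrite ler_peMl//.
  by apply: prodr_ge0 => i _; rewrite invr_ge0 addr_ge0// sqr_ge0.
by rewrite exprn_ege1// lerDl.
Qed.

Lemma integral_wexpN_lty : (\int[mu]_xi (wexp (-1) xi)%:E < +oo)%E.
Proof.
have [C C0 CP] := wexpN_le.
have mP : measurable_fun setT (fun xi : 'rV[R]_n => \prod_(i < n) (1 + xi ord0 i ^+ 2)^-1).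
  apply: (@measurable_prod _ _ _ _ _ _ (fun i (xi : 'rV[R]_n) => (1 + xi ord0 i ^+ 2)^-1)) => i _.
  apply: (measurableT_comp (f := fun t : R => (1 + t ^+ 2)^-1)); last exact: measurable_rV_coord.
  by apply: continuous_measurable_fun; exact: continuous_oneDsqrV.
have P0 (xi : 'rV[R]_n) : 0 <= \prod_(i < n) (1 + xi ord0 i ^+ 2)^-1.
  by apply: prodr_ge0 => i _; rewrite invr_ge0 addr_ge0// sqr_ge0.
apply: (@le_lt_trans _ _ (\int[mu]_xi (C%:E * (\prod_(i < n) (1 + xi ord0 i ^+ 2)^-1)%:E))%E).
  apply: ge0_le_integral => //.
  - by move=> xi _; rewrite lee_fin wexp_ge0.
  - by apply/measurable_EFinP; exact: measurable_wexp.
  - by apply: emeasurable_funM => //; exact/measurable_EFinP.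
  - by move=> xi _; rewrite -EFinM lee_fin.
rewrite ge0_integralZl ?lee_fin//.
- by rewrite lte_mul_pinfty ?lee_fin// integral_prod_oneDsqrV_lty.
- exact/measurable_EFinP.
- by move=> xi _; rewrite lee_fin.
Qed.

Section wnormK.
Variable Omega : set 'rV[R]_n.
Implicit Type K : set 'rV[R]_n.

Lemma wnormK_le K l chi f : test_function omega Omega chi ->
  (forall x, K x -> chi x = 1) ->
  (wnormK omega Omega K l f <= wnorm omega l (chi \* f)%R)%E.
Proof. by move=> tchi chi1; apply: ereal_inf_lbound; exists chi. Qed.

(** Every [psi] competing in the infimum equals 1 on the support of [chi], so [chi f] is the product
    of [chi] and [psi f] and [wnorm_mul] applies. The constant depends on [chi] only: one fixed cutoff
    thus replaces the cutoffs, varying along a net, that nearly attain the infimum. *)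
Lemma wnorm_le_wnormK chi : test_function omega Omega chi ->
  exists l0 C, [/\ 0 < l0, 0 < C & forall l f, 0 <= l -> l <= l0 ->
    ultradifferentiable omega Omega f ->
    (wnorm omega l (chi \* f)%R <= C%:E * wnormK omega Omega (supp chi) l f)%E].
Proof.
move=> tchi; have Cchi := test_function_Cc tchi.
have [_ _ _ [l0 l00 chioo]] := tchi.
pose N := fine (wnorm omega l0 chi).
have NE : N%:E = wnorm omega l0 chi by rewrite fineK// ge0_fin_numE ?wnorm_ge0.
have N0 : 0 <= N by rewrite -lee_fin NE wnorm_ge0.
pose C := (@fejer_mass R n)^-1 * N + 1.
have k0 : 0 <= (@fejer_mass R n)^-1 by rewrite invr_ge0 ltW// fejer_mass_gt0.
have C0 : 0 < C by rewrite ltr_wpDl// mulr_ge0.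
exists l0, C; split => // l f l_ge0 ll0 uf.
rewrite -lee_pdivrMl//; apply: le_ereal_inf_tmp => _ [psi [tpsi psi1] <-].
rewrite lee_pdivrMl//.
have tpf := uf.2 _ tpsi.
have -> : chi \* f = (fun x => chi x * (psi \* f) x).
  apply/funext => x /=; have [->|cx] := eqVneq (chi x) 0; first by rewrite !mul0r.
  by rewrite psi1 ?mul1r//; apply: subset_closure.
have chil : (wnorm omega l chi <= N%:E)%E.
  by rewrite NE le_wnorm//; exact: Cc_measC.
apply: le_trans (wnorm_mul l_ge0 Cchi (test_function_Cc tpf) _) _.
  by apply: le_lt_trans chil _; rewrite ltry.
rewrite muleA lee_wpmul2r ?wnorm_ge0//.
apply: (@le_trans _ _ (((@fejer_mass R n)^-1)%:E * N%:E)%E).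
  by rewrite lee_wpmul2l ?lee_fin.
by rewrite -EFinM lee_fin lerDl.
Qed.

End wnormK.

End weights.

(** * The gliding hump *)

(** Suppose that the values of [F e] cannot be bounded by any multiple of [w n e] for small [e]. Then
    some series with coefficients [b n] has sums at least [2 * w n e] along suitable [e] tending to 0.
    The coefficients are chosen in turn, with a budget [delta] that at least halves at each step. At
    step [n] pick [e] and [x] with [delta * |F e x| >= 8 * w n e]; the partial sum and the partial sum
    plus [delta * F e x] cannot both be smaller than [4 * w n e], so the new coefficient can be taken to
    be 0 or [delta]. The next budget is so small that all later terms together change the sum at that
    [e] by at most [2 * w n e]. *)
Lemma gliding_hump (R : realType) (X : Type) (F : R -> X -> R[i]) (M : R -> R)
    (w : nat -> R -> R) :
  (forall e x, 0 < e < 1 -> Normc.normc (F e x) <= M e) ->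
  (forall n e, 0 < w n e) ->
  (forall n (C : R), 0 < C -> exists e x, 0 < e < n.+1%:R^-1 /\
     C * w n e <= Normc.normc (F e x)) ->
  exists (b : nat -> R) (x : nat -> X),
    (forall n, 0 <= b n <= 2^-1 ^+ n) /\
    forall n, exists2 e, 0 < e < n.+1%:R^-1 & forall N, (n < N)%N ->
      2 * w n e <= Normc.normc (\sum_(j < N) (b j)%:C%C * F e (x j)).
Proof.
move=> FM w0 Fw.
pose st := (R * (R -> R[i]))%type.
have [f fP] : {f : nat * st -> R * X * R & forall p, 0 < p.2.1 ->
    [/\ 0 < (f p).2 < p.1.+1%:R^-1, 0 <= (f p).1.1 <= p.2.1 &
        4 * w p.1 (f p).2 <=
        Normc.normc (p.2.2 (f p).2 + ((f p).1.1)%:C%C * F (f p).2 (f p).1.2)]}.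
  pose Q (p : nat * st) (r : R * X * R) := 0 < p.2.1 ->
    [/\ 0 < r.2 < p.1.+1%:R^-1, 0 <= r.1.1 <= p.2.1 &
        4 * w p.1 r.2 <= Normc.normc (p.2.2 r.2 + (r.1.1)%:C%C * F r.2 r.1.2)].
  apply: (@choice _ _ Q) => -[n [delta T]].
  have [d0|d0] := ltP 0 delta; last first.
    have [e [x _]] := Fw 0%N 1 ltr01.
    by exists (0, x, e) => /= d1; have := lt_le_trans d1 d0; rewrite ltxx.
  have [e [x [e01 Fex]]] := Fw n (8 / delta) (divr_gt0 (ltr0n R 8) d0).
  rewrite mulrAC ler_pdivrMr// in Fex.
  have [Tw|Tw] := leP (4 * w n e) (Normc.normc (T e)).
    exists (0, x, e) => _; split => //=; first by rewrite lexx ltW.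
    by rewrite mul0r addr0.
  exists (delta, x, e) => _; split => //=; first by rewrite lexx ltW.
  have := ler_normcD (T e + delta%:C%C * F e x) (- T e).
  rewrite addrAC subrr add0r Normc.normcM normcR ?(ltW d0)// normcN => H.
  have : Normc.normc (F e x) * delta <= Normc.normc (T e + delta%:C%C * F e x) + 4 * w n e.
    by rewrite mulrC (le_trans H)// lerD2l ltW.
  by move=> H2; have := le_trans Fex H2; lra.
(* a state is the remaining budget together with the partial sum, as a function of e *)
pose next n (s : st) : st := let r := f (n, s) in
  (Num.min (s.1 / 2) (w n r.2 / (M r.2 + 1)),
   fun e => s.2 e + (r.1.1)%:C%C * F e r.1.2).
pose S := fix S n : st := if n is m.+1 then next m (S m) else (1, fun=> 0).
pose e n := (f (n, S n)).2; pose b n := (f (n, S n)).1.1; pose x n := (f (n, S n)).1.2.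
have M0 t (y : X) : 0 < t < 1 -> 0 <= M t.
  by move=> t01; apply: le_trans (FM t y t01); exact: normc_ge0.
have inv1 n : n.+1%:R^-1 <= 1 :> R by rewrite invf_le1 ?ler1n ?ltr0n.
have S0 n : 0 < (S n).1.
  elim: n => [|n IH] /=; first exact: ltr01.
  have [/andP[e0 e1] _ _] := fP (n, S n) IH.
  rewrite lt_min divr_gt0//= divr_gt0// ltr_wpDl// (M0 _ (x n))// e0/=.
  exact: lt_le_trans e1 (inv1 n).
have e01 n : 0 < e n < n.+1%:R^-1 by have [] := fP (n, S n) (S0 n).
have eI n : 0 < e n < 1.
  by have /andP[-> e1] := e01 n; exact: lt_le_trans e1 (inv1 n).
have bS n : 0 <= b n <= (S n).1 by have [] := fP (n, S n) (S0 n).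
have Shalf n : (S n.+1).1 <= (S n).1 / 2 by rewrite /= ge_min lexx.
have Sgeo n k : (S (n + k)%N).1 <= (S n).1 * 2^-1 ^+ k.
  elim: k => [|k IH]; first by rewrite addn0 expr0 mulr1.
  by rewrite addnS exprSr mulrA (le_trans (Shalf _))// ler_pM2r ?invr_gt0.
have TE n t : (S n).2 t = \sum_(j < n) (b j)%:C%C * F t (x j).
  by elim: n => [|n IH]; rewrite ?big_ord0// big_ord_recr -IH.
exists b, x; split=> [n|n].
  have /andP[-> bn] := bS n; rewrite (le_trans bn)//.
  by have := Sgeo 0%N n; rewrite mul1r.
exists (e n) => // N nN; rewrite -TE.
have M0e := M0 _ (x n) (eI n).
have tail k : Normc.normc ((S (n.+1 + k)%N).2 (e n) - (S n.+1).2 (e n)) <=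
    (S n.+1).1 * M (e n) * (2 - 2 * 2^-1 ^+ k).
  elim: k => [|k IH].
    by rewrite addn0 subrr Normc.normc0 expr0 mulr1 subrr mulr0.
  have -> : (S (n.+1 + k.+1)%N).2 (e n) - (S n.+1).2 (e n) =
      ((S (n.+1 + k)%N).2 (e n) - (S n.+1).2 (e n)) +
      (b (n.+1 + k)%N)%:C%C * F (e n) (x (n.+1 + k)%N).
    by rewrite addnS [(S (n.+1 + k).+1).2 (e n)]/= -addrA [RHS]addrAC addrA.
  apply: le_trans (ler_normcD _ _) _; apply: le_trans (lerD IH (lexx _)) _.
  have /andP[bk0 bk] := bS (n.+1 + k)%N.
  rewrite Normc.normcM normcR//.
  apply: (@le_trans _ _ ((S n.+1).1 * M (e n) * (2 - 2 * 2^-1 ^+ k) +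
     (S n.+1).1 * 2^-1 ^+ k * M (e n))).
    rewrite lerD2l ler_pM ?normc_ge0//; last exact: FM.
    exact: le_trans bk (Sgeo _ _).
  rewrite exprSr; lra.
have [k Nk] : exists k, N = (n.+1 + k)%N by exists (N - n.+1)%N; rewrite subnKC.
have := tail k; rewrite -Nk => tk.
have [_ _ wn] := fP (n, S n) (S0 n).
have wn' : 4 * w n (e n) <= Normc.normc ((S n.+1).2 (e n)) by exact: wn.
have Sw : (S n.+1).1 * M (e n) <= w n (e n).
  have : (S n.+1).1 <= w n (e n) / (M (e n) + 1) by rewrite /= ge_min lexx orbT.
  rewrite ler_pdivlMr ?ltr_wpDl// => H; apply: le_trans H.
  by rewrite ler_wpM2l ?(ltW (S0 _))// lerDl.
have tk2 : Normc.normc ((S N).2 (e n) - (S n.+1).2 (e n)) <= 2 * w n (e n).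
  apply: le_trans tk _.
  have q0 : 0 <= 2^-1 ^+ k :> R by rewrite exprn_ge0.
  have SM0 : 0 <= (S n.+1).1 * M (e n) by rewrite mulr_ge0 ?(ltW (S0 _)).
  by have := mulr_ge0 SM0 q0; lra.
have := ler_normcD ((S N).2 (e n)) (- ((S N).2 (e n) - (S n.+1).2 (e n))).
rewrite normcN opprB addrCA subrr addr0 => H.
by have := le_trans wn' H; lra.
Qed.

Section dyadic_series.
Context {R : realType}.
Implicit Type a : nat -> R.

Let half_lt1 : `|2^-1 : R| < 1.
Proof. by rewrite ger0_norm ?invf_lt1 ?ltr1n. Qed.

Lemma cvg_half_exp (C : R) : C * 2^-1 ^+ N @[N --> \oo] --> (0 : R).
Proof.
rewrite -(mulr0 C); apply: cvgM; first exact: cvg_cst.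
exact: cvg_expr.
Qed.

Lemma half_exp_small (C eps : R) : 0 < eps ->
  exists N0, forall N, (N0 <= N)%N -> C * 2^-1 ^+ N <= eps.
Proof.
move=> e0; have /cvgrPdist_le/(_ _ e0)[N0 _ NP] := cvg_half_exp C.
exists N0 => N /NP; rewrite /= sub0r normrN; apply: le_trans; exact: ler_norm.
Qed.

Lemma dyadic_series a : (forall j, `|a j| <= 2^-1 ^+ j) ->
  forall N, `|limn (series a) - series a N| <= 2 * 2^-1 ^+ N.
Proof.
move=> aj N.
have tail k : `|series a (N + k)%N - series a N| <= 2 * 2^-1 ^+ N - 2 * 2^-1 ^+ (N + k).
  elim: k => [|k IH]; first by rewrite addn0 !subrr normr0.
  have -> : series a (N + k.+1)%N - series a N = (series a (N + k)%N - series a N) + a (N + k)%N.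
    by rewrite addnS seriesSr addrAC.
  apply: le_trans (ler_normD _ _) _; apply: le_trans (lerD IH (aj _)) _.
  by rewrite addnS exprSr; lra.
have ca : cvgn (series a).
  apply: normed_cvg; apply: (@series_le_cvg _ _ (geometric 1 2^-1)).
  - by move=> n; exact: normr_ge0.
  - by move=> n; rewrite /geometric/= mul1r exprn_ge0.
  - by move=> n; rewrite /geometric/= mul1r aj.
  - exact: is_cvg_geometric_series.
have cs : `|series a k - series a N| @[k --> \oo] --> `|limn (series a) - series a N|.
  by apply: cvg_norm; apply: cvgB => //; exact: cvg_cst.
rewrite -(cvg_lim _ cs)//; apply: limr_le; first by apply: cvgP cs.
near=> k; have Nk : (N <= k)%N by near: k; exact: nbhs_infty_ge.
rewrite -(subnKC Nk) (le_trans (tail _))// gerBl mulr_ge0// exprn_ge0//.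
Unshelve. all: by end_near.
Qed.

Lemma uniform_dyadic_continuous (T : topologicalType) (f_ : nat -> T -> R) (f : T -> R)
    (C : R) : (forall N, continuous (f_ N)) ->
  (forall N x, `|f x - f_ N x| <= C * 2^-1 ^+ N) -> continuous f.
Proof.
move=> cf fC x; apply/cvgrPdist_le => eps e0.
have e3 : 0 < eps / 3 by rewrite divr_gt0.
have [N0 /(_ _ (leqnn _)) NP] := half_exp_small C e3.
have /cvgrPdist_le/(_ _ e3) cN := cf N0 x.
near=> y.
have h1 := le_trans (fC N0 x) NP; have h2 := le_trans (fC N0 y) NP.
have h3 : `|f_ N0 x - f_ N0 y| <= eps / 3 by near: y.
move: h1 h2 h3; rewrite !ler_norml; lra.
Unshelve. all: by end_near.
Qed.

End dyadic_series.

(** * Test functions modulated by trigonometric series *)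

Section trig_series.
Context {R : realType} {n : nat}.
Local Notation mu := (lebesgue_rV R n).
Variables (c : nat -> R) (freq : nat -> 'rV[R]_n).
Hypothesis c0 : forall j, 0 <= c j <= 2^-1 ^+ j.
Implicit Types (x xi eta : 'rV[R]_n) (u : 'rV[R]_n -> R[i]).

Definition trig_sum N x : R[i] := \sum_(j < N) (c j)%:C%C * cis (- dot x (freq j)).

(** The series of the terms [c_j exp(- i x.freq_j)], summed in R rather than in R[i] because the
    convergence results apply to real series. *)
Definition trig_series x : R[i] :=
  Complex (limn (series (fun j => c j * cos (- dot x (freq j)))))
          (limn (series (fun j => c j * sin (- dot x (freq j))))).

Let cj_ge0 j : 0 <= c j. Proof. by case/andP : (c0 j). Qed.

Lemma Re_trig_sum N x : complex.Re (trig_sum N x) =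
  series (fun j => c j * cos (- dot x (freq j))) N.
Proof.
rewrite cRe_sum seriesEord; apply: eq_bigr => j _.
by rewrite cReM /= mul0r subr0.
Qed.

Lemma Im_trig_sum N x : complex.Im (trig_sum N x) =
  series (fun j => c j * sin (- dot x (freq j))) N.
Proof.
rewrite cIm_sum seriesEord; apply: eq_bigr => j _.
by rewrite cImM /= mul0r addr0.
Qed.

Let Re_approx N x : `|complex.Re (trig_series x) - complex.Re (trig_sum N x)| <= 2 * 2^-1 ^+ N.
Proof.
rewrite Re_trig_sum; apply: (dyadic_series (a := fun j => c j * cos (- dot x (freq j)))) => j.
rewrite normrM ger0_norm//; have /andP[_] := c0 j; apply: le_trans.
by rewrite ler_piMr// cos_max.
Qed.

Let Im_approx N x : `|complex.Im (trig_series x) - complex.Im (trig_sum N x)| <= 2 * 2^-1 ^+ N.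
Proof.
rewrite Im_trig_sum; apply: (dyadic_series (a := fun j => c j * sin (- dot x (freq j)))) => j.
rewrite normrM ger0_norm//; have /andP[_] := c0 j; apply: le_trans.
by rewrite ler_piMr// sin_max.
Qed.

Lemma trig_series_approx N x :
  Normc.normc (trig_series x - trig_sum N x) <= 4 * 2^-1 ^+ N.
Proof.
apply: le_trans (normc_le_ReIm _) _.
have -> : complex.Re (trig_series x - trig_sum N x) =
    complex.Re (trig_series x) - complex.Re (trig_sum N x).
  by case: (trig_series x); case: (trig_sum N x).
have -> : complex.Im (trig_series x - trig_sum N x) =
    complex.Im (trig_series x) - complex.Im (trig_sum N x).
  by case: (trig_series x); case: (trig_sum N x).
have := Re_approx N x; have := Im_approx N x; lra.
Qed.

Let continuous_Ndot xi : continuous (fun x : 'rV[R]_n => - dot x xi).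
Proof.
by apply: (continuous_compR (h := -%R)); [exact: continuous_dot|exact: opp_continuous].
Qed.

Lemma continuous_trig_series_Re : continuous (fun x => complex.Re (trig_series x)).
Proof.
apply: (uniform_dyadic_continuous (f_ := fun N x => complex.Re (trig_sum N x)) (C := 2)) => //.
move=> N; under eq_fun do rewrite Re_trig_sum /series /=.
apply: (continuous_bigsum (f := fun j x => c j * cos (- dot x (freq j)))) => j.
apply: continuous_mulR; first exact: continuous_cstR.
by apply: continuous_compR; [exact: continuous_Ndot|exact: continuous_cos].
Qed.

Lemma continuous_trig_series_Im : continuous (fun x => complex.Im (trig_series x)).
Proof.
apply: (uniform_dyadic_continuous (f_ := fun N x => complex.Im (trig_sum N x)) (C := 2)) => //.
move=> N; under eq_fun do rewrite Im_trig_sum /series /=.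
apply: (continuous_bigsum (f := fun j x => c j * sin (- dot x (freq j)))) => j.
apply: continuous_mulR; first exact: continuous_cstR.
by apply: continuous_compR; [exact: continuous_Ndot|exact: continuous_sin].
Qed.

Lemma Cc_mul_trig_series u : Cc u -> Cc (fun x => u x * trig_series x).
Proof.
move=> Cu; apply: Cc_mull => //; first exact: continuous_trig_series_Re.
exact: continuous_trig_series_Im.
Qed.

Lemma integralC_trig_sum u N : intC u ->
  intC (fun x => u x * trig_sum N x) /\
  integralC (fun x => u x * trig_sum N x) = \sum_(j < N) (c j)%:C%C * fourier u (freq j).
Proof.
move=> Iu; elim: N => [|N [IH1 IH2]].
  have E : (fun x => u x * trig_sum 0 x) = (fun x => 0 * u x).
    by apply/funext => x; rewrite /trig_sum big_ord0 mulr0 mul0r.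
  by rewrite E big_ord0 integralCZl// mul0r; split => //; exact: intCZl.
have E : (fun x => u x * trig_sum N.+1 x) =
    (fun x => u x * trig_sum N x + (c N)%:C%C * (u x * cis (- dot x (freq N)))).
  by apply/funext => x; rewrite /trig_sum big_ord_recr /= mulrDr; congr (_ + _); ring.
have Ic : intC (fun x => u x * cis (- dot x (freq N))).
  by apply: intCM_cis => //; exact: measurable_dotNl.
rewrite E big_ord_recr /= integralCD//; last exact: intCZl.
rewrite IH2 integralCZl// -fourierE; split => //.
split; first by apply: measCD; [exact: IH1.1|apply: measCM; [exact: measC_cst|exact: Ic.1]].
have Ic2 := intCZl (c N)%:C%C Ic.
apply: (@le_lt_trans _ _ (\int[mu]_x ((Normc.normc (u x * trig_sum N x))%:E +
  (Normc.normc ((c N)%:C%C * (u x * cis (- dot x (freq N)))))%:E))%E).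
  apply: ge0_le_integral => //.
  - by move=> x _; rewrite lee_fin normc_ge0.
  - apply/measurable_EFinP; apply: measurable_normc.
    exact: measCD IH1.1 Ic2.1.
  - apply: emeasurable_funD; apply/measurable_EFinP; apply: measurable_normc.
      exact: IH1.1.
    exact: Ic2.1.
  - by move=> x _; rewrite -EFinD lee_fin ler_normcD.
rewrite ge0_integralD//.
- by rewrite lte_add_pinfty//; [exact: IH1.2|exact: Ic2.2].
- by move=> x _; rewrite lee_fin normc_ge0.
- by apply/measurable_EFinP; apply: measurable_normc; exact: IH1.1.
- by move=> x _; rewrite lee_fin normc_ge0.
- by apply/measurable_EFinP; apply: measurable_normc; exact: Ic2.1.
Qed.

Definition L1norm u : R := fine (\int[mu]_x (Normc.normc (u x))%:E).

Lemma L1normE u : intC u -> (L1norm u)%:E = (\int[mu]_x (Normc.normc (u x))%:E)%E.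
Proof.
move=> Iu; rewrite fineK// ge0_fin_numE ?Iu.2//.
by apply: integral_ge0 => x _; rewrite lee_fin normc_ge0.
Qed.

(** Integrating [u] against the series is summing the transforms of [u] at the frequencies, up to the
    tail of the series times the L^1 norm. *)
Lemma integralC_trig_series u N : Cc u ->
  Normc.normc (integralC (fun x => u x * trig_series x) -
     \sum_(j < N) (c j)%:C%C * fourier u (freq j)) <= 4 * 2^-1 ^+ N * L1norm u.
Proof.
move=> Cu; have Iu := Cc_intC Cu; have [IS <-] := integralC_trig_sum N Iu.
have IP := Cc_intC (Cc_mul_trig_series Cu).
have IN := intCZl (-1) IS.
have -> : integralC (fun x => u x * trig_series x) - integralC (fun x => u x * trig_sum N x) =
    integralC (fun x => u x * (trig_series x - trig_sum N x)).
  rewrite -mulN1r -integralCZl// -integralCD//; congr integralC; apply/funext => x; ring.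
have md : measC (fun x => u x * (trig_series x - trig_sum N x)).
  rewrite (_ : (fun x => _) = (fun x => u x * trig_series x + -1 * (u x * trig_sum N x))).
    exact: measCD IP.1 IN.1.
  by apply/funext => x; ring.
have k0 : 0 <= 4 * 2^-1 ^+ N :> R by rewrite mulr_ge0// exprn_ge0.
have le1 x : Normc.normc (u x * (trig_series x - trig_sum N x)) <=
    4 * 2^-1 ^+ N * Normc.normc (u x).
  by rewrite Normc.normcM mulrC ler_wpM2r ?normc_ge0// trig_series_approx.
have mnu : measurable_fun setT (fun x => Normc.normc (u x)) by exact: measurable_normc Iu.1.
have IE : (\int[mu]_x (4 * 2^-1 ^+ N * Normc.normc (u x))%:E =
    (4 * 2^-1 ^+ N * L1norm u)%:E)%E.
  under eq_integral do rewrite EFinM.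
  rewrite ge0_integralZl ?lee_fin//; first by rewrite -L1normE.
  - exact/measurable_EFinP.
  - by move=> x _; rewrite lee_fin normc_ge0.
have Id : intC (fun x => u x * (trig_series x - trig_sum N x)).
  apply: intC_le le1 _ => //; first exact: measurable_funM.
  by rewrite IE ltry.
rewrite -lee_fin -IE; apply: le_trans (normc_integralC Id) _.
apply: ge0_le_integral => //.
- by move=> x _; rewrite lee_fin normc_ge0.
- by apply/measurable_EFinP; exact: measurable_normc.
- by apply/measurable_EFinP; exact: measurable_funM.
- by move=> x _; rewrite lee_fin.
Qed.

End trig_series.

Lemma sum_half_exp (R : realType) N : \sum_(j < N) 2^-1 ^+ j = 2 - 2 * 2^-1 ^+ N :> R.
Proof.
elim: N => [|N IH]; first by rewrite big_ord0 expr0 mulr1 subrr.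
by rewrite big_ord_recr /= IH exprSr; lra.
Qed.

Section modulated_test_function.
Context {R : realType} {n : nat}.
Local Notation mu := (lebesgue_rV R n).
Variable omega : R -> R.
Hypothesis womega : weight omega.
Variables (Omega : set 'rV[R]_n) (chi : 'rV[R]_n -> R[i]) (l0 : R).
Hypothesis l0_gt0 : 0 < l0.
Hypothesis tchi : test_function omega Omega chi.
Hypothesis chioo : (wnorm omega l0 chi < +oo)%E.
Variables (b : nat -> R) (freq : nat -> 'rV[R]_n).
Hypothesis b0 : forall j, 0 <= b j <= 2^-1 ^+ j.

Let c j := b j / wexp omega l0 (freq j).

Let wexp_gt0 (xi : 'rV[R]_n) : 0 < wexp omega l0 xi. Proof. exact: expR_gt0. Qed.

(** Dividing by the weight leaves room to translate the transform of [chi] by [freq j]. *)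
Lemma normalized_coeff j : 0 <= c j <= 2^-1 ^+ j.
Proof.
have /andP[bj0 bj] := b0 j; rewrite divr_ge0 ?wexp_ge0//=.
apply: le_trans bj; rewrite ler_piMr// invf_le1//.
by apply: wexp_ge1 => //; exact: ltW.
Qed.

Let rho x := chi x * trig_series c freq x.

Let h xi := Normc.normc (fourier chi xi) * wexp omega l0 xi.

Let Cchi : Cc chi. Proof. exact: test_function_Cc tchi. Qed.

Let h0 xi : 0 <= h xi. Proof. exact: wnorm_arg_ge0. Qed.

Let mh : measurable_fun setT h.
Proof. by apply: measurable_wnorm_arg => //; exact: Cc_measC. Qed.

Let mhs j : measurable_fun setT (fun eta => h (freq j + eta)).
Proof.
apply: (measurableT_comp mh); have := measurable_rV_affine 1 (freq j).
by under eq_fun do rewrite scale1r addrC.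
Qed.

Let bj_ge0 j : 0 <= b j. Proof. by case/andP : (b0 j). Qed.

(** The transform of [rho] is, up to the tail, a sum of translates of the transform of [chi]; the
    weight at [eta] is at most the weight at [freq j + eta] times the weight at [freq j], and the
    latter cancels the normalisation of the coefficients. *)
Lemma fourier_modulated_le N eta : Normc.normc (fourier rho eta) * wexp omega l0 eta <=
  \sum_(j < N) b j * h (freq j + eta) + 4 * 2^-1 ^+ N * L1norm chi * wexp omega l0 eta.
Proof.
pose u x := chi x * cis (- dot x eta).
have cN : continuous (fun x : 'rV[R]_n => - dot x eta).
  by apply: (continuous_compR (h := -%R)); [exact: continuous_dot|exact: opp_continuous].
have Cu : Cc u.
  apply: (Cc_mull (g := fun x => cis (- dot x eta))) => //=.
    by apply: continuous_compR => //; exact: continuous_cos.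
  by apply: continuous_compR => //; exact: continuous_sin.
have Lu : L1norm u = L1norm chi.
  congr fine; apply: eq_integral => x _.
  by rewrite /u Normc.normcM normc_cis mulr1.
have -> : fourier rho eta = integralC (fun x => u x * trig_series c freq x).
  by rewrite fourierE; congr integralC; apply/funext => x; rewrite /rho /u; ring.
have := integralC_trig_series freq normalized_coeff N Cu; rewrite Lu.
set I := integralC _; set S := \sum_(j < N) _ => IS.
have : Normc.normc I <= Normc.normc S + 4 * 2^-1 ^+ N * L1norm chi.
  rewrite -[X in Normc.normc X <= _](subrK S) addrC.
  by apply: le_trans (ler_normcD _ _) _; rewrite lerD2l.
move=> IS2; apply: (@le_trans _ _
  ((Normc.normc S + 4 * 2^-1 ^+ N * L1norm chi) * wexp omega l0 eta)).
  by rewrite ler_wpM2r ?wexp_ge0.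
rewrite mulrDl lerD2r; apply: (@le_trans _ _
  ((\sum_(j < N) c j * Normc.normc (fourier chi (freq j + eta))) * wexp omega l0 eta)).
  rewrite ler_wpM2r ?wexp_ge0//; apply: le_trans (normc_sum _ _) _.
  apply: ler_sum => j _; have /andP[cj _] := normalized_coeff j.
  by rewrite Normc.normcM normcR// fourier_modulation.
rewrite mulr_suml; apply: ler_sum => j _; rewrite /c /h -!mulrA ler_wpM2l//.
rewrite mulrCA ler_wpM2l ?normc_ge0// ler_pdivrMl//.
rewrite -[X in wexp _ _ X <= _](addrK (freq j)) [eta + _]addrC mulrC.
apply: le_trans (wexp_add womega _ _ (ltW l0_gt0)) _.
by rewrite /wexp euclidean_normN.
Qed.

(** The weighted norm is finite because each translate in [fourier_modulated_le] contributes
    [b j * wnorm chi] and the [b j] are summable. *)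
Lemma modulated_test_function : test_function omega Omega rho.
Proof.
have [_ csupp suppO _] := tchi.
have Crho : Cc rho by apply: Cc_mul_trig_series => //; exact: normalized_coeff.
have ss : supp rho `<=` supp chi.
  apply: closure_subset => x /=; apply: contraNN => /eqP cx.
  by rewrite /rho cx mul0r.
split.
- by apply/complex_continuousP; case: Crho.
- by apply: subclosed_compact ss => //; exact: closed_closure.
- exact: subset_trans ss suppO.
exists l0; first exact: l0_gt0.
pose G eta := (\sum_(0 <= j <oo) (b j * h (freq j + eta))%:E)%E.
have G_ge N eta : ((\sum_(j < N) b j * h (freq j + eta))%:E <= G eta)%E.
  rewrite -sumEFin -(big_mkord xpredT (fun j => (b j * h (freq j + eta))%:E)).
  by apply: nneseries_lim_ge => j _ _; rewrite lee_fin mulr_ge0.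
have rhoG eta : ((Normc.normc (fourier rho eta) * wexp omega l0 eta)%:E <= G eta)%E.
  apply/lee_addgt0Pr => eps e0.
  have [N0 /(_ _ (leqnn _)) NP] := half_exp_small (4 * L1norm chi * wexp omega l0 eta) e0.
  apply: (@le_trans _ _ (\sum_(j < N0) b j * h (freq j + eta) + eps)%:E).
    rewrite lee_fin (le_trans (fourier_modulated_le N0 eta))// lerD2l.
    by apply: le_trans NP; rewrite le_eqVlt; apply/orP; left; apply/eqP; ring.
  by rewrite EFinD leeD2r.
apply: (@le_lt_trans _ _ (\int[mu]_eta G eta)%E).
  apply: ge0_le_integral => //.
  - by move=> eta _; rewrite lee_fin wnorm_arg_ge0.
  - by apply/measurable_EFinP; apply: measurable_wnorm_arg => //; exact: Cc_measC.
  - apply: ge0_emeasurable_sum => [j eta _ _|j _]; first by rewrite lee_fin mulr_ge0.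
    by apply/measurable_EFinP; apply: measurable_funM.
rewrite integral_nneseries//; last 2 first.
- by move=> j; apply/measurable_EFinP; apply: measurable_funM.
- by move=> j eta _; rewrite lee_fin mulr_ge0.
pose W := fine (wnorm omega l0 chi).
have WE : W%:E = wnorm omega l0 chi by rewrite fineK// ge0_fin_numE ?wnorm_ge0.
have W0 : 0 <= W by rewrite -lee_fin WE wnorm_ge0.
have hE j : (\int[mu]_eta (h (freq j + eta))%:E = W%:E)%E.
  have -> : (W%:E = \int[mu]_x (h x)%:E)%E by rewrite WE.
  have := ge0_integral_rV_affine (freq j) (f := fun x => (h x)%:E) (oner_neq0 R).
  rewrite normr1 invr1 expr1n mul1e => <-; last 2 first.
  - exact/measurable_EFinP.
  - by move=> x; rewrite lee_fin.
  by apply: eq_integral => eta _; rewrite scale1r addrC.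
have IE j : (\int[mu]_eta (b j * h (freq j + eta))%:E = (b j * W)%:E)%E.
  under eq_integral do rewrite EFinM.
  rewrite ge0_integralZl ?lee_fin//.
  - by rewrite hE EFinM.
  - exact/measurable_EFinP.
  - by move=> eta _; rewrite lee_fin.
apply: (@le_lt_trans _ _ (2 * W)%:E); last by rewrite ltry.
apply: lime_le.
  by apply: is_cvg_nneseries => j _ _; rewrite IE lee_fin mulr_ge0.
apply: nearW => N; rewrite big_mkord; under eq_bigr do rewrite IE.
rewrite sumEFin lee_fin -mulr_suml ler_wpM2r//.
apply: (@le_trans _ _ (\sum_(j < N) 2^-1 ^+ j)).
  by apply: ler_sum => j _; case/andP : (b0 j).
by rewrite sum_half_exp gerBl mulr_ge0// exprn_ge0.
Qed.

End modulated_test_function.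

(** * Uniform decay of the Fourier transforms of a net *)

Section uniform_bound.
Context {R : realType} {n : nat}.
Variable omega : R -> R.
Hypothesis womega : weight omega.
Variables (Omega : set 'rV[R]_n) (g : R -> 'rV[R]_n -> R[i]).
Hypothesis ug : ultradifferentiable_net omega Omega g.
Hypothesis gneg : forall rho : 'rV[R]_n -> R[i], test_function omega Omega rho ->
  negligible_numbers omega (fun e => pairing (g e) rho).

(** The pairings of the net with the test functions [chi exp(- i x.xi)] are the values of the transform
    of [chi g_e]. Each is negligible, at a rate depending on [xi]; the bound below has one rate for all
    [xi], at the price of an exponential of [omega(|xi|)]. If it failed for every rate, [gliding_hump]
    with [w m e = exp(- omega(1/e) / (m+1))] would give frequencies and coefficients whose series times
    [chi] is a test function, and the pairing of the net with it would exceed [w m e] at suitable [e] for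
    every [m], hence would not be negligible. *)
Lemma uniform_fourier_bound (chi : 'rV[R]_n -> R[i]) (l0 : R) : 0 < l0 ->
  test_function omega Omega chi -> (wnorm omega l0 chi < +oo)%E ->
  exists k C e0, [/\ 0 < k, 0 < C, 0 < e0 & forall e (xi : 'rV[R]_n), 0 < e < e0 ->
    Normc.normc (fourier (chi \* g e) xi) <=
    C * expR (- k * omega e^-1) * wexp omega l0 xi].
Proof.
move=> l0_gt0 tchi chioo.
have [//|H] := pselect (exists k C e0, [/\ 0 < k, 0 < C, 0 < e0 &
    forall e (xi : 'rV[R]_n), 0 < e < e0 ->
    Normc.normc (fourier (chi \* g e) xi) <=
    C * expR (- k * omega e^-1) * wexp omega l0 xi]).
exfalso.
pose wx (xi : 'rV[R]_n) := wexp omega l0 xi.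
have wx0 xi : 0 < wx xi by exact: expR_gt0.
have Cu e : 0 < e < 1 -> Cc (chi \* g e).
  by move=> e01; apply: (test_function_Cc ((ug e01).2 _ tchi)).
pose F e xi : R[i] := ((wx xi)^-1)%:C%C * fourier (chi \* g e) xi.
pose w (m : nat) (e : R) := expR (- m.+1%:R^-1 * omega e^-1).
have [||m C C0|b [freq [b0 bF]]] := @gliding_hump R _ F (fun e => L1norm (chi \* g e)) w.
- move=> e xi e01; rewrite /F Normc.normcM normcR ?invr_ge0 ?(ltW (wx0 _))//.
  have Iu := Cc_intC (Cu _ e01).
  have := fourier_le xi Iu; rewrite -L1normE// lee_fin; apply: le_trans.
  rewrite ler_piMl ?normc_ge0// invf_le1//; apply: wexp_ge1 => //; exact: ltW.
- by move=> m e; exact: expR_gt0.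
- have m0 : 0 < m.+1%:R^-1 :> R by rewrite invr_gt0.
  apply: contrapT => nH; apply: H; exists m.+1%:R^-1, C, m.+1%:R^-1; split => // e xi e0.
  rewrite leNgt; apply/negP => lt1; apply: nH; exists e, xi; split => //.
  rewrite /F Normc.normcM normcR ?invr_ge0 ?(ltW (wx0 _))//.
  by rewrite [leRHS]mulrC ler_pdivlMr// ltW.
have trho := modulated_test_function womega l0_gt0 tchi chioo freq b0.
have [l l_gt0 small] := gneg trho.
have := small 1 ltr01 => -[r /= r0 rP].
(* e_m < 1/(m+1) lies in the range of the bound, and the rate 1/(m+1) is slower than l *)
have [m [ml mr]] : exists m : nat, m.+1%:R^-1 <= l /\ m.+1%:R^-1 <= r.
  have lr0 : 0 < Num.min l r by rewrite lt_min l_gt0.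
  have := @near_infty_natSinv_lt R (PosNum lr0).
  case=> N _ /(_ N (leqnn N)) /= ; rewrite lt_min => /andP[h1 h2].
  by exists N; split; exact: ltW.
have [e /andP[e0 em] eN] := bF m.
have er : e < r := lt_le_trans em mr.
have e01 : 0 < e < 1.
  by rewrite e0 (lt_le_trans em)// invf_le1 ?ler1n ?ltr0n.
have om0 : 0 <= omega e^-1 by apply: (weight_ge0 womega); rewrite invr_ge0 ltW.
set c := fun j => b j / wexp omega l0 (freq j) in trho small rP.
have up : Normc.normc (pairing (g e) (fun x => chi x * trig_series c freq x)) <= w m e.
  have := rP e; rewrite /ball_ /= sub0r normrN gtr0_norm// => /(_ er e0).
  rewrite lee_fin mul1r => H1; apply: le_trans H1 _.
  by rewrite ler_expR !mulNr lerN2 ler_wpM2r.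
have PE : pairing (g e) (fun x => chi x * trig_series c freq x) =
    integralC (fun x => (chi \* g e) x * trig_series c freq x).
  by congr integralC; apply/funext => x /=; ring.
have [N0 NP] := half_exp_small (4 * L1norm (chi \* g e))
  (divr_gt0 (expR_gt0 (- m.+1%:R^-1 * omega e^-1)) (ltr0n R 2)).
pose N := maxn N0 m.+1.
have := integralC_trig_series freq (normalized_coeff womega l0_gt0 freq b0) N (Cu _ e01).
rewrite -PE.
have -> : \sum_(j < N) (b j / wexp omega l0 (freq j))%:C%C * fourier (chi \* g e) (freq j) =
    \sum_(j < N) (b j)%:C%C * F e (freq j).
  by apply: eq_bigr => j _; rewrite /F mulrA -rmorphM.
set S := \sum_(j < N) _; set P := pairing _ _ => PS.
have Sge : 2 * w m e <= Normc.normc S by apply: eN; rewrite leq_max ltnSn orbT.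
have SP : Normc.normc S <= Normc.normc P + Normc.normc (P - S).
  by have := ler_normcD P (- (P - S)); rewrite normcN opprB addrCA subrr addr0.
have NPN := NP N (leq_maxl _ _).
have w0 : 0 < w m e by exact: expR_gt0.
have : Normc.normc (P - S) <= w m e / 2.
  by apply: le_trans PS _; apply: le_trans NPN; rewrite le_eqVlt; apply/orP; left; apply/eqP; ring.
move: Sge SP up; rewrite -/P; lra.
Qed.

End uniform_bound.

(** * Differences of ultradifferentiable functions *)

Lemma near_eq_continuous_at (T U : topologicalType) (f g : T -> U) (x : T) :
  (\forall y \near x, f y = g y) -> {for x, continuous f} -> {for x, continuous g}.
Proof.
move=> fg cf; rewrite /prop_for /continuous_at -(nbhs_singleton fg).
by apply: cvg_trans cf; exact: near_eq_cvg.
Qed.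

Section smooth_sub.
Context {R : realType} {n : nat}.
Variable Omega : set 'rV[R]_n.
Hypothesis oO : open Omega.
Implicit Types u v : 'rV[R]_n -> R.

(** [Ck] on an open set depends only on the values there. The derivative of a difference is the
    difference of the derivatives only on that set, hence the need for this. *)
Lemma Ck_eq k u v : (forall x, Omega x -> u x = v x) -> Ck k Omega u -> Ck k Omega v.
Proof.
have nearO w w' : (forall x, Omega x -> w x = w' x :> R) ->
    forall x, Omega x -> \forall y \near x, w y = w' y.
  move=> ww x Ox; have : nbhs x Omega by exact: open_nbhs_nbhs.
  by apply: filterS => y; exact: ww.
have cont w w' : (forall x, Omega x -> w x = w' x :> R) ->
    (forall x, Omega x -> {for x, continuous w}) ->
    forall x, Omega x -> {for x, continuous w'}.
  move=> ww cw x Ox; exact: near_eq_continuous_at (nearO _ _ ww x Ox) (cw x Ox).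
elim: k u v => [|k IH] u v uv [cu du]; split; try exact: cont cu.
  by [].
move=> i; have [dui Du] := du i; split.
  by move=> x Ox; apply: near_eq_derivable (dui x Ox); exact: nearO.
apply: IH Du => x Ox; apply: near_eq_derive; exact: nearO.
Qed.

Lemma CkB k u v : Ck k Omega u -> Ck k Omega v -> Ck k Omega (fun x => u x - v x).
Proof.
have cont w w' : (forall x, Omega x -> {for x, continuous w}) ->
    (forall x, Omega x -> {for x, continuous w'}) ->
    forall x, Omega x -> {for x, continuous (fun x => w x - w' x : R)}.
  move=> cw cw' x Ox; have c1 := cw x Ox; have c2 := cw' x Ox.
  exact: continuousB c1 c2.
elim: k u v => [|k IH] u v [cu du] [cv dv]; split => //; try exact: cont.
move=> i; have [dui Du] := du i; have [dvi Dv] := dv i; split.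
  by move=> x Ox; apply: derivableB; [exact: dui|exact: dvi].
apply: (Ck_eq _ (IH _ _ Du Dv)) => x Ox.
by rewrite -deriveB; [|exact: dui|exact: dvi].
Qed.

Lemma smoothB (f g : 'rV[R]_n -> R[i]) : smooth Omega f -> smooth Omega g ->
  smooth Omega (f \- g).
Proof.
move=> sf sg k; have [fR fI] := sf k; have [gR gI] := sg k.
have RE : (fun x => complex.Re ((f \- g) x)) = (fun x => complex.Re (f x) - complex.Re (g x)).
  by apply/funext => x /=; case: (f x); case: (g x).
have IE : (fun x => complex.Im ((f \- g) x)) = (fun x => complex.Im (f x) - complex.Im (g x)).
  by apply/funext => x /=; case: (f x); case: (g x).
by rewrite RE IE; split; exact: CkB.
Qed.

End smooth_sub.

Section nets.
Context {R : realType} {n : nat}.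
Local Notation mu := (lebesgue_rV R n).
Variables (omega : R -> R) (Omega : set 'rV[R]_n).
Hypotheses (womega : weight omega) (oO : open Omega).
Implicit Types (f chi psi rho : 'rV[R]_n -> R[i]) (K : set 'rV[R]_n).

Lemma wnormB l f g : Cc f -> Cc g ->
  (wnorm omega l (fun x => f x - g x)%R <= wnorm omega l f + wnorm omega l g)%E.
Proof.
move=> Cf Cg; rewrite -(wnormN omega l (Cc_intC Cg)).
by apply: wnormD => //; apply: Cc_intC => //; exact: Cc_opp.
Qed.

Lemma test_functionB f g : test_function omega Omega f -> test_function omega Omega g ->
  test_function omega Omega (f \- g).
Proof.
move=> tf tg; have Cf := test_function_Cc tf; have Cg := test_function_Cc tg.
have [_ csf sfO [l l0 fl]] := tf; have [_ csg sgO [m m0 gm]] := tg.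
have ss : supp (f \- g) `<=` supp f `|` supp g.
  rewrite /supp -closureU; apply: closure_subset => x /= fgx.
  have [fx|fx] := eqVneq (f x) 0; last by left.
  by right; move: fgx; rewrite fx sub0r oppr_eq0.
split.
- by apply/complex_continuousP; case: (Cc_add Cf (Cc_opp Cg)).
- apply: subclosed_compact ss; first exact: closed_closure.
  exact: compactU.
- by apply: subset_trans ss _ => x [/sfO|/sgO].
exists (Num.min l m); first by rewrite lt_min l0.
apply: (le_lt_trans (wnormB (Num.min l m) Cf Cg)).
apply: lte_add_pinfty.
  by apply: le_lt_trans fl; apply: le_wnorm => //; [exact: Cc_measC|rewrite ge_min lexx].
by apply: le_lt_trans gm; apply: le_wnorm => //; [exact: Cc_measC|rewrite ge_min lexx orbT].
Qed.

Lemma ultradifferentiableB f g : ultradifferentiable omega Omega f ->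
  ultradifferentiable omega Omega g -> ultradifferentiable omega Omega (f \- g).
Proof.
move=> [sf tf] [sg tg]; split; first exact: smoothB.
move=> psi tpsi; rewrite (_ : psi \* (f \- g) = (psi \* f) \- (psi \* g)).
  by apply: test_functionB; [exact: tf|exact: tg].
by apply/funext => x /=; rewrite mulrBr.
Qed.

Lemma le_wnormK K l l' f : ultradifferentiable omega Omega f -> l <= l' ->
  (wnormK omega Omega K l f <= wnormK omega Omega K l' f)%E.
Proof.
move=> uf ll; apply: le_ereal_inf_tmp => _ [psi [tpsi psi1] <-].
apply: le_trans (wnormK_le l f tpsi psi1) _; apply: le_wnorm => //.
exact: (Cc_measC (test_function_Cc (uf.2 _ tpsi))).
Qed.

(** * Negligible nets *)

Lemma near_right0P (P : R -> Prop) :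
  (\forall e \near 0^'+, P e) <-> exists2 r : R, 0 < r & forall e, 0 < e < r -> P e.
Proof.
split=> [[r /= r0 rP]|[r r0 rP]].
  exists r => // e /andP[e0 er]; apply: rP => //.
  by rewrite /ball_/= sub0r normrN gtr0_norm.
exists r => //= e; rewrite /ball_/= sub0r normrN => er e0; apply: rP.
by rewrite e0 (le_lt_trans (ler_norm _)).
Qed.

(** The moderate bound makes the infimum over the cutoffs finite, hence the set of cutoffs nonempty. *)
Lemma cutoff_exists (g : net) K : moderate_net omega Omega g -> compact K -> K `<=` Omega ->
  exists2 chi, test_function omega Omega chi & forall x, K x -> chi x = 1.
Proof.
move=> [_ mg] cK KO; have [h h0 /(_ 1 ltr01)/near_right0P[r r0 rP]] := mg K cK KO 1 ltr01.
have e0 : 0 < r / 2 < r by lra.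
have : (wnormK omega Omega K h (g (r / 2)%R) < +oo)%E.
  by apply: le_lt_trans (rP _ e0) _; rewrite ltry.
by move=> /ereal_inf_lt[_ [chi [tchi chi1] _] _]; exists chi.
Qed.

(** The sup norm is controlled by the L^1 norm of the transform, by inversion. *)
Lemma normc_le_fourier f x : Cc f ->
  ((@fejer_mass R n * Normc.normc (f x))%:E <=
   \int[mu]_xi (Normc.normc (fourier f xi))%:E)%E.
Proof.
move=> Cf; have k0 := ltW (@fejer_mass_gt0 R n).
have [foo|] := ltP (\int[mu]_xi (Normc.normc (fourier f xi))%:E)%E +oo%E; last first.
  by rewrite leye_eq => /eqP ->; rewrite leey.
rewrite -{1}(normcR k0) -Normc.normcM fourier_inversion//.
have If : intC (fourier f) by split => //; exact: measC_fourier (Cc_measC Cf).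
apply: le_trans (normc_integralC (intCM_cis (measurable_dotr x) If)) _.
by under eq_integral do rewrite Normc.normcM normc_cis mulr1.
Qed.

(** On the support of [rho] the function [f] agrees with [psi f], which is bounded through its
    transform. *)
Lemma pairing_le_wnormK rho : test_function omega Omega rho ->
  exists2 C : R, 0 < C & forall h f, 0 <= h -> ultradifferentiable omega Omega f ->
    ((Normc.normc (pairing f rho))%:E <= C%:E * wnormK omega Omega (supp rho) h f)%E.
Proof.
move=> trho; have Crho := test_function_Cc trho; have Irho := Cc_intC Crho.
have k0 := @fejer_mass_gt0 R n.
have L0 : 0 <= L1norm rho.
  by rewrite fine_ge0//; apply: integral_ge0 => x _; rewrite lee_fin normc_ge0.
pose C := (@fejer_mass R n)^-1 * L1norm rho + 1.
have kL0 : 0 <= (@fejer_mass R n)^-1 * L1norm rho by rewrite mulr_ge0// invr_ge0 ltW.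
have C0 : 0 < C by rewrite ltr_wpDl.
exists C => // h f h0 uf.
rewrite -lee_pdivrMl//; apply: le_ereal_inf_tmp => _ [psi [tpsi psi1] <-].
rewrite lee_pdivrMl//.
have CF := test_function_Cc (uf.2 _ tpsi); set F := psi \* f in CF *.
have -> : pairing f rho = integralC (fun x => rho x * F x).
  congr integralC; apply/funext => x /=; rewrite /F /=.
  have [->|rx] := eqVneq (rho x) 0; first by rewrite mulr0 mul0r.
  by rewrite psi1 ?mul1r 1?mulrC//; apply: subset_closure.
(* an infinite norm makes the bound trivial *)
have [Foo|] := ltP (wnorm omega h F) +oo%E; last first.
  by rewrite leye_eq => /eqP ->; rewrite gt0_muley ?lte_fin// leey.
have W0 := wnorm_ge0 omega h F.
pose W := fine (wnorm omega h F).
have WE : W%:E = wnorm omega h F by rewrite fineK// ge0_fin_numE.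
have W0' : 0 <= W by rewrite -lee_fin WE.
have supF x : Normc.normc (F x) <= (@fejer_mass R n)^-1 * W.
  rewrite ler_pdivlMl// -lee_fin WE; apply: le_trans (normc_le_fourier x CF) _.
  apply: le_trans (le_wnorm (n := n) womega (Cc_measC CF) h0).
  rewrite le_eqVlt; apply/orP; left; apply/eqP; apply: eq_integral => xi _.
  by rewrite -/(wexp omega 0 xi) wexp0 mulr1.
have Irf : intC (fun x => rho x * F x) by apply: Cc_intC; exact: Cc_mul.
apply: le_trans (normc_integralC Irf) _.
apply: (@le_trans _ _ (\int[mu]_x ((Normc.normc (rho x))%:E * ((@fejer_mass R n)^-1 * W)%:E))%E).
  apply: ge0_le_integral => //.
  - by move=> x _; rewrite lee_fin normc_ge0.
  - by apply/measurable_EFinP; apply: measurable_normc; exact: Irf.1.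
  - apply: emeasurable_funM => //; apply/measurable_EFinP; apply: measurable_normc.
    exact: Irho.1.
  - by move=> x _; rewrite -EFinM lee_fin Normc.normcM ler_wpM2l ?normc_ge0.
rewrite ge0_integralZr//; last 3 first.
- by apply/measurable_EFinP; apply: measurable_normc; exact: Irho.1.
- by move=> x _; rewrite lee_fin normc_ge0.
- by rewrite lee_fin mulr_ge0// invr_ge0 ltW.
rewrite -L1normE// -WE -!EFinM lee_fin mulrA ler_wpM2r// (mulrC (L1norm _)).
by rewrite lerDl.
Qed.

Lemma omega_inv_large (A : R) : exists2 r : R, 0 < r &
  forall e, 0 < e < r -> A <= omega e^-1.
Proof.
have [T T0 TP] := omega_cvg_pinfty womega A.
exists (T + 1)^-1; first by rewrite invr_gt0 ltr_wpDl.
move=> e /andP[e0 er]; apply: TP.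
have : T + 1 <= e^-1.
  by rewrite -[leLHS]invrK lef_pV2 ?posrE ?invr_gt0 ?ltr_wpDl// ltW.
by apply: le_trans; rewrite lerDl.
Qed.

(** Half of the rate [k + k] is spent on absorbing the constants [D] and [c], because [omega(1/e)] tends
    to infinity. *)
Lemma small_o_exp (N : R -> \bar R) (D k : R) : 0 < k -> 0 <= D ->
  (\forall e \near 0^'+, (N e <= (D * expR (- (k + k) * omega e^-1))%:E)%E) ->
  small_o N (fun e => expR (- k * omega e^-1)).
Proof.
move=> k0 D0 /near_right0P[r r0 rP] c c0; apply/near_right0P.
have [s s0 sP] := omega_inv_large (k^-1 * (D / c)).
exists (Num.min r s); first by rewrite lt_min r0.
move=> e; rewrite lt_min => /and3P[e0 er es].
apply: le_trans (rP _ _) _; first by rewrite e0.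
rewrite lee_fin opprD mulrDl expRD mulrA ler_wpM2r ?expR_ge0//.
rewrite mulNr expRN ler_pdivrMr ?expR_gt0//.
have : k^-1 * (D / c) <= omega e^-1 by apply: sP; rewrite e0.
rewrite ler_pdivrMl// ler_pdivrMr// mulrC => H; apply: le_trans H _.
by rewrite ler_wpM2l ?(ltW c0)// (le_trans _ (expR_ge1Dx _))// lerDr.
Qed.

(** A single cutoff [chi] serves both nets, so the K-norm of the difference is bounded by the norms
    over [supp chi] of the two terms. *)
Lemma negligible_netB (f g : R -> 'rV[R]_n -> R[i]) :
  (forall K, compact K -> K `<=` Omega ->
    exists2 chi, test_function omega Omega chi & forall x, K x -> chi x = 1) ->
  negligible_net omega Omega f -> negligible_net omega Omega g ->
  negligible_net omega Omega (fun e => f e \- g e).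
Proof.
move=> cut [uf nf] [ug ng]; split.
  by move=> e e01; apply: ultradifferentiableB; [exact: uf|exact: ug].
move=> K cK KO; have [chi tchi chi1] := cut K cK KO.
have [_ csupp suppO _] := tchi.
have [l0 [C [l00 C0 CP]]] := wnorm_le_wnormK womega tchi.
have [k1 k10 [h1 h10 small1]] := nf _ csupp suppO.
have [k2 k20 [h2 h20 small2]] := ng _ csupp suppO.
pose l := Num.min l0 (Num.min h1 h2).
have l_gt0 : 0 < l by rewrite !lt_min l00 h10 h20.
have ll0 : l <= l0 by rewrite ge_min lexx.
have lh1 : l <= h1 by rewrite !ge_min lexx orbT.
have lh2 : l <= h2 by rewrite !ge_min lexx !orbT.
exists (Num.min k1 k2); first by rewrite lt_min k10.
exists l => // c c0.
have c'0 : 0 < c / (2 * C) by rewrite divr_gt0// mulr_gt0.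
have /near_right0P[r1 r10 r1P] := small1 _ c'0.
have /near_right0P[r2 r20 r2P] := small2 _ c'0.
apply/near_right0P; exists (Num.min 1 (Num.min r1 r2)).
  by rewrite !lt_min ltr01 r10.
move=> e; rewrite !lt_min => /and4P[e0 e1 er1 er2].
have e01 : 0 < e < 1 by rewrite e0.
have om0 : 0 <= omega e^-1 by apply: (weight_ge0 womega); rewrite invr_ge0 ltW.
apply: le_trans (wnormK_le l (f e \- g e) tchi chi1) _.
have -> : chi \* (f e \- g e) = (fun x => (chi \* f e) x - (chi \* g e) x).
  by apply/funext => x /=; rewrite mulrBr.
have Cf := test_function_Cc ((uf e e01).2 _ tchi).
have Cg := test_function_Cc ((ug e e01).2 _ tchi).
apply: le_trans (wnormB l Cf Cg) _.
have B (h k r : R) (u : R -> 'rV[R]_n -> R[i]) : l <= h -> Num.min k1 k2 <= k ->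
    0 < e < r -> ultradifferentiable omega Omega (u e) ->
    (forall e, 0 < e < r -> (wnormK omega Omega (supp chi) h (u e) <=
       (c / (2 * C) * expR (- k * omega e^-1))%:E)%E) ->
    (wnorm omega l (chi \* u e)%R <= (c / 2 * expR (- Num.min k1 k2 * omega e^-1))%:E)%E.
  move=> lh kk er uu uP; apply: le_trans (CP _ _ (ltW l_gt0) ll0 uu) _.
  rewrite -lee_pdivlMl//; apply: le_trans (le_wnormK _ uu lh) _.
  apply: le_trans (uP _ er) _; rewrite -EFinM lee_fin mulrA.
  have -> : C^-1 * (c / 2) = c / (2 * C) by field; rewrite gt_eqF.
  by rewrite ler_wpM2l ?(ltW c'0)// ler_expR !mulNr lerN2 ler_wpM2r.
have Bf := B h1 k1 r1 f lh1 _ _ (uf e e01) r1P.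
have Bg := B h2 k2 r2 g lh2 _ _ (ug e e01) r2P.
apply: le_trans (leeD (Bf _ _) (Bg _ _)) _.
- by rewrite ge_min lexx.
- by rewrite e0.
- by rewrite ge_min lexx orbT.
- by rewrite e0.
by rewrite -EFinD lee_fin -mulrDl -splitr.
Qed.

End nets.

Section regular.
Context {R : realType} {n : nat}.
Local Notation mu := (lebesgue_rV R n).
Variables (omega : R -> R) (Omega : set 'rV[R]_n).
Hypotheses (womega : weight omega) (oO : open Omega).

(** Here [E] stands for the modulus of a transform, [W] for [omega(|xi|)], [L] for [omega(1/e)]. If
    [W <= s * L], the decay in [L] wins against the growth in [W]: the value of [s] leaves
    [exp(- k L / 2)] and still a factor [exp(- W)] for integrability. If [s * L < W], half of the weight
    [exp(l W)] is converted into decay in [L]. *)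
Lemma interpolation_le (L W E a l C k s : R) : 0 <= L -> 0 <= W -> 0 < a -> 0 < l -> 0 < k ->
  0 <= C -> 0 <= E ->
  E <= C * expR (- k * L) * expR (a * W) ->
  s = k / (2 * (a + l / 2 + 1)) ->
  E * expR (l / 2 * W) <=
    C * expR (- (k / 2) * L) * expR (- 1 * W) +
    expR (- (l / 2 * s) * L) * (E * expR (l * W)).
Proof.
move=> L0 W0 a0 l0 k0 C0 E0 EC sE.
have d0 : 0 < a + l / 2 + 1 by lra.
have sd : (a + l / 2 + 1) * s = k / 2 by rewrite sE; field; rewrite gt_eqF//; lra.
have [WL|WL] := leP W (s * L).
  apply: (@le_trans _ _ (C * expR (- (k / 2) * L) * expR (- 1 * W))); last first.
    by rewrite lerDl mulr_ge0 ?expR_ge0// mulr_ge0 ?expR_ge0.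
  apply: (@le_trans _ _ (C * expR (- k * L) * expR (a * W) * expR (l / 2 * W))).
    by rewrite ler_wpM2r ?expR_ge0.
  rewrite -!mulrA ler_wpM2l// -!expRD ler_expR.
  have : (a + l / 2 + 1) * W <= k / 2 * L.
    by rewrite -sd -mulrA ler_wpM2l// ltW.
  lra.
apply: (@le_trans _ _ (expR (- (l / 2 * s) * L) * (E * expR (l * W)))); last first.
  by rewrite lerDr mulr_ge0 ?expR_ge0// mulr_ge0 ?expR_ge0.
rewrite mulrCA ler_wpM2l// -expRD ler_expR.
have l20 : 0 <= l / 2 by lra.
have := ler_wpM2l l20 (ltW WL); lra.
Qed.

(** Take a cutoff [chi] and let [F] be the transform of [chi g_e]. Regularity bounds the integral of
    [|F| exp(l omega)], for one [l], by [exp(j omega(1/e))] with [j] as small as wanted, and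
    [uniform_fourier_bound] bounds [|F|] pointwise. Integrating [interpolation_le] gives a negative
    exponent of [omega(1/e)], since [j] is chosen as half of the gain [l s / 2]. *)
Lemma regular_negligible (g : R -> 'rV[R]_n -> R[i]) :
  moderate_net omega Omega g -> regular_net omega Omega g ->
  (forall rho : 'rV[R]_n -> R[i], test_function omega Omega rho ->
    negligible_numbers omega (fun e => pairing (g e) rho)) ->
  negligible_net omega Omega g.
Proof.
move=> mg rg gneg; split; first exact: mg.1.
move=> K cK KO; have [chi tchi chi1] := cutoff_exists mg cK KO.
have [_ csupp suppO [a a0 chioo]] := tchi.
have [l0 [C [l00 C0 CP]]] := wnorm_le_wnormK womega tchi.
have [h h0 hP] := rg _ csupp suppO.
have [k [C1 [e0 [k0 C10 e00 UB]]]] := uniform_fourier_bound womega mg.1 gneg a0 tchi chioo.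
pose l := Num.min l0 h; have l_gt0 : 0 < l by rewrite lt_min l00.
pose s := k / (2 * (a + l / 2 + 1)).
have s0 : 0 < s by rewrite divr_gt0// mulr_gt0// !addr_gt0// divr_gt0.
pose j := l / 2 * s / 2.
have j0 : 0 < j by rewrite /j divr_gt0// mulr_gt0// divr_gt0.
have iC0 : 0 < C^-1 by rewrite invr_gt0.
have /near_right0P[r r0 rP] := hP j j0 _ iC0.
pose k' := Num.min (k / 2) j / 2.
have k'0 : 0 < k' by rewrite divr_gt0// lt_min j0 divr_gt0.
exists k' => //; exists (l / 2); first by rewrite divr_gt0.
pose I := fine (\int[mu]_xi (wexp omega (-1) xi)%:E).
have I0' : (0 <= \int[mu]_xi (wexp omega (-1) xi)%:E)%E.
  by apply: integral_ge0 => xi _; rewrite lee_fin wexp_ge0.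
have IE : I%:E = (\int[mu]_xi (wexp omega (-1) xi)%:E)%E.
  by rewrite fineK// ge0_fin_numE// integral_wexpN_lty.
have I0 : 0 <= I by rewrite -lee_fin IE.
apply: (@small_o_exp _ _ womega _ (C1 * I + 1)) => //.
  by rewrite addr_ge0// mulr_ge0// ltW.
apply/near_right0P; exists (Num.min 1 (Num.min e0 r)).
  by rewrite !lt_min ltr01 e00.
move=> e; rewrite !lt_min => /and4P[ep e1 ee0 er].
have e01 : 0 < e < 1 by rewrite ep.
set L := omega e^-1.
have L0 : 0 <= L by apply: (weight_ge0 womega); rewrite invr_ge0 ltW.
have ug := mg.1 e e01.
have Cu := test_function_Cc (ug.2 _ tchi); have mu_ := Cc_measC Cu.
apply: le_trans (wnormK_le (l / 2) (g e) tchi chi1) _.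
set F := fourier (chi \* g e).
(* regularity, at the rate j chosen above *)
have big : (wnorm omega l (chi \* g e)%R <= (expR (j * L))%:E)%E.
  apply: le_trans (CP _ _ (ltW l_gt0) _ ug) _; first by rewrite ge_min lexx.
  rewrite -lee_pdivlMl//; apply: le_trans (le_wnormK womega _ ug (_ : l <= h)) _.
    by rewrite ge_min lexx orbT.
  by rewrite -EFinM rP// ep.
have pt xi : Normc.normc (F xi) * wexp omega (l / 2) xi <=
    C1 * expR (- (k / 2) * L) * wexp omega (-1) xi +
    expR (- (l / 2 * s) * L) * (Normc.normc (F xi) * wexp omega l xi).
  have Fxi : Normc.normc (F xi) <=
      C1 * expR (- k * L) * expR (a * omega (euclidean_norm xi)).
    by apply: UB; rewrite ep.
  exact: (interpolation_le L0 (omega_norm_ge0 womega xi) a0 l_gt0 k0 (ltW C10)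
    (normc_ge0 _) Fxi).
have c1 : 0 <= C1 * expR (- (k / 2) * L) by rewrite mulr_ge0 ?expR_ge0// ltW.
have mw1 := measurable_wexp (n := n) womega (-1).
have ml := measurable_wnorm_arg womega l mu_.
apply: (@le_trans _ _ (\int[mu]_xi ((C1 * expR (- (k / 2) * L))%:E * (wexp omega (-1) xi)%:E +
    (expR (- (l / 2 * s) * L))%:E * (Normc.normc (F xi) * wexp omega l xi)%:E))%E).
  apply: ge0_le_integral => //.
  - by move=> xi _; rewrite lee_fin wnorm_arg_ge0.
  - by apply/measurable_EFinP; exact: (measurable_wnorm_arg womega (l / 2) mu_).
  - apply: emeasurable_funD; apply: emeasurable_funM => //; exact/measurable_EFinP.
  - by move=> xi _; rewrite -!EFinM -EFinD lee_fin; exact: pt.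
rewrite ge0_integralD//; last 4 first.
- by move=> xi _; rewrite -EFinM lee_fin mulr_ge0 ?wexp_ge0.
- by apply: emeasurable_funM => //; exact/measurable_EFinP.
- by move=> xi _; rewrite -EFinM lee_fin mulr_ge0 ?expR_ge0 ?wnorm_arg_ge0.
- by apply: emeasurable_funM => //; exact/measurable_EFinP.
rewrite ge0_integralZl//; last 2 first.
- exact/measurable_EFinP.
- by move=> xi _; rewrite lee_fin wexp_ge0.
rewrite ge0_integralZl; last 4 first.
- by [].
- exact/measurable_EFinP.
- by move=> xi _; rewrite lee_fin wnorm_arg_ge0.
- by rewrite lee_fin expR_ge0.
rewrite -IE -EFinM.
apply: (@le_trans _ _ ((C1 * expR (- (k / 2) * L) * I)%:E +
    (expR (- (l / 2 * s) * L))%:E * (expR (j * L))%:E)%E).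
  by rewrite leeD2l// lee_wpmul2l ?lee_fin ?expR_ge0.
rewrite -EFinM -EFinD lee_fin mulrDl mul1r mulrAC lerD//.
  rewrite ler_wpM2l ?mulr_ge0 ?(ltW C10)// ler_expR !mulNr lerN2 ler_wpM2r//.
  by rewrite /k' -splitr ge_min lexx.
rewrite -expRD ler_expR -mulrDl ler_wpM2r//.
have -> : - (l / 2 * s) + j = - j by rewrite /j; lra.
by rewrite lerN2 /k' -splitr ge_min lexx orbT.
Qed.

End regular.

Theorem theorem8p5 (R : realType) (d : nat) (Omega : set 'rV[R]_d)
    (omega : R -> R) (g : R -> 'rV[R]_d -> R[i]) :
  open Omega ->
  weight omega ->
  moderate_net omega Omega g ->
  regular_gen_functions omega Omega (gen_class omega Omega g) ->
  (forall rho : 'rV[R]_d -> R[i], test_function omega Omega rho ->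
    negligible_numbers omega (fun e => pairing (g e) rho)) ->
  gen_class omega Omega g = gen_zero omega Omega.
Proof.
move=> oO womega mg [_ [g0 [mg0 ngg0] rg0]] gneg.
have cut K : compact K -> K `<=` Omega ->
    exists2 chi, test_function omega Omega chi & forall x, K x -> chi x = 1.
  exact: cutoff_exists mg.
have negB := negligible_netB womega oO cut.
have ng0 : negligible_net omega Omega g0.
  apply: regular_negligible => // rho trho.
  have [l l0 small] := gneg rho trho.
  have [_ csupp suppO _] := trho; have Crho := test_function_Cc trho.
  have [k k0 [h h0 hsmall]] := ngg0.2 _ csupp suppO.
  have [C C0 CP] := pairing_le_wnormK womega trho.
  exists (Num.min l k); first by rewrite lt_min l0.
  move=> c c0; have c20 : 0 < c / 2 by rewrite divr_gt0.
  have cC0 : 0 < C^-1 * (c / 2) by rewrite mulr_gt0// invr_gt0.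
  have /near_right0P[r1 r10 r1P] := small _ c20.
  have /near_right0P[r2 r20 r2P] := hsmall _ cC0.
  apply/near_right0P; exists (Num.min 1 (Num.min r1 r2)).
    by rewrite !lt_min ltr01 r10.
  move=> e; rewrite !lt_min => /and4P[e0 e1 er1 er2].
  have e01 : 0 < e < 1 by rewrite e0.
  have om0 : 0 <= omega e^-1 by apply: (weight_ge0 womega); rewrite invr_ge0 ltW.
  have Ig (u : 'rV[R]_d -> R[i]) : ultradifferentiable omega Omega u -> intC (u \* rho).
    move=> uu; apply: Cc_intC; have := test_function_Cc (uu.2 _ trho).
    by rewrite (_ : rho \* u = u \* rho)//; apply/funext => x /=; rewrite mulrC.
  (* g0 differs from g by a negligible net, whose pairings are negligible *)
  have -> : pairing (g0 e) rho = pairing (g e) rho + -1 * pairing (g e \- g0 e) rho.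
    rewrite /pairing -integralCZl; last exact: Ig (ngg0.1 e e01).
    rewrite -integralCD; last first.
    - exact: intCZl (Ig _ (ngg0.1 e e01)).
    - exact: Ig (mg.1 e e01).
    by congr integralC; apply/funext => x /=; ring.
  rewrite mulN1r; apply: (@le_trans _ _ ((Normc.normc (pairing (g e) rho))%:E +
      (Normc.normc (pairing (g e \- g0 e) rho))%:E)%E).
    rewrite -EFinD lee_fin; apply: le_trans (ler_normcD _ _) _.
    by rewrite normcN.
  apply: (@le_trans _ _ ((c / 2 * expR (- Num.min l k * omega e^-1))%:E +
      (c / 2 * expR (- Num.min l k * omega e^-1))%:E)%E); last first.
    by rewrite -EFinD lee_fin -mulrDl -splitr.
  apply: leeD.
    apply: le_trans (r1P _ _) _; first by rewrite e0.
    by rewrite lee_fin ler_wpM2l ?(ltW c20)// ler_expR !mulNr lerN2 ler_wpM2r// ge_min lexx.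
  apply: le_trans (CP _ _ (ltW h0) (ngg0.1 e e01)) _.
  rewrite -lee_pdivlMl//; apply: le_trans (r2P _ _) _; first by rewrite e0.
  rewrite -EFinM lee_fin [leRHS]mulrA ler_wpM2l ?(ltW cC0)//.
  by rewrite ler_expR !mulNr lerN2 ler_wpM2r// ge_min lexx orbT.
(* closure under differences yields 0 = u - u, hence closure under opposites *)
have zeroB (u : R -> 'rV[R]_d -> R[i]) : negligible_net omega Omega u ->
    negligible_net omega Omega (fun e => (fun=> 0) \- u e).
  move=> nu; have n0 := negB _ _ nu nu.
  have -> : (fun e => (fun=> 0) \- u e) = (fun e => (u e \- u e) \- u e).
    by apply/funext => e; apply/funext => x /=; rewrite subrr.
  exact: (negB _ _ n0 nu).
have ng : negligible_net omega Omega g.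
  have -> : g = (fun e => (g e \- g0 e) \- ((fun=> 0) \- g0 e)).
    by apply/funext => e; apply/funext => x /=; ring.
  exact: (negB _ _ ngg0 (zeroB _ ng0)).
apply/seteqP; split=> [u [mu_ ngu]|u [mu_ n0u]]; split; [exact: mu_| |exact: mu_|].
  have -> : (fun e => (fun=> 0) \- u e) = (fun e => (g e \- u e) \- g e).
    by apply/funext => e; apply/funext => x /=; ring.
  exact: (negB _ _ ngu ng).
have -> : (fun e => g e \- u e) = (fun e => ((fun=> 0) \- u e) \- ((fun=> 0) \- g e)).
  by apply/funext => e; apply/funext => x /=; ring.
exact: (negB _ _ n0u (zeroB _ ng)).
Qed.
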